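(* Let $M\subset\mathbb{C}^N$ and $M'\subset\mathbb{C}^{N'}$ be connected generic real ($C^\infty$) submanifolds, $p_0\in M$, such that $M$ is of finite type at $p_0$. There exists an integer $K$ such that the following holds: if $H:U\to\mathbb{C}^{N'}$ is a holomorphic map defined on some neighbourhood $U$ of $p_0$ with $H(U\cap M)\subset M'$ and such that $H$ is $k_0$-nondegenerate at $p_0$, and $H'$ is another holomorphic map defined on some neighbourhood $U'$ of $p_0$ with $H'(U'\cap M)\subset M'$ and $$\frac{\partial^{|\alpha|}H}{\partial Z^\alpha}(p_0)=\frac{\partial^{|\alpha|}H'}{\partial Z^\alpha}(p_0),\qquad |\alpha|\le Kk_0,$$ then $H=H'$ near $p_0$.
   Context: A real submanifold $M\subset\mathbb{C}^N$ of codimension $d$ is generic if near each point it has real defining functions $\rho_1,\dots,\rho_d$ with $\partial\rho_1\wedge\dots\wedge\partial\rho_d\neq0$ on $M$; $n=N-d$. $M$ is of finite type at $p$ (Kohn–Bloom–Graham) if the CR and anti-CR vector fields tangent to $M$ together with their commutators of all lengths span the complexified tangent space of $M$ at $p$. Nondegeneracy: let $\rho'_1,\dots,\rho'_{d'}$ be local defining functions for $M'$ near $H(p_0)$ ($d'$ the codimension of $M'$), $\rho'_{j,Z'}=(\partial\rho'_j/\partial Z'_1,\dots,\partial\rho'_j/\partial Z'_{N'})$ the complex gradient, and $L_1,\dots,L_n$ a local basis of the CR-vector fields on $M$ (type $(0,1)$) near $p_0$. For $\alpha\in\mathbb{N}^n$ put $L^\alpha=L_1^{\alpha_1}\cdots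 L_n^{\alpha_n}$, and set $$E'_k(p_0)=\operatorname{span}_{\mathbb{C}}\{L^\alpha\rho'_{j,Z'}(H(Z),\overline{H(Z)})|_{Z=p_0}:|\alpha|\le k,\ 1\le j\le d'\}\subset\mathbb{C}^{N'}.$$ $H$ is $k_0$-nondegenerate at $p_0$ if $\max_k\dim_{\mathbb{C}}E'_k(p_0)=N'$ and $k_0$ is the least $k$ for which $E'_k(p_0)=\mathbb{C}^{N'}$. (This does not depend on the choices made.) *)

(* Defs.v *)
(* MathComp-Analysis; the complex field over [R : realType] is [R[i]], from
   mathcomp-real-closed, and C^N is ['rV[R[i]]_N]. *)
From HB Require Import structures.
From mathcomp Require Import all_boot all_order all_algebra.
From mathcomp Require Import all_classical all_reals all_analysis.
From mathcomp Require Import complex.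

Set Implicit Arguments.
Unset Strict Implicit.
Unset Printing Implicit Defensive.

Import Order.TTheory GRing.Theory Num.Theory.
Import numFieldNormedType.Exports.

Local Open Scope classical_set_scope.
Local Open Scope ring_scope.

(* R[i] with the topology of its modulus and its structure of normed space
   over itself. *)
HB.instance Definition _ (R : realType) := GRing.ComAlgebra.copy R[i] R[i]^o.
HB.instance Definition _ (R : realType) := Vector.copy R[i] R[i]^o.
HB.instance Definition _ (R : realType) := NormedModule.copy R[i] R[i]^o.

(* For [D i] the derivation along the [i]-th direction, this is
   D_0^(a 0) D_1^(a 1) ... D_(n-1)^(a (n-1)) f. *)
Definition multi_iter (T : Type) (n : nat) (D : 'I_n -> T -> T)
    (a : 'I_n -> nat) (f : T) : T :=
  foldr (fun i g => iter (a i) (D i) g) f (enum 'I_n).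

Section RealCalculus.
Context {R : realType} {N : nat}.
Notation C := R[i].
Implicit Types (f : 'rV[C]_N -> C) (Z v : 'rV[C]_N) (U : set 'rV[C]_N).

(* The library's ['D_v f] on C^N is the complex derivative.  Derivatives in the
   sense of R^(2N) are taken along t |-> Z + t v with t real, on the real and
   imaginary parts of f. *)
Definition real_derivable f Z v : Prop :=
  derivable (fun t : R => complex.Re (f (Z + t%:C%C *: v))) 0 1 /\
  derivable (fun t : R => complex.Im (f (Z + t%:C%C *: v))) 0 1.

Definition real_derive v f Z : C :=
  (derive1 (fun t : R => complex.Re (f (Z + t%:C%C *: v))) 0 +i*
   derive1 (fun t : R => complex.Im (f (Z + t%:C%C *: v))) 0)%C.

(* C^infinity: all iterated real directional derivatives exist and are
   continuous on U. *)
Definition smooth_on U f : Prop :=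
  forall (vs : seq 'rV[C]_N) Z, U Z ->
    let g := foldr real_derive f vs in
    {for Z, continuous g} /\ forall v, real_derivable g Z v.

Definition dZ (k : 'I_N) f Z : C :=
  (real_derive (delta_mx 0 k) f Z
   - 'i%C * real_derive ('i%C *: delta_mx 0 k) f Z) / 2%:R.

Definition dZbar (k : 'I_N) f Z : C :=
  (real_derive (delta_mx 0 k) f Z
   + 'i%C * real_derive ('i%C *: delta_mx 0 k) f Z) / 2%:R.

Definition complex_gradient (rho : 'rV[C]_N -> R) Z : 'rV[C]_N :=
  \row_k dZ k (fun W => (rho W)%:C%C) Z.

End RealCalculus.

(* [(a, b)] stands for sum_k a_k d/dZ_k + sum_k b_k d/dZbar_k. *)
Notation cvector R N := ('rV[R[i]]_N * 'rV[R[i]]_N)%type.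
Notation cfield R N := ('rV[R[i]]_N -> cvector R N).

Section VectorFields.
Context {R : realType} {N : nat}.
Notation C := R[i].

Definition vector_apply (Z : 'rV[C]_N) (v : cvector R N) (f : 'rV[C]_N -> C) : C :=
  \sum_k (v.1 0 k * dZ k f Z + v.2 0 k * dZbar k f Z).

Definition field_apply (X : cfield R N) (f : 'rV[C]_N -> C) : 'rV[C]_N -> C :=
  fun Z => vector_apply Z (X Z) f.

Definition bracket (X Y : cfield R N) : cfield R N := fun Z =>
  (\row_k (field_apply X (fun W => (Y W).1 0 k) Z
           - field_apply Y (fun W => (X W).1 0 k) Z),
   \row_k (field_apply X (fun W => (Y W).2 0 k) Z
           - field_apply Y (fun W => (X W).2 0 k) Z)).

Definition smooth_field (V : set 'rV[C]_N) (X : cfield R N) : Prop :=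
  forall k, smooth_on V (fun Z => (X Z).1 0 k) /\
            smooth_on V (fun Z => (X Z).2 0 k).

End VectorFields.

Section Submanifolds.
Context {R : realType} {N : nat}.
Notation C := R[i].
Implicit Types (M U V : set 'rV[C]_N) (Z p : 'rV[C]_N).

(* The d-form del rho_1 /\ ... /\ del rho_d at Z, evaluated on d vectors of
   C^N, the columns of W. *)
Definition gradient_wedge (d : nat) (rho : 'I_d -> 'rV[C]_N -> R) Z
    (W : 'M[C]_(N, d)) : C :=
  \det ((\matrix_(j < d) complex_gradient (rho j) Z) *m W).

Definition defining_functions (d : nat) M U (rho : 'I_d -> 'rV[C]_N -> R) : Prop :=
  [/\ forall j, smooth_on U (fun Z => (rho j Z)%:C%C),
      M `&` U = [set Z | forall j, rho j Z = 0] `&` U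
    & forall Z, (M `&` U) Z -> exists W, gradient_wedge rho Z W != 0].

Definition generic_submanifold (d : nat) M : Prop :=
  forall p, M p -> exists U (rho : 'I_d -> 'rV[C]_N -> R),
    open_nbhs p U /\ defining_functions M U rho.

(* The complexified tangent space of M at Z; it does not depend on the
   defining functions. *)
Definition ctangent (d : nat) M Z (v : cvector R N) : Prop :=
  exists U (rho : 'I_d -> 'rV[C]_N -> R),
    [/\ open_nbhs Z U, defining_functions M U rho
      & forall j, vector_apply Z v (fun W => (rho j W)%:C%C) = 0].

(* Vector fields on M near a point are given by smooth extensions to an open
   set V of C^N; being tangent to M and of type (0,1) or (1,0) is only
   required along M.  Neither brackets nor iterated derivatives at points of M
   depend on the extensions. *)
Definition CR_field (d : nat) M V (X : cfield R N) : Prop :=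
  smooth_field V X /\
  forall Z, (M `&` V) Z -> ctangent d M Z (X Z) /\ (X Z).1 = 0.

Definition antiCR_field (d : nat) M V (X : cfield R N) : Prop :=
  smooth_field V X /\
  forall Z, (M `&` V) Z -> ctangent d M Z (X Z) /\ (X Z).2 = 0.

Inductive CR_commutator (d : nat) M V : cfield R N -> Prop :=
| CR_commutator_CR X : CR_field d M V X -> CR_commutator d M V X
| CR_commutator_antiCR X : antiCR_field d M V X -> CR_commutator d M V X
| CR_commutator_bracket X Y : CR_commutator d M V X -> CR_commutator d M V Y ->
    CR_commutator d M V (bracket X Y).

Definition finite_type (d : nat) M p : Prop :=
  exists2 V, open_nbhs p V &
    forall v, ctangent d M p v ->
      exists m (X : 'I_m -> cfield R N) (c : 'I_m -> C),
        (forall i, CR_commutator d M V (X i)) /\ v = \sum_i c i *: X i p.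

Definition CR_basis (d : nat) M V (L : 'I_(N - d) -> cfield R N) : Prop :=
  (forall i, CR_field d M V (L i)) /\
  forall Z, (M `&` V) Z -> forall v, ctangent d M Z v -> v.1 = 0 ->
    exists! c : 'rV[C]_(N - d), v = \sum_i c 0 i *: L i Z.

End Submanifolds.

Arguments CR_basis {R N} d M V L.

Section Maps.
Context {R : realType} {N N' : nat}.
Notation C := R[i].
Implicit Types (H : 'rV[C]_N -> 'rV[C]_N') (p : 'rV[C]_N).

Definition holomorphic_on (U : set 'rV[C]_N) H : Prop :=
  forall Z, U Z -> differentiable H Z.

Definition partial_derivative (a : 'I_N -> nat) H : 'rV[C]_N -> 'rV[C]_N' :=
  multi_iter (fun (k : 'I_N) G => 'D_(delta_mx 0 k) G) a H.

(* L^a rho'_Z'(H(Z), conj(H(Z))) at Z = p. *)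
Definition gradient_jet (n : nat) (L : 'I_n -> cfield R N)
    (rho' : 'rV[C]_N' -> R) H p (a : 'I_n -> nat) : 'rV[C]_N' :=
  \row_l multi_iter (fun i => field_apply (L i)) a
            (fun Z => complex_gradient rho' (H Z) 0 l) p.

(* A multi-index of length at most k has all its entries below k.+1. *)
Definition nondegeneracy_space (n d' : nat) (L : 'I_n -> cfield R N)
    (rho' : 'I_d' -> 'rV[C]_N' -> R) H p (k : nat) : {vspace 'rV[C]_N'} :=
  (\sum_(a : {ffun 'I_n -> 'I_k.+1} | (\sum_i a i <= k)%N) \sum_(j < d')
     <[gradient_jet L (rho' j) H p (fun i => nat_of_ord (a i))]>)%VS.

Definition map_nondegenerate (d d' : nat) (M : set 'rV[C]_N) (M' : set 'rV[C]_N')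
    H p (k0 : nat) : Prop :=
  exists V (L : 'I_(N - d) -> cfield R N) V' (rho' : 'I_d' -> 'rV[C]_N' -> R),
    [/\ open_nbhs p V, CR_basis d M V L,
        open_nbhs (H p) V', defining_functions M' V' rho' &
        let E := nondegeneracy_space L rho' H p in
        [/\ exists k, \dim (E k) = N',
            E k0 = fullv
          & forall k, E k = fullv -> (k0 <= k)%N]].

End Maps.

(* Main.v *)
(* The constant [K = 2 N + 1] works.  Put [h = H - H'].  Hadamard's lemma gives
   smooth [P_jl] with [rho'_j (H) - rho'_j (H') = 2 Re (sum_l P_jl h_l)], and
   this vanishes on [M].  Applying CR fields, which annihilate [h], and solving
   the linear system that nondegeneracy makes invertible, one writes each [h_l],
   modulo functions vanishing on [M], as a combination of conjugates of
   derivatives of [h] of order at most [k0]; fields tangent to [M] that lift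
   d/dZ_k then give the same for the derivatives of order [m], with conjugates
   of derivatives of order at most [m + k0].

   For fields [X_1, ..., X_r], each CR or anti-CR, consider the ideal of the
   functions [u] such that [u (exp (t_r X_r) ... exp (t_1 X_1) p0)] is flat at
   [t = 0].  If [X_(r+1)] is CR it annihilates the derivatives of [h], so that
   these stay in the ideal for [r + 1], and reflection puts their conjugates
   there too, at the cost of [k0] orders of differentiation; anti-CR fields are
   symmetric.  The quotient by the ideal is a domain of formal power series; if
   some [X_(r+1)] does not preserve the ideal, then adding it raises the generic
   rank of the composed flow, which is at most [2 N].  So after at most [2 N]
   steps the ideal contains [h] and is stable under all CR and anti-CR fields,
   hence under their commutators.  By finite type it is then stable under d/dZ_k
   on holomorphic functions, so [h] is flat at [p0]. *)

Require Import Defs.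
From mathcomp Require Import all_boot all_order all_algebra.
From mathcomp Require Import all_classical all_reals all_analysis.
From mathcomp Require Import complex.
From HB Require Import structures.
From mathcomp Require Import ring lra.

Import Order.TTheory GRing.Theory Num.Theory.
Import numFieldNormedType.Exports.
Local Open Scope classical_set_scope.
Local Open Scope ring_scope.

Set Implicit Arguments.
Unset Strict Implicit.
Unset Printing Implicit Defensive.

(** As [M] is only smooth, it cannot be complexified and there are no Segre sets to iterate. The
    formal orbit of [p0] replaces them: a composed flow enters only through the values at [p0] of
    iterated fields applied to functions, so no differential equation is solved. Its generic rank is
    measured by a minor over an iterated power series ring. That ring is a domain of characteristic
    0, which is what permits cancelling a minor once all larger ones vanish. The bound [2 N] on the
    length of a word is the number of derivations d/dZ_k and d/dZbar_k. The jets of [H] and [H'] are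
    used twice: up to order [2 N k0] to start the reflection, and up to order [k0] so that the
    coefficients [P_jl] have at [p0] the jets of the gradient of [rho'_j] along [H]. This second use
    is how nondegeneracy of [H] at [p0] makes the system for [h] solvable nearby. Holomorphy is
    given as complex differentiability. Smoothness comes from Goursat's theorem and a Cauchy formula
    for derivatives; that a flat holomorphic function vanishes is drawn from the mean value
    property, without power series. *)

Local Notation Re := complex.Re.
Local Notation Im := complex.Im.

(** * Gauges *)

Section Gauges.
Context {R : realType}.
Notation C := R[i].

(* Equivalent to the modulus of [R[i]], which is not real-valued. *)
Definition cn (z : C) : R := `|Re z| + `|Im z|.

Lemma cn_ge0 z : 0 <= cn z. Proof. by rewrite addr_ge0. Qed.
Lemma cn0 : cn 0 = 0. Proof. by rewrite /cn normr0 addr0. Qed.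

Lemma cn_eq0 z : cn z <= 0 -> z = 0.
Proof.
move=> z0; have /eqP : cn z = 0 by apply: le_anti; rewrite z0 cn_ge0.
rewrite paddr_eq0 // !normr_eq0 => /andP[/eqP a /eqP b].
by apply/eqP; rewrite eq_complex a b /= !eqxx.
Qed.

Lemma ReD (z w : C) : Re (z + w) = Re z + Re w. Proof. by case: z w => ? ? []. Qed.
Lemma ImD (z w : C) : Im (z + w) = Im z + Im w. Proof. by case: z w => ? ? []. Qed.
Lemma ReN (z : C) : Re (- z) = - Re z. Proof. by case: z. Qed.
Lemma ImN (z : C) : Im (- z) = - Im z. Proof. by case: z. Qed.
Lemma ReMc (z w : C) : Re (z * w) = Re z * Re w - Im z * Im w.
Proof. by case: z w => ? ? []. Qed.
Lemma ImMc (z w : C) : Im (z * w) = Re z * Im w + Im z * Re w.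
Proof. by case: z w => ? ? []. Qed.
Lemma ReJ (z : C) : Re z^*%C = Re z. Proof. by case: z. Qed.
Lemma ImJ (z : C) : Im z^*%C = - Im z. Proof. by case: z. Qed.
Definition ReImE := (ReD, ImD, ReN, ImN, ReMc, ImMc, ReJ, ImJ).

Lemma eqReIm (z w : C) : Re z = Re w -> Im z = Im w -> z = w.
Proof. by move=> a b; apply/eqP; rewrite eq_complex a b !eqxx. Qed.

Lemma cnD z w : cn (z + w) <= cn z + cn w.
Proof.
rewrite /cn !ReImE.
by have := ler_normD (Re z) (Re w); have := ler_normD (Im z) (Im w); lra.
Qed.

Lemma cnN z : cn (- z) = cn z. Proof. by rewrite /cn !ReImE !normrN. Qed.
Lemma cnB z w : cn (z - w) <= cn z + cn w.
Proof. by rewrite -[cn w]cnN cnD. Qed.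
Lemma cnJ z : cn z^*%C = cn z. Proof. by rewrite /cn !ReImE normrN. Qed.

Lemma cnM z w : cn (z * w) <= cn z * cn w.
Proof.
rewrite /cn !ReImE.
have := ler_normB (Re z * Re w) (Im z * Im w).
have := ler_normD (Re z * Im w) (Im z * Re w).
rewrite !normrM; nra.
Qed.

Lemma cnR (x : R) : cn x%:C%C = `|x|. Proof. by rewrite /cn /= normr0 addr0. Qed.
Lemma cnMR (x : R) z : cn (x%:C%C * z) = `|x| * cn z.
Proof. by rewrite /cn !ReImE /= !mul0r subr0 addr0 !normrM mulrDr. Qed.
Lemma cni z : cn ('i%C * z) = cn z.
Proof. by rewrite /cn !ReImE /= !mul0r !mul1r add0r add0r normrN addrC. Qed.

Lemma cn_sum I (s : seq I) (P : pred I) (F : I -> C) :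
  cn (\sum_(i <- s | P i) F i) <= \sum_(i <- s | P i) cn (F i).
Proof.
elim/big_rec2: _ => [|i x y _ h]; first by rewrite cn0.
by apply: le_trans (cnD _ _) _; rewrite lerD2l.
Qed.

Lemma Re_cn z : `|Re z| <= cn z. Proof. by rewrite lerDl. Qed.
Lemma Im_cn z : `|Im z| <= cn z. Proof. by rewrite lerDr. Qed.

Lemma norm_le_cn (z : C) : `|z| <= (cn z)%:C%C.
Proof.
rewrite normc_def lecR /cn.
rewrite -[leRHS]ger0_norm ?addr_ge0 // -sqrtr_sqr ler_sqrt ?sqr_ge0 //.
have h1 := normr_ge0 (Re z); have h2 := normr_ge0 (Im z).
rewrite -(real_normK (num_real (Re z))) -(real_normK (num_real (Im z))) !expr2; nra.
Qed.

Lemma cn_le_norm (z : C) : (cn z)%:C%C <= 2%:R * `|z|.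
Proof.
have h1 := normc_ge_Re z.
have h2 : `|Im z|%:C%C <= `|z|.
  rewrite normc_def lecR -sqrtr_sqr ler_sqrt ?addr_ge0 ?sqr_ge0 //.
  by rewrite lerDr sqr_ge0.
rewrite /cn (rmorphD (real_complex R)) mulr_natl mulr2n; exact: lerD.
Qed.

Definition rn n (w : 'rV[C]_n) : R := \sum_k cn (w 0 k).

Lemma rn_ge0 n (w : 'rV[C]_n) : 0 <= rn w.
Proof. by apply: sumr_ge0 => k _; exact: cn_ge0. Qed.
Lemma rn0 n : rn (0 : 'rV[C]_n) = 0.
Proof. by rewrite /rn big1 // => k _; rewrite mxE cn0. Qed.
Lemma rnD n (v w : 'rV[C]_n) : rn (v + w) <= rn v + rn w.
Proof. by rewrite -big_split; apply: ler_sum => k _; rewrite mxE cnD. Qed.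
Lemma rnN n (w : 'rV[C]_n) : rn (- w) = rn w.
Proof. by apply: eq_bigr => k _; rewrite mxE cnN. Qed.
Lemma rnZ n a (w : 'rV[C]_n) : rn (a *: w) <= cn a * rn w.
Proof. by rewrite /rn mulr_sumr; apply: ler_sum => k _; rewrite mxE cnM. Qed.
Lemma rnZR n (a : R) (w : 'rV[C]_n) : rn (a%:C%C *: w) = `|a| * rn w.
Proof. by rewrite /rn mulr_sumr; apply: eq_bigr => k _; rewrite mxE cnMR. Qed.
Lemma cn_le_rn n (w : 'rV[C]_n) k : cn (w 0 k) <= rn w.
Proof.
by rewrite /rn (bigD1 k) //= lerDl sumr_ge0 // => *; exact: cn_ge0.
Qed.
Lemma C_gt0 (e : C) : 0 < e -> e = (Re e)%:C%C /\ 0 < Re e.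
Proof. by case: e => a b; rewrite ltcE /= => /andP[/eqP ->]. Qed.

Lemma nbhs_CP (z : C) (P : set C) :
  nbhs z P <-> exists2 d : R, 0 < d & forall w, cn (w - z) < d -> P w.
Proof.
split=> [/nbhs_ballP[e /= e0 eP]|[d d0 dP]].
  have [ee e0'] := C_gt0 e0; exists (Re e) => // w wz; apply: eP.
  rewrite -ball_normE /ball_ /= distrC; apply: le_lt_trans (norm_le_cn _) _.
  by rewrite ee ltcR.
apply/nbhs_ballP; exists (d%:C%C / 2%:R) => /=.
  by rewrite divr_gt0 // ltcR.
move=> w; rewrite -ball_normE /ball_ /= distrC ltr_pdivlMr // => wz.
apply: dP; rewrite -ltcR; apply: le_lt_trans (cn_le_norm _) _.
by rewrite mulrC.
Qed.

Lemma nbhs_rVP n (Z : 'rV[C]_n) (P : set 'rV[C]_n) :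
  nbhs Z P <-> exists2 d : R, 0 < d & forall W, rn (W - Z) < d -> P W.
Proof.
split=> [/nbhs_ballP[e /= e0 eP]|[d d0 dP]].
  have [ee e0'] := C_gt0 e0; exists (Re e) => // W wz; apply: eP.
  split=> // i j; rewrite (ord1 i).
  rewrite -ball_normE /ball_ /= distrC; apply: le_lt_trans (norm_le_cn _) _.
  rewrite ee ltcR; apply: le_lt_trans wz.
  by have := cn_le_rn (W - Z) j; rewrite !mxE.
(* [rn] adds up the entries and [cn] is at most twice the modulus, so an entrywise radius below
   [d / (2 n)] is required; [n.+1] gives the strict inequality and covers [n = 0]. *)
pose e : R := d / 2%:R / n.+1%:R.
have e0 : 0 < e by rewrite !divr_gt0.
apply/nbhs_ballP; exists e%:C%C => /=; first by rewrite ltcR.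
move=> W [_ WZ]; apply: dP.
have h k : cn ((W - Z) 0 k) <= 2%:R * e.
  have := WZ 0 k; rewrite -ball_normE /ball_ /= distrC => WZk.
  rewrite !mxE -lecR; apply: le_trans (cn_le_norm _) _.
  by rewrite (rmorphM (real_complex R)) rmorph_nat ler_wpM2l // ltW.
apply: (@le_lt_trans _ _ (\sum_(k < n) 2%:R * e)); first exact: ler_sum.
rewrite sumr_const card_ord -[_ *+ n]mulr_natr /e.
have -> : 2%:R * (d / 2%:R / n.+1%:R) * n%:R = d * (n%:R / n.+1%:R) by field; rewrite lt0r_neq0.
by rewrite -[ltRHS]mulr1 ltr_pM2l // ltr_pdivrMr // mul1r ltr_nat.
Qed.

Lemma cont_rVP n (f : 'rV[C]_n -> C) Z : {for Z, continuous f} <->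
  forall e : R, 0 < e -> exists2 d : R, 0 < d &
    forall W, rn (W - Z) < d -> cn (f W - f Z) < e.
Proof.
split=> [cf e e0|h P].
  apply/nbhs_rVP; apply: (cf [set w | cn (w - f Z) < e]).
  by apply/nbhs_CP; exists e.
rewrite nbhs_CP => -[e e0 eP].
have /nbhs_rVP hn := h e e0.
by change (nbhs Z (f @^-1` P)); apply: filterS hn => W; apply: eP.
Qed.

End Gauges.

(** * Derivatives along real lines *)

Section RealVariable.
Context {R : realType}.
Notation C := R[i].

(** Multiplying out the difference quotient removes the punctured neighbourhood: at [h = 0] the
    inequality is trivial. *)
Lemma is_derive_epsP (f : R -> R) t l : is_derive t (1 : R) f l <->
  forall e, 0 < e -> exists2 d, 0 < d &
    forall h, `|h| < d -> `|f (t + h) - f t - h * l| <= e * `|h|.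
Proof.
have key : (h^-1 *: ((f \o shift t) (h *: (1 : R)) - f t) @[h --> 0^'] --> l) <->
  forall e, 0 < e -> exists2 d, 0 < d &
    forall h, `|h| < d -> `|f (t + h) - f t - h * l| <= e * `|h|.
  split.
    move/cvgrPdist_le => H e e0; have /= := H e e0.
    rewrite near_withinE near_nbhs => /nbhs_ballP[d /= d0 dP]; exists d => // h hd.
    have [->|h0] := eqVneq h 0.
      by rewrite addr0 subrr mul0r subr0 normr0 mulr0.
    have := dP h; rewrite /ball /= sub0r normrN => /(_ hd h0).
    rewrite /= /shift /= {1}(_ : h *: (1 : R) = h); last by rewrite /GRing.scale /= mulr1.
    rewrite (addrC h t) /GRing.scale /= => ineq.
    rewrite -ler_pdivrMr ?normr_gt0 // -normf_div -normrN.
    rewrite (_ : - (_ / h) = l - h^-1 * (f (t + h) - f t)) //.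
    by field.
  move=> H; apply/cvgrPdist_le => e e0; have [d d0 dP] := H e e0.
  rewrite near_withinE near_nbhs; apply/nbhs_ballP; exists d => //= h.
  rewrite /ball /= sub0r normrN => hd h0.
  rewrite /shift /= (_ : h *: (1 : R) = h); last by rewrite /GRing.scale /= mulr1.
  rewrite (addrC h t) /GRing.scale /=.
  have -> : l - h^-1 * (f (t + h) - f t) = - ((f (t + h) - f t - h * l) / h).
    by have h0' : h != 0 := h0; field.
  by rewrite normrN normf_div ler_pdivrMr ?normr_gt0 // dP.
rewrite -key; split=> [[ex <-]|cv]; first exact: ex.
have ex : derivable f t 1 by apply/cvg_ex; exists l.
by apply: DeriveDef => //; apply: cvg_lim.
Qed.

Implicit Types (f : R -> R) (t : R).

Lemma is_derive_funD f1 f2 t l1 l2 : is_derive t (1 : R) f1 l1 ->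
  is_derive t (1 : R) f2 l2 -> is_derive t (1 : R) (fun s => f1 s + f2 s) (l1 + l2).
Proof. exact: is_deriveD. Qed.

Lemma is_derive_funB f1 f2 t l1 l2 : is_derive t (1 : R) f1 l1 ->
  is_derive t (1 : R) f2 l2 -> is_derive t (1 : R) (fun s => f1 s - f2 s) (l1 - l2).
Proof. exact: is_deriveB. Qed.

Lemma is_derive_funM f1 f2 t l1 l2 : is_derive t (1 : R) f1 l1 ->
  is_derive t (1 : R) f2 l2 ->
  is_derive t (1 : R) (fun s => f1 s * f2 s) (l1 * f2 t + f1 t * l2).
Proof.
move=> h1 h2; rewrite addrC (mulrC l1); exact: is_deriveM.
Qed.

Lemma derivable_is_derive1 f t : derivable f t 1 -> is_derive t (1 : R) f (derive1 f t).
Proof. by move=> df; apply: DeriveDef df _; rewrite derive1E. Qed.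

Lemma is_derive_derivable1 f t l : is_derive t (1 : R) f l ->
  derivable f t 1 /\ derive1 f t = l.
Proof. by move=> [df <-]; rewrite derive1E. Qed.

(** The same division-free form for a curve in C. The increment is real, as opposed to the complex
    derivative [cdiffl] below. *)
Definition cderiv (g : R -> C) (t : R) (l : C) : Prop :=
  forall e, 0 < e -> exists2 d, 0 < d &
    forall h, `|h| < d -> cn (g (t + h) - g t - h%:C%C * l) <= e * `|h|.

Lemma cderivP g t l : cderiv g t l <->
  is_derive t (1 : R) (fun s => Re (g s)) (Re l) /\
  is_derive t (1 : R) (fun s => Im (g s)) (Im l).
Proof.
rewrite !is_derive_epsP; split.
  move=> H; split=> e e0; have [d d0 dP] := H e e0; exists d => // h /dP;
    apply: le_trans.
    by apply: le_trans (Re_cn _); rewrite !ReImE /= mul0r subr0.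
  by apply: le_trans (Im_cn _); rewrite !ReImE /= mul0r addr0.
move=> [Hr Hi] e e0; have e2 : 0 < e / 2%:R by rewrite divr_gt0.
have [d1 d10 d1P] := Hr _ e2; have [d2 d20 d2P] := Hi _ e2.
exists (Num.min d1 d2); first by rewrite lt_min d10.
move=> h; rewrite lt_min => /andP[/d1P a /d2P b].
rewrite /cn !ReImE /= !mul0r subr0 addr0.
by move: a b; move: `|_| `|_| `|_| => x y z; lra.
Qed.

Lemma cderiv_unique g t l l' : cderiv g t l -> cderiv g t l' -> l = l'.
Proof.
move=> /cderivP[[_ a] [_ b]] /cderivP[[_ a'] [_ b']].
by apply: eqReIm; [rewrite -a -a' | rewrite -b -b'].
Qed.

Lemma cderiv_local (g1 g2 : R -> C) t l : (exists2 d, 0 < d &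
    forall h, `|h| < d -> g1 (t + h) = g2 (t + h)) ->
  cderiv g1 t l -> cderiv g2 t l.
Proof.
move=> [d0 d00 E] H e e0; have [d d1 dP] := H e e0.
exists (Num.min d0 d); first by rewrite lt_min d00.
move=> h; rewrite lt_min => /andP[h1 h2].
rewrite -E // -[t in g2 t]addr0 -E ?normr0 // addr0; exact: dP.
Qed.

Lemma cderivD g1 g2 t l1 l2 : cderiv g1 t l1 -> cderiv g2 t l2 ->
  cderiv (fun s => g1 s + g2 s) t (l1 + l2).
Proof.
move=> /cderivP[a b] /cderivP[c d]; apply/cderivP; rewrite !ReImE; split.
  by have := is_derive_funD a c; congr is_derive; apply/funext => s; rewrite ReD.
by have := is_derive_funD b d; congr is_derive; apply/funext => s; rewrite ImD.
Qed.

Lemma cderivM g1 g2 t l1 l2 : cderiv g1 t l1 -> cderiv g2 t l2 ->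
  cderiv (fun s => g1 s * g2 s) t (l1 * g2 t + g1 t * l2).
Proof.
move=> /cderivP[a b] /cderivP[c d]; apply/cderivP; rewrite !ReImE; split.
  have := is_derive_funB (is_derive_funM a c) (is_derive_funM b d).
  by congr is_derive; [apply/funext => s; rewrite ReMc | ring].
have := is_derive_funD (is_derive_funM a d) (is_derive_funM b c).
by congr is_derive; [apply/funext => s; rewrite ImMc | ring].
Qed.

Lemma cderiv_cst c t : cderiv (fun=> c) t 0.
Proof.
move=> e e0; exists 1 => // h _; rewrite subrr mulr0 subr0 cn0 mulr_ge0 //.
exact: ltW.
Qed.

Lemma cderiv_id t : cderiv (fun s => s%:C%C) t 1.
Proof.
move=> e e0; exists 1 => // h _.
have -> : (t + h)%:C%C - t%:C%C - h%:C%C * 1 = 0 :> C.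
  by rewrite (rmorphD (real_complex R)); ring.
by rewrite cn0 mulr_ge0 // ltW.
Qed.

Lemma cderivZ c g t l : cderiv g t l -> cderiv (fun s => c * g s) t (c * l).
Proof.
by move=> H; have := cderivM (cderiv_cst c t) H; rewrite mul0r add0r.
Qed.

Lemma cderivN g t l : cderiv g t l -> cderiv (fun s => - g s) t (- l).
Proof.
move=> H e /H[d d0 dP]; exists d => // h /dP; rewrite -cnN.
by congr (cn _ <= _); ring.
Qed.

Lemma cderivB g1 g2 t l1 l2 : cderiv g1 t l1 -> cderiv g2 t l2 ->
  cderiv (fun s => g1 s - g2 s) t (l1 - l2).
Proof. by move=> a /cderivN b; exact: cderivD. Qed.

Lemma cderivJ g t l : cderiv g t l -> cderiv (fun s => (g s)^*%C) t l^*%C.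
Proof.
move=> H e /H[d d0 dP]; exists d => // h /dP; rewrite -cnJ.
congr (cn _ <= _); apply: eqReIm; rewrite !ReImE /=; ring.
Qed.

Lemma cderiv_sum I (s : seq I) (P : pred I) (g : I -> R -> C) t l :
  (forall i, P i -> cderiv (g i) t (l i)) ->
  cderiv (fun u => \sum_(i <- s | P i) g i u) t (\sum_(i <- s | P i) l i).
Proof.
move=> H; elim: s => [|i s IH].
  rewrite big_nil (_ : (fun _ => _) = fun=> 0); first exact: cderiv_cst.
  by apply/funext => u; rewrite big_nil.
rewrite big_cons (_ : (fun _ => _) = (fun u => if P i then g i u +
    \sum_(i <- s | P i) g i u else \sum_(i <- s | P i) g i u)); last first.
  by apply/funext => u; rewrite big_cons.
by case: ifP => // Pi; apply: cderivD => //; exact: H.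
Qed.

(** Writing 1/g as conj(g) / |g|^2 leaves only the inverse of a real function to differentiate. *)
Lemma cderivV g t l : g t != 0 -> cderiv g t l ->
  cderiv (fun s => (g s)^-1) t (- (l / g t ^+ 2)).
Proof.
move=> g0 H; pose n (s : R) := Re (g s) ^+ 2 + Im (g s) ^+ 2.
have nt : n t != 0.
  apply: contra g0; rewrite paddr_eq0 ?sqr_ge0 // !sqrf_eq0 => /andP[/eqP a /eqP b].
  by apply/eqP/eqReIm.
case/cderivP: (H) => a b.
have nd : is_derive t (1 : R) n (2%:R * (Re (g t) * Re l + Im (g t) * Im l)).
  have := is_derive_funD (is_derive_funM a a) (is_derive_funM b b).
  by congr is_derive; ring.
have nd' : cderiv (fun s => ((n s)^-1)%:C%C) t
    (- (2%:R * (Re (g t) * Re l + Im (g t) * Im l)) / n t ^+ 2)%:C%C.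
  apply/cderivP; split => /=; last exact: is_derive_cst.
  case: nd => nd1 nd2; apply: DeriveDef; first exact: derivableV.
  by rewrite deriveV // nd2 /GRing.scale /=; field.
have wn s : (n s)%:C%C = g s * (g s)^*%C.
  by apply: eqReIm; rewrite !ReImE /= /n; ring.
have := cderivM (cderivJ H) nd'; rewrite (_ : (fun s => _) = fun s => (g s)^-1).
  congr cderiv; have c0 : (g t)^*%C != 0 by rewrite conjc_eq0.
  have h3 : (2%:R * (Re (g t) * Re l + Im (g t) * Im l))%:C%C =
      g t * l^*%C + (g t)^*%C * l by apply: eqReIm; rewrite !ReImE /=; ring.
  rewrite [X in _ + _ * X](_ : _ = - (g t * l^*%C + (g t)^*%C * l) /
      (g t * (g t)^*%C) ^+ 2); last first.
    rewrite -wn -h3 -(rmorphXn (real_complex R)) -(fmorphV (real_complex R)).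
    by rewrite -(rmorphN (real_complex R)) -(rmorphM (real_complex R)).
  rewrite (_ : ((n t)^-1)%:C%C = (g t * (g t)^*%C)^-1); last first.
    by rewrite -wn -(fmorphV (real_complex R)).
  by field; rewrite g0.
apply/funext => s.
rewrite (_ : ((n s)^-1)%:C%C = (g s * (g s)^*%C)^-1); last first.
  by rewrite -wn -(fmorphV (real_complex R)).
have [->|s0] := eqVneq (g s) 0; first by rewrite conjc0 mul0r invr0.
by field; rewrite s0 conjc_eq0.
Qed.

Lemma cderiv_shift g t u l :
  cderiv (fun s => g (t + s)) u l <-> cderiv g (t + u) l.
Proof.
by split=> H e /H[d d0 dP]; exists d => // h /dP; rewrite addrA.
Qed.

Lemma cderiv_cont g t l : cderiv g t l -> forall e, 0 < e -> exists2 d, 0 < d &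
  forall h, `|h| < d -> cn (g (t + h) - g t) < e.
Proof.
move=> H e e0; have [d d0 dP] := H 1 ltr01; have c0 := cn_ge0 l.
have k0 : 0 < e / (1 + cn l) by rewrite divr_gt0 //; lra.
exists (Num.min d (e / (1 + cn l))); first by rewrite lt_min d0.
move=> h; rewrite lt_min => /andP[/dP h1 h2].
move: h2; rewrite ltr_pdivlMr; last lra.
have := cnD (g (t + h) - g t - h%:C%C * l) (h%:C%C * l); rewrite subrK cnMR; lra.
Qed.

Lemma is_derive_mvt (f f' : R -> R) a b l e : a <= b ->
  (forall t, a <= t <= b -> is_derive t (1 : R) f (f' t)) ->
  (forall t, a <= t <= b -> `|f' t - l| <= e) ->
  `|f b - f a - (b - a) * l| <= e * (b - a).
Proof.
move=> ab df bd.
have [||c] := @MVT_segment R f f' a b ab.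
- by move=> t; rewrite in_itv /= => /andP[h1 h2]; apply: df; rewrite !ltW.
- by apply: derivable_within_continuous => x; rewrite in_itv /= => /df [].
rewrite in_itv /= => /bd h ->; have ba : 0 <= b - a by rewrite subr_ge0.
have -> : f' c * (b - a) - (b - a) * l = (f' c - l) * (b - a) by ring.
by rewrite normrM (ger0_norm ba) ler_wpM2r.
Qed.

(** The mean value theorem has no complex-valued form; it is applied to the real and imaginary parts
    separately, whence the factor 2. With the slope [l] subtracted it bounds the deviation from a
    linear function. *)
Lemma cderiv_mvt (g g' : R -> C) a b l e : a <= b ->
  (forall t, a <= t <= b -> cderiv g t (g' t)) ->
  (forall t, a <= t <= b -> cn (g' t - l) <= e) ->
  cn (g b - g a - (b - a)%:C%C * l) <= 2%:R * e * (b - a).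
Proof.
move=> ab dg bd.
have H1 := @is_derive_mvt (fun s => Re (g s)) (fun s => Re (g' s)) a b (Re l) e ab.
have H2 := @is_derive_mvt (fun s => Im (g s)) (fun s => Im (g' s)) a b (Im l) e ab.
rewrite (_ : 2%:R * e * (b - a) = e * (b - a) + e * (b - a)); last by ring.
rewrite /cn !ReImE /= !mul0r subr0 addr0.
apply: lerD; first apply: H1; last apply: H2.
- by move=> t /dg /cderivP[].
- by move=> t /bd; apply: le_trans; apply: le_trans (Re_cn _); rewrite !ReImE.
- by move=> t /dg /cderivP[].
- by move=> t /bd; apply: le_trans; apply: le_trans (Im_cn _); rewrite !ReImE.
Qed.

Lemma cderiv_mvt0 (g g' : R -> C) h l e :
  (forall t, `|t| <= `|h| -> cderiv g t (g' t)) ->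
  (forall t, `|t| <= `|h| -> cn (g' t - l) <= e) ->
  cn (g h - g 0 - h%:C%C * l) <= 2%:R * e * `|h|.
Proof.
move=> dg bd; have [h0|h0] := leP 0 h.
  have := @cderiv_mvt g g' 0 h l e h0; rewrite subr0 (ger0_norm h0); apply.
    by move=> t /andP[t0 th]; apply: dg; rewrite !ger0_norm.
  by move=> t /andP[t0 th]; apply: bd; rewrite !ger0_norm.
have -> : cn (g h - g 0 - h%:C%C * l) = cn (g 0 - g h - (0 - h)%:C%C * l).
  by rewrite -cnN sub0r (rmorphN (real_complex R)); congr cn; ring.
rewrite (ltr0_norm h0) (_ : 2%:R * e * - h = 2%:R * e * (0 - h)); last by rewrite sub0r.
apply: (@cderiv_mvt g g' h 0 l e (ltW h0)).
  by move=> t /andP[t0 th]; apply: dg; rewrite (ltr0_norm h0) ler0_norm; lra.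
by move=> t /andP[t0 th]; apply: bd; rewrite (ltr0_norm h0) ler0_norm; lra.
Qed.

End RealVariable.

(** * Directional derivatives and strict differentiability *)

Section DirectionalDerivatives.
Context {R : realType} {N : nat}.
Notation C := R[i].
Implicit Types (f g : 'rV[C]_N -> C) (Z v w : 'rV[C]_N) (U : set 'rV[C]_N).

Definition pd f Z v (l : C) := cderiv (fun t : R => f (Z + t%:C%C *: v)) 0 l.

Lemma real_derivable_pd f Z v : real_derivable f Z v -> pd f Z v (real_derive v f Z).
Proof.
move=> [a b]; apply/cderivP; split.
  exact: (derivable_is_derive1 a).
exact: (derivable_is_derive1 b).
Qed.

Lemma pd_real_derive f Z v l : pd f Z v l -> real_derivable f Z v /\ real_derive v f Z = l.
Proof.
move=> /cderivP[/is_derive_derivable1[a a'] /is_derive_derivable1[b b']].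
split; first exact: (conj a b).
apply: eqReIm.
  exact: a'.
exact: b'.
Qed.

Lemma pd_line f Z v t l : pd f (Z + t%:C%C *: v) v l ->
  cderiv (fun s : R => f (Z + s%:C%C *: v)) t l.
Proof.
move=> H; have [+ _] := cderiv_shift (fun s : R => f (Z + s%:C%C *: v)) t 0 l.
rewrite (addr0 t); apply.
have -> : (fun s : R => f (Z + (t + s)%:C%C *: v)) = fun s => f (Z + t%:C%C *: v + s%:C%C *: v).
  by apply/funext => s; rewrite (rmorphD (real_complex R)) scalerDl addrA.
exact: H.
Qed.

Lemma pd_local f g Z v l : (\near Z, f Z = g Z) -> pd f Z v l -> pd g Z v l.
Proof.
move/nbhs_rVP => [d d0 dP]; apply: cderiv_local.
have c0 := rn_ge0 v; have k0 : 0 < d / (1 + rn v) by rewrite divr_gt0 //; lra.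
exists (d / (1 + rn v)) => // h; rewrite ltr_pdivlMr; last lra.
move=> hd; rewrite add0r; apply: dP; rewrite addrAC subrr add0r rnZR.
by have := normr_ge0 h; lra.
Qed.

Lemma near_eq_continuous f g Z : (\near Z, f Z = g Z) ->
  {for Z, continuous f} -> {for Z, continuous g}.
Proof.
move=> e cf P; have E : f Z = g Z := nbhs_singleton e; rewrite /= -E => /cf H.
by change (nbhs Z (g @^-1` P)); apply: filterS2 e H => W /= ->.
Qed.

Lemma open_near U Z (P : set 'rV[C]_N) : open U -> U Z ->
  (forall W, U W -> P W) -> \near Z, P Z.
Proof. by move=> oU UZ H; apply: filterS H _; exact: open_nbhs_nbhs. Qed.

Lemma real_derive_local U f g Z v : open U -> U Z -> (forall W, U W -> f W = g W) ->
  real_derivable f Z v -> real_derivable g Z v /\ real_derive v g Z = real_derive v f Z.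
Proof.
move=> oU UZ E /real_derivable_pd H; apply: pd_real_derive.
by apply: pd_local H; apply: open_near E.
Qed.

Definition direction_basis : seq 'rV[C]_N :=
  [seq delta_mx 0 k | k <- index_enum 'I_N] ++ [seq 'i%C *: delta_mx 0 k | k <- index_enum 'I_N].

Lemma rn_delta k : rn (delta_mx 0 k : 'rV[C]_N) = 1.
Proof.
rewrite /rn (bigD1 k) //= big1 => [|j jk].
  by rewrite mxE !eqxx /cn /= normr1 normr0 !addr0.
by rewrite mxE (negPf jk) andbF cn0.
Qed.

Lemma rn_idelta k : rn ('i%C *: delta_mx 0 k : 'rV[C]_N) = 1.
Proof.
by rewrite -[RHS](rn_delta k); apply: eq_bigr => j _; rewrite mxE cni.
Qed.

(* The offset [y] gives the estimate uniformly at all base points near [Z0];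
   this uniformity is what the contraction argument needs. *)
Lemma step_estimate f Z0 (D : seq 'rV[C]_N) (f' : 'rV[C]_N -> 'rV[C]_N -> C) :
  (exists2 d, 0 < d & forall Z u, rn (Z - Z0) < d -> u \in D -> pd f Z u (f' u Z)) ->
  (forall u e, 0 < e -> exists2 d, 0 < d &
     forall Z, rn (Z - Z0) < d -> u \in D -> cn (f' u Z - f' u Z0) <= e) ->
  forall e, 0 < e -> exists2 d, 0 < d &
    forall y (s : seq (R * 'rV[C]_N)), {subset map snd s <= D} ->
      rn y + \sum_(p <- s) `|p.1| * rn p.2 < d ->
      cn (f (Z0 + y + \sum_(p <- s) p.1%:C%C *: p.2) - f (Z0 + y)
          - \sum_(p <- s) p.1%:C%C * f' p.2 Z0) <= e * \sum_(p <- s) `|p.1|.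
Proof.
move=> [d0 d00 df] cf e e0; have e2 : 0 < e / 2%:R by rewrite divr_gt0.
have [d d1 dP] : exists2 d, 0 < d & forall Z u, rn (Z - Z0) < d -> u \in D ->
    cn (f' u Z - f' u Z0) <= e / 2%:R.
  elim: D {df} cf => [|u D IH] cf; first by exists 1.
  have [d1 d10 d1P] := cf u _ e2; case: IH => [u' e' /(cf u')[d' d'0 d'P]|d2 d20 d2P].
    by exists d' => // Z dZ u'D; apply: d'P; rewrite ?in_cons ?u'D ?orbT.
  exists (Num.min d1 d2); first by rewrite lt_min d10.
  move=> Z u'; rewrite lt_min => /andP[h1 h2]; rewrite in_cons => /orP[/eqP ->|].
    by apply: d1P => //; rewrite in_cons eqxx.
  exact: d2P.
exists (Num.min d0 d); first by rewrite lt_min d00.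
move=> y s; elim: s y => [|[a u] s IH] y sD.
  by rewrite !big_nil !addr0 subrr subr0 cn0 mulr0.
rewrite !big_cons /= => hd.
have uD : u \in D by apply: sD; rewrite in_cons eqxx.
have S0 : 0 <= \sum_(p <- s) `|p.1| * rn p.2.
  by apply: sumr_ge0 => p _; rewrite mulr_ge0 ?rn_ge0.
have yau : rn (y + a%:C%C *: u) <= rn y + `|a| * rn u.
  by apply: le_trans (rnD _ _) _; rewrite rnZR.
have sD' : {subset map snd s <= D} by move=> p ps; apply: sD; rewrite in_cons ps orbT.
have := IH (y + a%:C%C *: u) sD'; rewrite !addrA => IH'.
apply: le_trans (_ : _ <= e / 2%:R * 2%:R * `|a| + e * \sum_(p <- s) `|p.1|) _; last first.
  by lra.
set A := f _; set B := f _; set S := \sum_(p <- s) _ * _.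
set B' := f (Z0 + y + a%:C%C *: u).
have -> : A - B - (a%:C%C * f' u Z0 + S) = (B' - B - a%:C%C * f' u Z0) + (A - B' - S).
  by ring.
apply: le_trans (cnD _ _) _; apply: lerD; last first.
  apply: IH'; by apply: le_lt_trans hd; rewrite addrA lerD2r.
have inD t : `|t| <= `|a| -> rn (Z0 + y + t%:C%C *: u - Z0) < Num.min d0 d.
  move=> ta; apply: le_lt_trans hd; rewrite (_ : _ - Z0 = y + t%:C%C *: u); last first.
    by rewrite -(addrA Z0) (addrC Z0) addrK.
  apply: le_trans (rnD _ _) _; rewrite rnZR.
  by have := ler_wpM2r (rn_ge0 u) ta; lra.
have := @cderiv_mvt0 _ (fun t => f (Z0 + y + t%:C%C *: u))
  (fun t => f' u (Z0 + y + t%:C%C *: u)) a (f' u Z0) (e / 2%:R).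
cbv beta; rewrite (scale0r u) (addr0 (Z0 + y)) (mulrC 2%:R) => -> // t /inD;
  rewrite lt_min => /andP[h1 h2].
  by apply: pd_line; apply: df.
exact: dP.
Qed.

Definition real_differential f Z w : C :=
  \sum_k (w 0 k * dZ k f Z + (w 0 k)^*%C * dZbar k f Z).

Lemma wirtinger_half (x y A B : C) :
  (x + 'i%C * y) * ((A - 'i%C * B) / 2%:R) + (x - 'i%C * y) * ((A + 'i%C * B) / 2%:R) =
  x * A + y * B.
Proof.
transitivity (x * A - ('i%C * 'i%C) * (y * B)).
  by field.
by rewrite -expr2 sqr_i; ring.
Qed.

Lemma real_differentialE f Z w : real_differential f Z w =
  \sum_k ((Re (w 0 k))%:C%C * real_derive (delta_mx 0 k) f Z +
          (Im (w 0 k))%:C%C * real_derive ('i%C *: delta_mx 0 k) f Z).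
Proof.
apply: eq_bigr => k _; rewrite /dZ /dZbar.
set A := real_derive _ f Z; set B := real_derive _ f Z; set z := w 0 k.
have -> : z = (Re z)%:C%C + 'i%C * (Im z)%:C%C by apply: eqReIm; rewrite !ReImE /=; ring.
have -> : ((Re z)%:C%C + 'i%C * (Im z)%:C%C)^*%C = (Re z)%:C%C - 'i%C * (Im z)%:C%C.
  by apply: eqReIm; rewrite !ReImE /=; ring.
rewrite (_ : Re (_ + _) = Re z); last by rewrite !ReImE /=; ring.
rewrite (_ : Im (_ + _) = Im z); last by rewrite !ReImE /=; ring.
exact: wirtinger_half.
Qed.

Lemma real_differentialD f Z v w :
  real_differential f Z (v + w) = real_differential f Z v + real_differential f Z w.
Proof.
rewrite -big_split; apply: eq_bigr => k _; rewrite !mxE (rmorphD (@conjc R)) /=; ring.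
Qed.

Lemma real_differentialN f Z w : real_differential f Z (- w) = - real_differential f Z w.
Proof.
rewrite -sumrN; apply: eq_bigr => k _; rewrite !mxE (rmorphN (@conjc R)) /=; ring.
Qed.

Lemma real_differentialZ f Z (a : R) w :
  real_differential f Z (a%:C%C *: w) = a%:C%C * real_differential f Z w.
Proof.
rewrite /real_differential mulr_sumr; apply: eq_bigr => k _; rewrite !mxE.
have -> : (a%:C%C * w 0 k)^*%C = a%:C%C * (w 0 k)^*%C.
  by apply: eqReIm; rewrite !ReImE /=; ring.
by ring.
Qed.

Definition C1 U f := [/\ forall Z, U Z -> {for Z, continuous f},
  forall Z v, U Z -> real_derivable f Z v &
  forall Z v, U Z -> {for Z, continuous (real_derive v f)}].

(** Strict differentiability: the base point [Z0 + y] moves while the differential is taken at [Z0].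
    The increment [w] is walked along the real basis, one coordinate at a time, by
    [step_estimate]. *)
Lemma C1_estimate U f Z0 : open U -> C1 U f -> U Z0 ->
  forall e, 0 < e -> exists2 d, 0 < d & forall y w, rn y + rn w < d ->
    cn (f (Z0 + y + w) - f (Z0 + y) - real_differential f Z0 w) <= e * rn w.
Proof.
move=> oU [cf df cf'] U0 e e0.
have /nbhs_rVP[d0 d00 d0P] := open_nbhs_nbhs (conj oU U0).
have [|u e'|d d1 dP] := @step_estimate f Z0 direction_basis (fun u => real_derive u f) _ _ e e0.
- by exists d0 => // Z u h _; apply: real_derivable_pd; apply: df; apply: d0P.
- move=> e'0; have /cont_rVP/(_ _ e'0)[d' d'0 d'P] := cf' Z0 u U0.
  by exists d' => // Z h _; rewrite ltW // d'P.
exists d => // y w hd.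
pose s : seq (R * 'rV[C]_N) := [seq (Re (w 0 k), delta_mx 0 k) | k <- index_enum 'I_N] ++
   [seq (Im (w 0 k), 'i%C *: delta_mx 0 k) | k <- index_enum 'I_N].
have := dP y s; rewrite /s !big_cat /= !big_map /=.
have E1 : \sum_k `|Re (w 0 k)| * rn (delta_mx 0 k : 'rV[C]_N) = \sum_k `|Re (w 0 k)|.
  by apply: eq_bigr => k _; rewrite rn_delta mulr1.
have E2 : \sum_k `|Im (w 0 k)| * rn ('i%C *: delta_mx 0 k : 'rV[C]_N) = \sum_k `|Im (w 0 k)|.
  by apply: eq_bigr => k _; rewrite rn_idelta mulr1.
have E3 : \sum_k `|Re (w 0 k)| + \sum_k `|Im (w 0 k)| = rn w by rewrite -big_split.
have E4 : \sum_k (Re (w 0 k))%:C%C *: delta_mx 0 k +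
    \sum_k (Im (w 0 k))%:C%C *: ('i%C *: delta_mx 0 k) = w :> 'rV[C]_N.
  rewrite -big_split [RHS]row_sum_delta; apply: eq_bigr => k _.
  rewrite /= scalerA -scalerDl; congr (_ *: _); apply: eqReIm; rewrite !ReImE /=; ring.
rewrite E1 E2 E3 E4 real_differentialE big_split; apply=> // u.
by rewrite map_cat mem_cat -!map_comp /direction_basis mem_cat.
Qed.

Lemma C1_curve U f (c : R -> 'rV[C]_N) (c' : 'rV[C]_N) t : open U -> C1 U f -> U (c t) ->
  (forall k, cderiv (fun s => c s 0 k) t (c' 0 k)) ->
  cderiv (fun s => f (c s)) t (real_differential f (c t) c').
Proof.
move=> oU Uf Uc dc e e0; have c0 := rn_ge0 c'.
have [K K0 HK] : exists2 K, 0 < K & forall w, cn (real_differential f (c t) w) <= K * rn w.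
  exists (1 + \sum_k (cn (dZ k f (c t)) + cn (dZbar k f (c t)))).
    apply: ltr_wpDr => //; apply: sumr_ge0 => k _; rewrite addr_ge0 ?cn_ge0 //.
  move=> w; apply: le_trans (cn_sum _ _ _) _; rewrite mulrDl mul1r.
  apply: ler_wpDl; first exact: rn_ge0.
  rewrite mulr_suml; apply: ler_sum => k _; apply: le_trans (cnD _ _) _.
  have h1 := cnM (w 0 k) (dZ k f (c t)); have h2 := cnM (w 0 k)^*%C (dZbar k f (c t)).
  rewrite cnJ in h2; have h3 := cn_le_rn w k; have h4 := cn_ge0 (w 0 k).
  have h5 := cn_ge0 (dZ k f (c t)); have h6 := cn_ge0 (dZbar k f (c t)).
  by rewrite mulrDl; nra.
have dcv e' : 0 < e' -> exists2 d, 0 < d & forall h, `|h| < d ->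
    rn (c (t + h) - c t - h%:C%C *: c') <= e' * `|h|.
  move=> e'0; have e1 : 0 < e' / N.+1%:R by rewrite divr_gt0.
  suff [d d0 dP] : exists2 d, 0 < d & forall h, `|h| < d -> forall k,
      cn (c (t + h) 0 k - c t 0 k - h%:C%C * c' 0 k) <= e' / N.+1%:R * `|h|.
    exists d => // h /dP H; apply: (@le_trans _ _ (\sum_(k < N) e' / N.+1%:R * `|h|)).
      by apply: ler_sum => k _; rewrite !mxE.
    rewrite sumr_const card_ord -[_ *+ N]mulr_natr.
    rewrite mulrAC ler_wpM2r // mulrAC ler_pdivrMr // ler_wpM2l ?ltW //.
    by rewrite ltr_nat.
  have : forall k, exists d, 0 < d /\ forall h, `|h| < d ->
      cn (c (t + h) 0 k - c t 0 k - h%:C%C * c' 0 k) <= e' / N.+1%:R * `|h|.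
    by move=> k; have [d d0 dP] := dc k _ e1; exists d.
  move=> /choice[d dP].
  exists (\big[Num.min/1]_k d k).
    by elim/big_ind: _ => // [x y x0 y0|k _]; [rewrite lt_min x0|case: (dP k)].
  move=> h hd k; apply: (dP k).2; apply: lt_le_trans hd _.
  exact: bigmin_le_cond.
(* Half of [e] pays for [f] along the chord, of length at most [(1 + rn c') |h|]; the other half
   pays for the error of the curve, amplified by the bound [K] of the differential. *)
pose e1 := e / (2%:R * (1 + rn c')); have e10 : 0 < e1 by rewrite divr_gt0 // mulr_gt0 //; lra.
have [d1 d10 d1P] := C1_estimate oU Uf Uc e10.
pose e2 := Num.min 1 (e / (2%:R * K)); have e20 : 0 < e2.
  by rewrite lt_min ltr01 divr_gt0 // mulr_gt0.
have [d2 d20 d2P] := dcv _ e20.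
pose d3 := d1 / (1 + rn c'); have d30 : 0 < d3 by rewrite divr_gt0 //; lra.
exists (Num.min d2 d3); first by rewrite lt_min d20.
move=> h; rewrite lt_min => /andP[/d2P hh h3].
have e2a : e2 <= 1 by rewrite ge_min lexx.
have e2b : e2 * (2%:R * K) <= e by rewrite -ler_pdivlMr ?mulr_gt0 // ge_min lexx orbT.
have hw : rn (c (t + h) - c t) <= (1 + rn c') * `|h|.
  have := rnD (c (t + h) - c t - h%:C%C *: c') (h%:C%C *: c'); rewrite subrK rnZR.
  by have := normr_ge0 h; nra.
have := d1P 0 (c (t + h) - c t); rewrite rn0 add0r addr0.
rewrite (addrC (c t)) subrK => H1.
have {}H1 : cn (f (c (t + h)) - f (c t) - real_differential f (c t) (c (t + h) - c t))
    <= e / 2%:R * `|h|.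
  apply: le_trans (H1 _) _.
    by apply: le_lt_trans hw _; rewrite mulrC -ltr_pdivlMr //; lra.
  apply: le_trans (ler_wpM2l (ltW e10) hw) _; rewrite mulrA ler_wpM2r //.
  by rewrite /e1 invfM mulrA divfK //; lra.
have := HK (c (t + h) - c t - h%:C%C *: c').
rewrite real_differentialD real_differentialN real_differentialZ => H2.
set A := f _ - f _ in H1 *; set B := real_differential f _ _ in H1 H2.
have -> : A - h%:C%C * real_differential f (c t) c' = (A - B) + (B - h%:C%C * real_differential f (c t) c').
  by ring.
apply: le_trans (cnD _ _) _.
have := normr_ge0 h; nra.
Qed.

End DirectionalDerivatives.

(** * Smooth functions *)

Section Differentiability_classes.
Context {R : realType}.
Notation C := R[i].

Lemma C1_real_derive N (U : set 'rV[C]_N) f Z w : open U -> C1 U f -> U Z ->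
  real_derive w f Z = real_differential f Z w.
Proof.
move=> oU Uf UZ; suff /pd_real_derive[] : pd f Z w (real_differential f Z w) by [].
have := @C1_curve R N U f (fun s : R => Z + s%:C%C *: w) w 0 oU Uf.
have E : Z + (0 : R)%:C%C *: w = Z by rewrite (scale0r w) (addr0 Z).
rewrite E; apply=> // k.
rewrite (_ : (fun _ => _) = (fun s : R => Z 0 k + s%:C%C * w 0 k)); last first.
  by apply/funext => s; rewrite !mxE.
have := cderivD (cderiv_cst (Z 0 k) 0) (cderivM (cderiv_id 0) (cderiv_cst (w 0 k) 0)).
by congr cderiv; ring.
Qed.

Lemma continuous_compC N m (f : 'rV[C]_m -> C) (G : 'rV[C]_N -> 'rV[C]_m) Z :
  {for G Z, continuous f} -> (forall k, {for Z, continuous (fun W => G W 0 k)}) ->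
  {for Z, continuous (fun W => f (G W))}.
Proof.
move=> cf cG; suff cG' : {for Z, continuous G} by apply: continuous_comp cG' cf.
move=> P /nbhs_rVP[d d0 dP]; have e0 : 0 < d / m.+1%:R by rewrite divr_gt0.
have H : \forall W \near Z, forall k, cn (G W 0 k - G Z 0 k) < d / m.+1%:R.
  apply: (@filter_forall _ _ (fun k W => cn (G W 0 k - G Z 0 k) < d / m.+1%:R) (nbhs Z)).
  move=> k; apply/nbhs_rVP.
  by have /cont_rVP := cG k; apply.
change (nbhs Z (G @^-1` P)); apply: filterS H => W WP; apply: dP.
apply: (@le_lt_trans _ _ (\sum_(k < m) d / m.+1%:R)).
  by apply: ler_sum => k _; rewrite !mxE ltW.
rewrite sumr_const card_ord -[_ *+ m]mulr_natr mulrAC ltr_pdivrMr // ltr_pM2l //.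
by rewrite ltr_nat.
Qed.

Section Continuity.
Context {N : nat}.
Implicit Types (f g : 'rV[C]_N -> C) (Z v : 'rV[C]_N) (U : set 'rV[C]_N).

Lemma continuous_C_D f g Z : {for Z, continuous f} -> {for Z, continuous g} ->
  {for Z, continuous (fun W => f W + g W)}.
Proof.
move=> /cont_rVP cf /cont_rVP cg; apply/cont_rVP => e e0.
have e2 : 0 < e / 2%:R by rewrite divr_gt0.
have [d d0 dP] := cf _ e2; have [d' d'0 d'P] := cg _ e2.
exists (Num.min d d'); first by rewrite lt_min d0.
move=> W; rewrite lt_min => /andP[/dP h1 /d'P h2].
have := cnD (f W - f Z) (g W - g Z).
rewrite (_ : _ + _ = f W + g W - (f Z + g Z)); last by ring.
by lra.
Qed.

Lemma continuous_C_M f g Z : {for Z, continuous f} -> {for Z, continuous g} ->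
  {for Z, continuous (fun W => f W * g W)}.
Proof.
move=> /cont_rVP cf /cont_rVP cg; apply/cont_rVP => e e0.
have a0 := cn_ge0 (f Z); have b0 := cn_ge0 (g Z).
pose K := 2%:R * (1 + cn (f Z) + cn (g Z)); have K0 : 0 < K by rewrite /K; lra.
have e2 : 0 < Num.min 1 (e / K) by rewrite lt_min ltr01 divr_gt0.
have [d d0 dP] := cf _ e2; have [d' d'0 d'P] := cg _ e2.
exists (Num.min d d'); first by rewrite lt_min d0.
move=> W; rewrite lt_min => /andP[/dP + /d'P].
rewrite !lt_min => /andP[h1]; rewrite ltr_pdivlMr // => h2.
move=> /andP[h3]; rewrite ltr_pdivlMr // => h4.
rewrite (_ : _ - _ = (f W - f Z) * (g W - g Z) +
  (f Z * (g W - g Z) + (f W - f Z) * g Z)); last by ring.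
have H1 := cnM (f W - f Z) (g W - g Z); have H2 := cnM (f Z) (g W - g Z).
have H3 := cnM (f W - f Z) (g Z).
apply: le_lt_trans (cnD _ _) _.
have := cnD (f Z * (g W - g Z)) ((f W - f Z) * g Z).
have x0 := cn_ge0 (f W - f Z); have y0 := cn_ge0 (g W - g Z).
by rewrite /K in h2 h4; nra.
Qed.

Lemma continuous_C_V f Z : f Z != 0 -> {for Z, continuous f} ->
  {for Z, continuous (fun W => (f W)^-1)}.
Proof. by move=> f0 cf; exact: (@cvgV _ _ (nbhs Z) _ f (f Z)). Qed.

Lemma continuous_C_J f Z : {for Z, continuous f} ->
  {for Z, continuous (fun W => (f W)^*%C)}.
Proof.
move=> /cont_rVP H; apply/cont_rVP => e /H[d d0 dP]; exists d => // W /dP.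
by rewrite -(rmorphB (@conjc R)) cnJ.
Qed.

End Continuity.

Section Ck.
Context {N : nat} (U : set 'rV[C]_N) (oU : open U).
Implicit Types (f g : 'rV[C]_N -> C) (Z v : 'rV[C]_N).

(** Finite orders give an induction in which the derivative of a product, an inverse or a composite
    is again built from functions of lower order. [smooth_on], which speaks of whole lists of
    directions, is the conjunction of all orders by [smooth_onP]. *)
Fixpoint Ck n f : Prop :=
  (forall Z, U Z -> {for Z, continuous f}) /\
  if n is n'.+1 then (forall Z v, U Z -> real_derivable f Z v) /\
    forall v, Ck n' (real_derive v f) else True.

Lemma Ck_cont n f : Ck n f -> forall Z, U Z -> {for Z, continuous f}.
Proof. by case: n => [|n] []. Qed.

Lemma Ck_ext n f g : (forall Z, U Z -> f Z = g Z) -> Ck n f -> Ck n g.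
Proof.
elim: n f g => [|n IH] f g E [cf].
  move=> _; split; last by [].
  move=> Z UZ; apply: near_eq_continuous (cf Z UZ).
  exact: open_near E.
move=> [df Cf]; split; last split.
- move=> Z UZ; apply: near_eq_continuous (cf Z UZ); exact: open_near E.
- by move=> Z v UZ; have [] := real_derive_local oU UZ E (df Z v UZ).
move=> v; apply: IH (Cf v) => Z UZ.
by have [] := real_derive_local oU UZ E (df Z v UZ).
Qed.

Lemma Ck_intro n f (f' : 'rV[C]_N -> 'rV[C]_N -> C) :
  (forall Z, U Z -> {for Z, continuous f}) ->
  (forall Z v, U Z -> pd f Z v (f' v Z)) -> (forall v, Ck n (f' v)) -> Ck n.+1 f.
Proof.
move=> cf df Cf; split; first exact: cf.
split.
  by move=> Z v UZ; have [] := pd_real_derive (df Z v UZ).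
move=> v; apply: Ck_ext (Cf v) => Z UZ.
by have [] := pd_real_derive (df Z v UZ).
Qed.

Lemma Ck_pd n f Z v : Ck n.+1 f -> U Z -> pd f Z v (real_derive v f Z).
Proof. by move=> [_ [df _]] UZ; apply: real_derivable_pd; apply: df. Qed.

Lemma Ck_real_derive n f v : Ck n.+1 f -> Ck n (real_derive v f).
Proof. by move=> [_ [_ Cf]]; exact: Cf. Qed.

Lemma Ck_S n f : Ck n.+1 f -> Ck n f.
Proof.
elim: n f => [|n IH] f [cf [df Cf]]; first exact: (conj cf I).
split; first exact: cf.
by split; [exact: df | move=> v; apply: IH].
Qed.

Lemma Ck_C1 n f : Ck n.+1 f -> C1 U f.
Proof.
move=> H; split; first exact: Ck_cont H.
  by move=> Z v UZ; case: H => _ [+ _]; apply.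
by move=> Z v; apply: Ck_cont; exact: Ck_real_derive H.
Qed.

Lemma CkD n f g : Ck n f -> Ck n g -> Ck n (fun W => f W + g W).
Proof.
elim: n f g => [|n IH] f g Cf Cg.
  split; last by [].
  move=> Z UZ; apply: continuous_C_D; [exact: (Ck_cont Cf)|exact: (Ck_cont Cg)].
apply: (@Ck_intro _ _ (fun v W => real_derive v f W + real_derive v g W)).
- move=> Z UZ; apply: continuous_C_D; [exact: (Ck_cont Cf)|exact: (Ck_cont Cg)].
- by move=> Z v UZ; apply: cderivD; [exact: Ck_pd Cf UZ | exact: Ck_pd Cg UZ].
by move=> v; apply: IH; apply: Ck_real_derive.
Qed.

Lemma pd_E0 f Z v : f (Z + (0 : R)%:C%C *: v) = f Z.
Proof. by rewrite (scale0r v) (addr0 Z). Qed.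

Lemma pdM f g Z v l l' : pd f Z v l -> pd g Z v l' ->
  pd (fun W => f W * g W) Z v (l * g Z + f Z * l').
Proof. by move=> a b; have := cderivM a b; rewrite /= !pd_E0. Qed.

Lemma CkM n f g : Ck n f -> Ck n g -> Ck n (fun W => f W * g W).
Proof.
elim: n f g => [|n IH] f g Cf Cg.
  split; last by [].
  move=> Z UZ; apply: continuous_C_M; [exact: (Ck_cont Cf)|exact: (Ck_cont Cg)].
apply: (@Ck_intro _ _ (fun v W => real_derive v f W * g W + f W * real_derive v g W)).
- move=> Z UZ; apply: continuous_C_M; [exact: (Ck_cont Cf)|exact: (Ck_cont Cg)].
- by move=> Z v UZ; apply: pdM; [exact: Ck_pd Cf UZ | exact: Ck_pd Cg UZ].
move=> v; apply: CkD; apply: IH; try exact: Ck_real_derive; exact: Ck_S.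
Qed.

Lemma Ck_cst n c : Ck n (fun=> c).
Proof.
elim: n c => [|n IH] c; first by split; [move=> Z _; apply: cst_continuous|].
apply: (@Ck_intro _ _ (fun v W => 0)); last by [].
  by move=> Z _; apply: cst_continuous.
by move=> Z v _; apply: cderiv_cst.
Qed.

Lemma CkJ n f : Ck n f -> Ck n (fun W => (f W)^*%C).
Proof.
elim: n f => [|n IH] f Cf.
  split; last by [].
  move=> Z UZ; apply: continuous_C_J; exact: (Ck_cont Cf).
apply: (@Ck_intro _ _ (fun v W => (real_derive v f W)^*%C)).
- by move=> Z UZ; apply: continuous_C_J; exact: (Ck_cont Cf).
- by move=> Z v UZ; apply: cderivJ; exact: Ck_pd Cf UZ.
by move=> v; apply: IH; apply: Ck_real_derive.
Qed.

Lemma CkV n f : (forall Z, U Z -> f Z != 0) -> Ck n f -> Ck n (fun W => (f W)^-1).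
Proof.
move=> f0; elim: n => [|n IH] Cf.
  split; last by [].
  move=> Z UZ; apply: continuous_C_V; [exact: f0 | exact: (Ck_cont Cf)].
apply: (@Ck_intro _ _ (fun v W => -1 * (real_derive v f W * ((f W)^-1 * (f W)^-1)))).
- by move=> Z UZ; apply: continuous_C_V; [exact: f0 | exact: (Ck_cont Cf)].
- move=> Z v UZ; have H := Ck_pd v Cf UZ.
  have := cderivV _ H; rewrite /= !pd_E0 => /(_ (f0 _ UZ)); congr cderiv.
  by rewrite mulN1r expr2 invfM.
move=> v; apply: CkM; first exact: Ck_cst.
apply: CkM; first exact: Ck_real_derive.
by apply: CkM; apply: IH; exact: Ck_S.
Qed.

Lemma Ck_coord n k : Ck n (fun W => W 0 k).
Proof.
case: n => [|n].
  split; last by [].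
  by move=> Z _; apply: coord_continuous.
apply: (@Ck_intro _ _ (fun v W => v 0 k)).
- by move=> Z _; apply: coord_continuous.
- move=> Z v _.
  have := cderivD (cderiv_cst (Z 0 k) 0) (cderivM (cderiv_id 0) (cderiv_cst (v 0 k) 0)).
  by rewrite /= mulr0 mul1r addr0 add0r; congr cderiv; apply/funext => t; rewrite !mxE.
by move=> v; apply: Ck_cst.
Qed.

Lemma Ck_dZ n f k : Ck n.+1 f -> Ck n (dZ k f).
Proof.
move=> Cf; apply: (@Ck_ext _ (fun W => (real_derive (delta_mx 0 k) f W +
  - 'i%C * real_derive ('i%C *: delta_mx 0 k) f W) * 2%:R^-1)).
  by move=> Z _; rewrite /dZ mulNr.
apply: CkM; last exact: Ck_cst.
by apply: CkD; last apply: CkM; try exact: Ck_cst; exact: Ck_real_derive.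
Qed.

Lemma Ck_dZbar n f k : Ck n.+1 f -> Ck n (dZbar k f).
Proof.
move=> Cf; apply: (@Ck_ext _ (fun W => (real_derive (delta_mx 0 k) f W +
  'i%C * real_derive ('i%C *: delta_mx 0 k) f W) * 2%:R^-1)) => //.
apply: CkM; last exact: Ck_cst.
by apply: CkD; last apply: CkM; try exact: Ck_cst; exact: Ck_real_derive.
Qed.

Lemma Ck_sum n I (s : seq I) (P : pred I) (f : I -> 'rV[C]_N -> C) :
  (forall i, P i -> Ck n (f i)) -> Ck n (fun W => \sum_(i <- s | P i) f i W).
Proof.
move=> H; elim: s => [|i s IH].
  by apply: (@Ck_ext _ (fun=> 0)) (Ck_cst _ _) => Z _; rewrite big_nil.
case Pi: (P i); last by apply: Ck_ext IH => Z _; rewrite big_cons Pi.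
by apply: Ck_ext (CkD (H i Pi) IH) => Z _; rewrite big_cons Pi.
Qed.

Lemma smooth_onP f : smooth_on U f <-> forall n, Ck n f.
Proof.
split=> [H n|H].
  elim: n f H => [|n IH] f H; first by split; [move=> Z /(H [::])[] |].
  split; first by move=> Z /(H [::])[].
  split; first by move=> Z v /(H [::])[_ /(_ v)].
  by move=> v; apply: IH => vs Z UZ; have := H (rcons vs v) Z UZ; rewrite foldr_rcons.
move=> vs Z UZ; elim/last_ind: vs f H => [|vs v IH] f H.
  split; first exact: (Ck_cont (H 0)).
  by move=> v; case: (H 1) => _ [+ _]; apply.
by rewrite foldr_rcons; apply: IH => n; apply: Ck_real_derive.
Qed.

End Ck.

(** By the chain rule a derivative of the composite involves Wirtinger derivatives of [f] at [G W],
    one order less, and derivatives of the entries of [G]; hence the induction on the order with [f]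
    general. *)
Lemma Ck_comp N m (U : set 'rV[C]_N) (V : set 'rV[C]_m) n f (G : 'rV[C]_N -> 'rV[C]_m) :
  open U -> open V -> (forall Z, U Z -> V (G Z)) ->
  (forall k, Ck U n (fun W => G W 0 k)) -> Ck V n f -> Ck U n (fun W => f (G W)).
Proof.
move=> oU oV UV; elim: n f => [|n IH] f CG Cf.
  split; last by [].
  move=> Z UZ; apply: continuous_compC; first by apply: (Ck_cont Cf); apply: UV.
  by move=> k; apply: (Ck_cont (CG k)).
pose G' v W : 'rV[C]_m := \row_k real_derive v (fun W => G W 0 k) W.
apply: (@Ck_intro _ U oU _ _ (fun v W => real_differential f (G W) (G' v W))).
- move=> Z UZ; apply: continuous_compC; first by apply: (Ck_cont Cf); apply: UV.
  by move=> k; apply: (Ck_cont (CG k)).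
- move=> Z v UZ.
  have := @C1_curve R m V f (fun t : R => G (Z + t%:C%C *: v)) (G' v Z) 0 oV (Ck_C1 Cf).
  rewrite (scale0r v) (addr0 Z); apply; first exact: UV.
  by move=> k; rewrite mxE; exact: Ck_pd (CG k) UZ.
move=> v; apply: Ck_sum => // k _; apply: CkD => //; apply: CkM => //.
- apply: (@Ck_ext _ U oU _ (real_derive v (fun W => G W 0 k))); last exact: Ck_real_derive.
  by move=> Z _; rewrite mxE.
- by apply: IH; [move=> j; apply: Ck_S | apply: Ck_dZ].
- apply: (@Ck_ext _ U oU _ (fun W => (real_derive v (fun W => G W 0 k) W)^*%C)).
    by move=> Z _; rewrite mxE.
  by apply: CkJ => //; exact: Ck_real_derive.
by apply: IH; [move=> j; apply: Ck_S | apply: Ck_dZbar].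
Qed.


End Differentiability_classes.

(** * The algebra of smooth functions and the symmetry of second derivatives *)

Section SmoothFunctions.
Context {R : realType} {N : nat}.
Notation C := R[i].
Variable U : set 'rV[C]_N.
Hypothesis oU : open U.
Implicit Types (f g : 'rV[C]_N -> C) (Z v w : 'rV[C]_N).

Lemma smooth_ext f g : (forall Z, U Z -> f Z = g Z) -> smooth_on U f -> smooth_on U g.
Proof. by move=> E /smooth_onP H; apply/smooth_onP => n; exact: (Ck_ext oU E (H n)). Qed.

Lemma smoothD f g : smooth_on U f -> smooth_on U g -> smooth_on U (fun W => f W + g W).
Proof.
move=> /smooth_onP a /smooth_onP b; apply/smooth_onP => n; exact: CkD.
Qed.

Lemma smoothM f g : smooth_on U f -> smooth_on U g -> smooth_on U (fun W => f W * g W).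
Proof.
move=> /smooth_onP a /smooth_onP b; apply/smooth_onP => n; exact: CkM.
Qed.

Lemma smooth_cst c : smooth_on U (fun=> c).
Proof. apply/smooth_onP => n; exact: Ck_cst. Qed.

Lemma smoothN f : smooth_on U f -> smooth_on U (fun W => - f W).
Proof.
move=> H; apply: smooth_ext (smoothM (smooth_cst (-1)) H) => Z _; exact: mulN1r.
Qed.

Lemma smoothB f g : smooth_on U f -> smooth_on U g -> smooth_on U (fun W => f W - g W).
Proof. by move=> a b; apply: smoothD; [exact: a | exact: smoothN]. Qed.

Lemma smoothJ f : smooth_on U f -> smooth_on U (fun W => (f W)^*%C).
Proof. move=> /smooth_onP a; apply/smooth_onP => n; exact: CkJ. Qed.

Lemma smoothV f : (forall Z, U Z -> f Z != 0) -> smooth_on U f ->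
  smooth_on U (fun W => (f W)^-1).
Proof. move=> f0 /smooth_onP a; apply/smooth_onP => n; exact: CkV. Qed.

Lemma smooth_coord k : smooth_on U (fun W => W 0 k).
Proof. apply/smooth_onP => n; exact: Ck_coord. Qed.

Lemma smooth_dZ k f : smooth_on U f -> smooth_on U (dZ k f).
Proof. move=> /smooth_onP a; apply/smooth_onP => n; exact: Ck_dZ. Qed.

Lemma smooth_dZbar k f : smooth_on U f -> smooth_on U (dZbar k f).
Proof. move=> /smooth_onP a; apply/smooth_onP => n; exact: Ck_dZbar. Qed.

Lemma smooth_real_derive v f : smooth_on U f -> smooth_on U (real_derive v f).
Proof. by move=> H vs; have := H (rcons vs v); rewrite foldr_rcons. Qed.

Lemma smooth_sum I (s : seq I) (P : pred I) (f : I -> 'rV[C]_N -> C) :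
  (forall i, P i -> smooth_on U (f i)) ->
  smooth_on U (fun W => \sum_(i <- s | P i) f i W).
Proof.
move=> H; apply/smooth_onP => n; apply: Ck_sum => // i /H /smooth_onP; exact.
Qed.

Lemma smooth_prod I (s : seq I) (P : pred I) (f : I -> 'rV[C]_N -> C) :
  (forall i, P i -> smooth_on U (f i)) ->
  smooth_on U (fun W => \prod_(i <- s | P i) f i W).
Proof.
move=> H; elim: s => [|i s IH].
  by apply: smooth_ext (smooth_cst 1) => Z _; rewrite big_nil.
case Pi: (P i); last by apply: smooth_ext IH => Z _; rewrite big_cons Pi.
by apply: smooth_ext (smoothM (H i Pi) IH) => Z _; rewrite big_cons Pi.
Qed.

Lemma smooth_sub f V : V `<=` U -> smooth_on U f -> smooth_on V f.
Proof. by move=> VU H vs Z VZ; apply: (H vs Z); apply: VU. Qed.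

Lemma smooth_cont f Z : smooth_on U f -> U Z -> {for Z, continuous f}.
Proof. by move=> H UZ; have [] := H [::] Z UZ. Qed.

Lemma smooth_C1 f : smooth_on U f -> C1 U f.
Proof. by move=> /smooth_onP /(_ 1) /Ck_C1. Qed.

Lemma smooth_pd f Z v : smooth_on U f -> U Z -> pd f Z v (real_derive v f Z).
Proof. by move=> H UZ; apply: real_derivable_pd; have [_] := H [::] Z UZ. Qed.

Lemma real_derive_ext f g v Z : (forall W, U W -> f W = g W) -> smooth_on U f -> U Z ->
  real_derive v g Z = real_derive v f Z.
Proof.
move=> E sf UZ; have [_ df] := sf [::] Z UZ.
exact: (real_derive_local oU UZ E (df v)).2.
Qed.

Lemma real_deriveD v f g Z : smooth_on U f -> smooth_on U g -> U Z ->
  real_derive v (fun W => f W + g W) Z = real_derive v f Z + real_derive v g Z.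
Proof.
move=> a b UZ.
have H : pd (fun W => f W + g W) Z v (real_derive v f Z + real_derive v g Z) :=
  cderivD (smooth_pd v a UZ) (smooth_pd v b UZ).
exact: (pd_real_derive H).2.
Qed.

Lemma real_deriveM v f g Z : smooth_on U f -> smooth_on U g -> U Z ->
  real_derive v (fun W => f W * g W) Z = real_derive v f Z * g Z + f Z * real_derive v g Z.
Proof.
move=> a b UZ; exact: (pd_real_derive (pdM (smooth_pd v a UZ) (smooth_pd v b UZ))).2.
Qed.

Lemma real_deriveJ v f Z : smooth_on U f -> U Z ->
  real_derive v (fun W => (f W)^*%C) Z = (real_derive v f Z)^*%C.
Proof.
move=> a UZ.
have H : pd (fun W => (f W)^*%C) Z v (real_derive v f Z)^*%C := cderivJ (smooth_pd v a UZ).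
exact: (pd_real_derive H).2.
Qed.

Lemma real_derive_cst v c Z : real_derive v (fun=> c : C) Z = 0.
Proof. exact: (pd_real_derive (cderiv_cst c 0 : pd (fun=> c) Z v 0)).2. Qed.

Lemma real_derive_coord v k Z : real_derive v (fun W => W 0 k) Z = v 0 k.
Proof.
suff H : pd (fun W => W 0 k) Z v (v 0 k) by exact: (pd_real_derive H).2.
have := cderivD (cderiv_cst (Z 0 k) 0) (cderivM (cderiv_id 0) (cderiv_cst (v 0 k) 0)).
rewrite mulr0 mul1r addr0 add0r.
by rewrite (_ : (fun s => _) = (fun s : R => (Z + s%:C%C *: v) 0 k)) //;
  apply/funext => s; rewrite !mxE.
Qed.

(** The mean value estimate is used for the derivative along [u] in the direction [v], then for the
    first difference in the direction [u]. The second difference is symmetric in [u] and [v] but the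
    approximation is not, so comparing both orders yields [real_derive_comm]. *)
Lemma second_difference f Z u v : smooth_on U f -> U Z -> forall e, 0 < e ->
  exists2 d, 0 < d & forall t : R, 0 < t < d ->
  cn (f (Z + t%:C%C *: u + t%:C%C *: v) - f (Z + t%:C%C *: u) - f (Z + t%:C%C *: v) + f Z
      - t%:C%C * (t%:C%C * real_derive v (real_derive u f) Z)) <= 4%:R * e * t * t.
Proof.
move=> sf UZ e e0; pose g := real_derive u f.
have sg : smooth_on U g := smooth_real_derive _ sf.
have /nbhs_rVP[d1 d10 d1P] := open_nbhs_nbhs (conj oU UZ).
have /cont_rVP/(_ _ e0)[d2 d20 d2P] := smooth_cont (smooth_real_derive v sg) UZ.
have u0 := rn_ge0 u; have v0 := rn_ge0 v.
pose d := Num.min d1 d2 / (1 + rn u + rn v).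
have d0 : 0 < d by rewrite divr_gt0 ?lt_min ?d10 //; lra.
exists d => // t /andP[t0]; rewrite ltr_pdivlMr; last lra.
move=> td.
have near s r : `|s| <= t -> `|r| <= t ->
    rn (Z + s%:C%C *: u + r%:C%C *: v - Z) < Num.min d1 d2.
  move=> hs hr; apply: le_lt_trans td.
  rewrite -(addrA Z) (addrC Z) addrK; apply: le_trans (rnD _ _) _; rewrite !rnZR.
  have := ler_wpM2r u0 hs; have := ler_wpM2r v0 hr; lra.
have nt : `|t| = t by rewrite ger0_norm // ltW.
have tt : `|t| <= t by rewrite nt.
have z0 : `|0 : R| <= t by rewrite normr0 ltW.
have inU s r : `|s| <= t -> `|r| <= t -> U (Z + s%:C%C *: u + r%:C%C *: v).
  by move=> hs hr; apply: d1P; have := near s r hs hr; rewrite lt_min => /andP[].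
have H1 s : `|s| <= t ->
    cn (g (Z + s%:C%C *: u + t%:C%C *: v) - g (Z + s%:C%C *: u) - t%:C%C * real_derive v g Z)
      <= 2%:R * e * t.
  move=> hs; have := @cderiv_mvt0 _ (fun r => g (Z + s%:C%C *: u + r%:C%C *: v))
    (fun r => real_derive v g (Z + s%:C%C *: u + r%:C%C *: v)) t (real_derive v g Z) e.
  cbv beta; rewrite (scale0r v) (addr0 (Z + s%:C%C *: u)) nt; apply=> r hr.
    by apply: pd_line; apply: (smooth_pd _ sg); apply: inU.
  by rewrite ltW // d2P //; have := near s r hs hr; rewrite lt_min => /andP[].
have := @cderiv_mvt0 _ (fun s => f (Z + s%:C%C *: u + t%:C%C *: v) - f (Z + s%:C%C *: u))
   (fun s => g (Z + s%:C%C *: u + t%:C%C *: v) - g (Z + s%:C%C *: u)) t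
   (t%:C%C * real_derive v g Z) (2%:R * e * t).
cbv beta; rewrite (scale0r u) (addr0 Z) nt.
move=> H; apply: le_trans (_ : _ <= 2%:R * (2%:R * e * t) * t) _; last by lra.
rewrite (_ : _ - _ - _ + _ - _ = f (Z + t%:C%C *: u + t%:C%C *: v) - f (Z + t%:C%C *: u) -
   (f (Z + t%:C%C *: v) - f Z) - t%:C%C * (t%:C%C * real_derive v g Z)); last by rewrite /g; ring.
apply: H => s hs; last exact: H1.
apply: cderivB.
  rewrite (_ : (fun s => _) = (fun s => f (Z + t%:C%C *: v + s%:C%C *: u))); last first.
    by apply/funext => r; congr f; exact: addrAC.
  rewrite addrAC; apply: pd_line; apply: (smooth_pd _ sf).
  by rewrite addrAC; apply: inU.
apply: pd_line; apply: (smooth_pd _ sf).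
by have := inU s 0 hs z0; rewrite (scale0r v) (addr0 (Z + s%:C%C *: u)).
Qed.

Lemma real_derive_comm f Z u v : smooth_on U f -> U Z ->
  real_derive v (real_derive u f) Z = real_derive u (real_derive v f) Z.
Proof.
move=> sf UZ; set A := LHS; set B := RHS.
apply/eqP; rewrite -subr_eq0; apply/eqP; apply: cn_eq0; rewrite leNgt; apply/negP => AB.
(* The two second differences together leave an error of [8 e t^2], half of [cn (A - B) t^2]. *)
pose e := cn (A - B) / 16%:R; have e0 : 0 < e by rewrite divr_gt0.
have [d1 d10 H1] := second_difference u v sf UZ e0.
have [d2 d20 H2] := second_difference v u sf UZ e0.
pose t := Num.min d1 d2 / 2%:R; have m0 : 0 < Num.min d1 d2 by rewrite lt_min d10.
have t0 : 0 < t by rewrite divr_gt0.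
have tm : t < Num.min d1 d2 by rewrite /t; lra.
move: (tm); rewrite lt_min => /andP[t1 t2].
have := H1 t; rewrite t0 t1 => /(_ isT) {}H1.
have := H2 t; rewrite t0 t2 => /(_ isT) {}H2.
move: H1 H2; rewrite -/A -/B (addrAC Z (t%:C%C *: v)).
set X := (_ + f Z - _); set Y := (_ + f Z - _) => H1 H2.
have : cn (t%:C%C * (t%:C%C * (A - B))) <= cn Y + cn X.
  by rewrite (_ : _ * _ = Y - X) ?cnB // /X /Y; ring.
rewrite !cnMR (ger0_norm (ltW t0)) => H3.
have {H1 H2 H3} : t * (t * cn (A - B)) <= t * (t * (8%:R * e)).
  apply: le_trans H3 _; apply: le_trans (lerD H2 H1) _.
  by rewrite le_eqVlt (_ : _ + _ = t * (t * (8%:R * e))) ?eqxx //; ring.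
by rewrite !ler_pM2l // /e; lra.
Qed.

End SmoothFunctions.

#[local] Opaque real_derive.

(** * Wirtinger derivatives *)

Section Wirtinger.
Context {R : realType} {N : nat}.
Notation C := R[i].
Variable U : set 'rV[C]_N.
Hypothesis oU : open U.
Implicit Types (f g : 'rV[C]_N -> C) (Z v w : 'rV[C]_N).

(** A single index type for both kinds of derivations: fields become families of coefficients over
    it, and its cardinality [2 N] bounds the rank of a formal flow. *)
Definition wirtinger (l : bool * 'I_N) f : 'rV[C]_N -> C :=
  if l.1 then dZ l.2 f else dZbar l.2 f.

Definition wcoord (l : bool * 'I_N) : 'rV[C]_N -> C :=
  fun Z => if l.1 then Z 0 l.2 else (Z 0 l.2)^*%C.

Definition wsign (l : bool * 'I_N) : C := if l.1 then - 'i%C else 'i%C.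

Lemma wirtingerE l f Z : wirtinger l f Z =
  (real_derive (delta_mx 0 l.2) f Z
   + wsign l * real_derive ('i%C *: delta_mx 0 l.2) f Z) * 2%:R^-1.
Proof. by case: l => -[] k //=; rewrite /wirtinger /wsign /= /dZ mulNr. Qed.

Lemma smooth_wirtinger l f : smooth_on U f -> smooth_on U (wirtinger l f).
Proof. by case: l => -[] k H; [apply: smooth_dZ | apply: smooth_dZbar]. Qed.

Lemma wirtinger_ext l f g Z : (forall W, U W -> f W = g W) -> smooth_on U f -> U Z ->
  wirtinger l g Z = wirtinger l f Z.
Proof.
move=> E sf UZ; rewrite !wirtingerE; have H v := real_derive_ext oU v E sf UZ.
by rewrite (H (delta_mx 0 l.2)) (H ('i%C *: delta_mx 0 l.2)).
Qed.

Lemma wirtingerD l f g Z : smooth_on U f -> smooth_on U g -> U Z ->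
  wirtinger l (fun W => f W + g W) Z = wirtinger l f Z + wirtinger l g Z.
Proof.
move=> sf sg UZ; rewrite !wirtingerE; have H v := real_deriveD v sf sg UZ.
rewrite (H (delta_mx 0 l.2)) (H ('i%C *: delta_mx 0 l.2)).
move: (real_derive _ f Z) (real_derive _ f Z) (real_derive _ g Z) (real_derive _ g Z).
by move=> *; ring.
Qed.

Lemma wirtingerM l f g Z : smooth_on U f -> smooth_on U g -> U Z ->
  wirtinger l (fun W => f W * g W) Z = wirtinger l f Z * g Z + f Z * wirtinger l g Z.
Proof.
move=> sf sg UZ; rewrite !wirtingerE; have H v := real_deriveM v sf sg UZ.
rewrite (H (delta_mx 0 l.2)) (H ('i%C *: delta_mx 0 l.2)).
move: (real_derive _ f Z) (real_derive _ f Z) (real_derive _ g Z) (real_derive _ g Z).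
by move: (f Z) (g Z) => *; ring.
Qed.

Lemma wirtingerJ l f Z : smooth_on U f -> U Z ->
  wirtinger l (fun W => (f W)^*%C) Z = (wirtinger (~~ l.1, l.2) f Z)^*%C.
Proof.
move=> sf UZ; rewrite !wirtingerE; have H v := real_deriveJ v sf UZ.
rewrite (H (delta_mx 0 l.2)) (H ('i%C *: delta_mx 0 l.2)) {H} /=.
move: (real_derive _ f Z) (real_derive _ f Z) => A B.
have -> : wsign l = (wsign (~~ l.1, l.2))^*%C.
  by rewrite /wsign; case: l.1; apply: eqReIm; rewrite /= ?oppr0 ?opprK.
rewrite (rmorphM (@conjc R)) (rmorphD (@conjc R)) (rmorphM (@conjc R)).
congr (_ * _); apply/esym; exact: etrans (conjc_inv _) (congr1 GRing.inv (conjc_nat _ 2)).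
Qed.

Lemma wirtinger_cst l c Z : wirtinger l (fun=> c) Z = 0.
Proof. by rewrite wirtingerE !real_derive_cst mulr0 addr0 mul0r. Qed.

Lemma wirtinger_coord l m Z : wirtinger l (wcoord m) Z = (l == m)%:R.
Proof.
have i2 : 'i%C * 'i%C = -1 :> C by rewrite -expr2 sqr_i.
have two : 2%:R != 0 :> C by rewrite pnatr_eq0.
have E v : real_derive v (wcoord m) Z = if m.1 then v 0 m.2 else (v 0 m.2)^*%C.
  case: m => -[] k; first exact: real_derive_coord.
  by rewrite (real_deriveJ (U := setT)) ?real_derive_coord //; apply: smooth_coord; apply: openT.
rewrite wirtingerE (E (delta_mx 0 l.2)) (E ('i%C *: delta_mx 0 l.2)).
have c0 : (0 : C)^*%C = 0 by exact: conjc0.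
have c1 : (1 : C)^*%C = 1 by exact: conjc1.
have ci : ('i%C * 1 : C)^*%C = - 'i%C by apply: eqReIm; rewrite !ReImE /=; ring.
rewrite !mxE eqxx andTb /wsign; case: l m {E} => [a k] [b j].
rewrite -pair_eqE /pair_eq -[(a, k).1]/a -[(a, k).2]/k -[(b, j).1]/b -[(b, j).2]/j (eq_sym k).
case: (j == k); rewrite ?andbT ?andbF ?mulr0 ?c0; last first.
  by case: b; rewrite mulr0 addr0 mul0r.
case: a b => -[]; rewrite ?ci ?mulr1 ?c1 ?mulrN ?mulNr ?i2 ?opprK ?subrr ?addNr ?mul0r //;
  exact: (mulfV two).
Qed.

Lemma real_derive_wirtinger v m f Z : smooth_on U f -> U Z ->
  real_derive v (wirtinger m f) Z =
   (real_derive v (real_derive (delta_mx 0 m.2) f) Z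
   + wsign m * real_derive v (real_derive ('i%C *: delta_mx 0 m.2) f) Z) * 2%:R^-1.
Proof.
move=> sf UZ.
have sr w := smooth_real_derive w sf; have sc c := smooth_cst oU c.
have -> : wirtinger m f = fun Z => (real_derive (delta_mx 0 m.2) f Z
  + wsign m * real_derive ('i%C *: delta_mx 0 m.2) f Z) * 2%:R^-1.
  by apply/funext => W; exact: wirtingerE.
have sm := smoothM oU (sc (wsign m)) (sr ('i%C *: delta_mx 0 m.2)).
have sd := smoothD oU (sr (delta_mx 0 m.2)) sm.
apply: etrans (real_deriveM v sd (sc _) UZ) _.
rewrite real_derive_cst mulr0 addr0; congr (_ * _).
apply: etrans (real_deriveD v (sr _) sm UZ) _; congr (_ + _).
apply: etrans (real_deriveM v (sc _) (sr _) UZ) _.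
by rewrite real_derive_cst mul0r add0r.
Qed.

Lemma wirtinger_comm l m f Z : smooth_on U f -> U Z ->
  wirtinger l (wirtinger m f) Z = wirtinger m (wirtinger l f) Z.
Proof.
move=> sf UZ; rewrite [LHS]wirtingerE [RHS]wirtingerE.
have Hm v := real_derive_wirtinger v m sf UZ; have Hl v := real_derive_wirtinger v l sf UZ.
rewrite (Hm (delta_mx 0 l.2)) (Hm ('i%C *: delta_mx 0 l.2)).
rewrite (Hl (delta_mx 0 m.2)) (Hl ('i%C *: delta_mx 0 m.2)).
have alg (a b c d a' b' c' d' s t h : C) : a = a' -> b = b' -> c = c' -> d = d' ->
    ((a + t * b) * h + s * ((c + t * d) * h)) * h =
    ((a' + s * c') * h + t * ((b' + s * d') * h)) * h.
  by move=> -> -> -> ->; ring.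
by apply: alg; exact: real_derive_comm sf UZ.
Qed.

End Wirtinger.

(** * Composed flows as formal power series *)

(* Sequences multiplied as exponential generating functions: the product is
   determined by [(f g)_0 = f_0 g_0] and the Leibniz rule for the shift. *)
Definition hurwitz (A : Type) := nat -> A.

Section Hurwitz.
Context {A : comNzRingType}.
Implicit Types (f g h : hurwitz A).

HB.instance Definition _ := gen_eqMixin (hurwitz A).
HB.instance Definition _ := gen_choiceMixin (hurwitz A).

Definition hadd f g : hurwitz A := fun n => f n + g n.
Definition hopp f : hurwitz A := fun n => - f n.
Definition hzero : hurwitz A := fun _ => 0.
Definition hone : hurwitz A := fun n => if n is 0%N then 1 else 0.
Definition hshift f : hurwitz A := fun n => f n.+1.

Fixpoint hmuln n f g : A :=
  if n is n'.+1 then hmuln n' (hshift f) g + hmuln n' f (hshift g) else f 0%N * g 0%N.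
Definition hmul f g : hurwitz A := fun n => hmuln n f g.

Lemma haddA : associative hadd.
Proof. by move=> f g h; apply/funext => n; rewrite /hadd addrA. Qed.
Lemma haddC : commutative hadd.
Proof. by move=> f g; apply/funext => n; rewrite /hadd addrC. Qed.
Lemma hadd0 : left_id hzero hadd.
Proof. by move=> f; apply/funext => n; rewrite /hadd add0r. Qed.
Lemma haddN : left_inverse hzero hopp hadd.
Proof. by move=> f; apply/funext => n; rewrite /hadd addNr. Qed.
HB.instance Definition _ := GRing.isZmodule.Build (hurwitz A) haddA haddC hadd0 haddN.

Lemma hmulnC n f g : hmuln n f g = hmuln n g f.
Proof.
by elim: n f g => [|n IH] f g /=; [rewrite mulrC | rewrite addrC IH (IH (hshift f))].
Qed.

Lemma hmulnDl n f g h : hmuln n (hadd f g) h = hmuln n f h + hmuln n g h.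
Proof.
elim: n f g h => [|n IH] f g h /=; first by rewrite mulrDl.
by rewrite (IH (hshift f) (hshift g)) IH addrACA.
Qed.

Lemma hmuln0l n g : hmuln n hzero g = 0.
Proof. by elim: n g => [|n IH] g /=; rewrite ?mul0r // !IH addr0. Qed.

Lemma hmuln1l n g : hmuln n hone g = g n.
Proof. by elim: n g => [|n IH] g /=; [rewrite mul1r | rewrite hmuln0l add0r IH]. Qed.

Lemma hmulnA n f g h : hmuln n f (hmul g h) = hmuln n (hmul f g) h.
Proof.
elim: n f g h => [|n IH] f g h /=; first by rewrite mulrA.
rewrite IH (hmulnC n f) -[hshift (hmul g h)]/(hadd (hmul (hshift g) h) (hmul g (hshift h))).
rewrite hmulnDl !(hmulnC n _ f) !IH addrA; congr (_ + _).
by rewrite -hmulnDl.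
Qed.

Lemma hmulA : associative hmul.
Proof. by move=> f g h; apply/funext => n; exact: hmulnA. Qed.
Lemma hmulC : commutative hmul.
Proof. by move=> f g; apply/funext => n; exact: hmulnC. Qed.
Lemma hmul1l : left_id hone hmul.
Proof. by move=> f; apply/funext => n; exact: hmuln1l. Qed.
Lemma hmulDl : left_distributive hmul hadd.
Proof. by move=> f g h; apply/funext => n; exact: hmulnDl. Qed.
Lemma hone_neq0 : hone != hzero.
Proof. by apply/eqP => /(congr1 (fun f => f 0%N)) /eqP; rewrite /= oner_eq0. Qed.

HB.instance Definition _ := GRing.Zmodule_isComNzRing.Build (hurwitz A)
  hmulA hmulC hmul1l hmulDl hone_neq0.

Lemma hurwitzD f g n : (f + g) n = f n + g n. Proof. by []. Qed.
Lemma hurwitzM0 f g : (f * g) 0%N = f 0%N * g 0%N. Proof. by []. Qed.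
Lemma hurwitzMS f g n : (f * g) n.+1 = (hshift f * g) n + (f * hshift g) n.
Proof. by []. Qed.
Lemma hurwitz_sum I (s : seq I) (P : pred I) (F : I -> hurwitz A) n :
  (\sum_(i <- s | P i) F i) n = \sum_(i <- s | P i) F i n.
Proof. by elim/big_rec2: _ => // i x y _ <-. Qed.

Definition heval0 f : A := f 0%N.
Lemma heval0_is_additive : {morph heval0 : x y / x - y}. Proof. by []. Qed.
Lemma heval0_is_multiplicative : monoid_morphism heval0. Proof. by split. Qed.
HB.instance Definition _ := GRing.isAdditive.Build (hurwitz A) A heval0 heval0_is_additive.
HB.instance Definition _ := GRing.isMonoidMorphism.Build (hurwitz A) A heval0
  heval0_is_multiplicative.

Lemma hurwitzM_congr n f g g' : (forall j, (j <= n)%N -> g j = g' j) ->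
  (f * g) n = (f * g') n.
Proof.
elim: n f g g' => [|n IH] f g g' E; first by rewrite !hurwitzM0 E.
rewrite !hurwitzMS; congr (_ + _); apply: IH => j jn; last exact: E.
by apply: E; rewrite ltnW.
Qed.

(** Of two series starting in degrees [a] and [b], only the product of the leading terms survives in
    degree [a + b]. Its binomial coefficient builds up by Pascal's rule along the Leibniz recursion,
    and it is nonzero over a domain of characteristic 0; this is why the series again form a
    domain. *)
Lemma hurwitz_lead n f g a b : n = (a + b)%N ->
  (forall i, (i < a)%N -> f i = 0) -> (forall j, (j < b)%N -> g j = 0) ->
  (f * g) n = 'C(n, a)%:R * (f a * g b).
Proof.
have low m (u v : hurwitz A) : (forall j, (j <= m)%N -> v j = 0) -> (u * v) m = 0.
  move=> H; rewrite (@hurwitzM_congr m u v 0) ?mulr0 //.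
elim: n f g a b => [|n IH] f g a b.
  by case: a b => [|a] [|b] // _ _ _; rewrite bin0 mul1r.
rewrite hurwitzMS; case: a b => [|a] [|b] // E fa gb.
- rewrite low ?add0r; last by move=> j jn; apply: gb; move: E; rewrite add0n => <-.
  rewrite (IH _ _ 0%N b) ?bin0 //; first by case: E.
  by move=> j; exact: (gb j.+1).
- rewrite (mulrC f) (low _ _ f) ?addr0; last by move: E; rewrite addn0 => -[->] j; exact: fa.
  move: E; rewrite addn0 => -[E]; subst n; rewrite (IH (hshift f) g a 0%N) ?addn0 ?binn //.
  by move=> j; exact: (fa j.+1).
have E' : n = (a + b.+1)%N by case: E.
have E2 : n = (a.+1 + b)%N by rewrite E' addnS.
rewrite (IH (hshift f) g a b.+1 E' (fun j => fa j.+1) gb).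
rewrite (IH f (hshift g) a.+1 b E2 fa (fun j => gb j.+1)).
by rewrite binS natrD mulrDl addrC.
Qed.

Hypothesis domA : forall x y : A, x * y = 0 -> x = 0 \/ y = 0.
Hypothesis charA : forall n, n.+1%:R != 0 :> A.

Lemma hurwitz_domain f g : f * g = 0 -> f = 0 \/ g = 0.
Proof.
have first (u : hurwitz A) : u <> 0 -> exists a, u a <> 0 /\ forall i, (i < a)%N -> u i = 0.
  move=> u0; have ex : exists a, u a != 0.
    apply: contrapT => H; apply: u0; apply/funext => a; apply/eqP/negPn/negP => ua.
    by apply: H; exists a.
  case: (ex_minnP ex) => a ua mina; exists a; split; first exact/eqP.
  by move=> i ia; apply/eqP/negPn/negP => /mina; rewrite leqNgt ia.
move=> fg; have [->|f0] := pselect (f = 0); [by left | right].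
apply: contrapT => g0; have [a [fa ma]] := first f f0; have [b [gb mb]] := first g g0.
have := @hurwitz_lead (a + b)%N f g a b erefl ma mb; rewrite fg => /esym H.
have bin0 : 'C(a + b, a)%:R != 0 :> A by rewrite -(@prednK 'C(a + b, a)) ?charA // bin_gt0 leq_addr.
case: (domA H) => [/eqP|/domA[]//]; by rewrite (negPf bin0).
Qed.

Lemma hurwitz_natr n m : (n%:R : hurwitz A) m = if m is 0%N then n%:R else 0.
Proof.
elim: n => [|n IH]; first by rewrite mulr0n; case: m.
by rewrite mulrS hurwitzD IH; case: m {IH} => [|m]; rewrite /= ?mulrS ?addr0.
Qed.

Lemma hurwitz_char n : n.+1%:R != 0 :> hurwitz A.
Proof.
apply/eqP => /(congr1 (fun f => f 0%N)); rewrite hurwitz_natr => /eqP.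
by rewrite (negPf (charA n)).
Qed.

End Hurwitz.

#[local] Opaque smooth_on.

Section DerivationOperators.
Context {R : realType} {N : nat}.
Notation C := R[i].
Notation L := (bool * 'I_N)%type.
Variable U : set 'rV[C]_N.
Hypothesis oU : open U.
Implicit Types (u v : 'rV[C]_N -> C) (b : L -> 'rV[C]_N -> C) (Z : 'rV[C]_N).

Definition deriv_op b u : 'rV[C]_N -> C := fun Z => \sum_l b l Z * wirtinger l u Z.

Definition smooth_coefs b := forall l, smooth_on U (b l).

Lemma smooth_deriv_op b u : smooth_coefs b -> smooth_on U u -> smooth_on U (deriv_op b u).
Proof.
move=> sb su; apply: (smooth_sum oU) => l _.
exact: (smoothM oU (sb l) (smooth_wirtinger oU _ su)).
Qed.

Lemma smooth_iter_deriv_op b u k : smooth_coefs b -> smooth_on U u ->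
  smooth_on U (iter k (deriv_op b) u).
Proof. by move=> sb su; elim: k => [|k IH]; [exact: su | exact: smooth_deriv_op sb IH]. Qed.

Lemma deriv_op_ext b u v Z : (forall W, U W -> u W = v W) -> smooth_on U u -> U Z ->
  deriv_op b v Z = deriv_op b u Z.
Proof.
by move=> E su UZ; apply: eq_bigr => l _; rewrite (wirtinger_ext oU l E su UZ).
Qed.

Lemma deriv_opD b u v Z : smooth_on U u -> smooth_on U v -> U Z ->
  deriv_op b (fun W => u W + v W) Z = deriv_op b u Z + deriv_op b v Z.
Proof.
move=> su sv UZ; rewrite -big_split; apply: eq_bigr => l _ /=.
by rewrite (wirtingerD l su sv UZ) mulrDr.
Qed.

Lemma deriv_opM b u v Z : smooth_on U u -> smooth_on U v -> U Z ->
  deriv_op b (fun W => u W * v W) Z = deriv_op b u Z * v Z + u Z * deriv_op b v Z.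
Proof.
move=> su sv UZ; rewrite mulr_suml mulr_sumr -big_split; apply: eq_bigr => l _ /=.
rewrite (wirtingerM l su sv UZ); move: (wirtinger l u Z) (wirtinger l v Z) => *; ring.
Qed.

Lemma deriv_op_cst b c : deriv_op b (fun=> c) = fun=> 0.
Proof.
by apply/funext => Z; rewrite /deriv_op big1 // => l _; rewrite wirtinger_cst mulr0.
Qed.

Lemma deriv_op_coord b m : deriv_op b (wcoord m) = b m.
Proof.
apply/funext => Z; rewrite /deriv_op (bigD1 m) //= wirtinger_coord eqxx mulr1.
by rewrite big1 ?addr0 // => l lm; rewrite wirtinger_coord (negPf lm) mulr0.
Qed.

End DerivationOperators.

(** * The formal orbit of a point and its generic rank *)

Section FormalOrbit.
Context {R : realType} {N : nat}.
Notation C := R[i].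
Notation L := (bool * 'I_N)%type.
Variables (U : set 'rV[C]_N) (p : 'rV[C]_N) (B : set (L -> 'rV[C]_N -> C)).
Hypothesis oU : open U.
Hypothesis Up : U p.
Hypothesis sB : forall b, B b -> smooth_coefs U b.
Implicit Types (u v : 'rV[C]_N -> C) (b : L -> 'rV[C]_N -> C) (Z : 'rV[C]_N).

(* [flow_kernel w u] says that the Taylor series at 0 of
   u(exp(t_r X_r) ... exp(t_1 X_1) p) vanishes, for w = [X_r; ...; X_1]. *)
Fixpoint flow_kernel (w : seq (L -> 'rV[C]_N -> C)) u : Prop :=
  if w is b :: w' then forall k, flow_kernel w' (iter k (deriv_op b) u) else u p = 0.

Fixpoint all_in (w : seq (L -> 'rV[C]_N -> C)) : Prop :=
  if w is b :: w' then B b /\ all_in w' else True.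

(* The quotient of the smooth functions by [flow_kernel w], embedded in a
   domain, with [r] vectors over that domain that annihilate the kernel and are
   independent, as some minor does not vanish. *)
Record flow_state (w : seq (L -> 'rV[C]_N -> C)) (r : nat) : Type := FlowState {
  fs_ring : comNzRingType;
  fs_domain : forall x y : fs_ring, x * y = 0 -> x = 0 \/ y = 0;
  fs_char : forall n, n.+1%:R != 0 :> fs_ring;
  fs_map : ('rV[C]_N -> C) -> fs_ring;
  fs_ext : forall u v, smooth_on U u -> (forall Z, U Z -> u Z = v Z) -> fs_map u = fs_map v;
  fs_1 : fs_map (fun=> 1) = 1;
  fs_D : forall u v, smooth_on U u -> smooth_on U v ->
    fs_map (fun Z => u Z + v Z) = fs_map u + fs_map v;
  fs_M : forall u v, smooth_on U u -> smooth_on U v ->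
    fs_map (fun Z => u Z * v Z) = fs_map u * fs_map v;
  fs_ker : forall u, smooth_on U u -> (fs_map u = 0 <-> flow_kernel w u);
  fs_row : 'I_r -> L -> fs_ring;
  fs_tangent : forall i u, smooth_on U u -> fs_map u = 0 ->
    \sum_l fs_row i l * fs_map (wirtinger l u) = 0;
  fs_col : 'I_r -> L;
  fs_minor : \det (\matrix_(i, j) fs_row i (fs_col j)) != 0 }.

Lemma fs_0 w r (S : flow_state w r) : fs_map S (fun=> 0) = 0.
Proof.
have s0 := smooth_cst oU (0 : C); have := fs_D S s0 s0.
have -> : (fun Z : 'rV[C]_N => 0 + 0 : C) = fun=> 0 by apply/funext => Z; rewrite addr0.
by move/eqP; rewrite -subr_eq0 opprD addNKr oppr_eq0 => /eqP.
Qed.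

Lemma fs_sum w r (S : flow_state w r) I (s : seq I) (P : pred I) (F : I -> 'rV[C]_N -> C) :
  (forall i, P i -> smooth_on U (F i)) ->
  fs_map S (fun Z => \sum_(i <- s | P i) F i Z) = \sum_(i <- s | P i) fs_map S (F i).
Proof.
move=> sF; elim: s => [|i s IH].
  rewrite big_nil -(fs_0 S); congr fs_map; apply/funext => Z; exact: big_nil.
rewrite big_cons; case Pi: (P i).
  rewrite -IH -(fs_D S (sF i Pi) (smooth_sum oU _ sF)); congr fs_map.
  by apply/funext => Z; rewrite big_cons Pi.
by rewrite -IH; congr fs_map; apply/funext => Z; rewrite big_cons Pi.
Qed.

(** Before any flow the orbit is the point [p]: evaluation into C and no tangent vector. The empty
    minor is 1. *)
Definition flow_state0 : flow_state [::] 0.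
Proof.
apply: (@FlowState [::] 0 C _ _ (fun u => u p) _ _ _ _ _ (fun _ _ => 0) _
  (fun i => match i with Ordinal _ h => False_rect L (Bool.diff_false_true h) end)).
- by move=> x y /eqP; rewrite mulf_eq0 => /orP[] /eqP; [left | right].
- by move=> n; rewrite pnatr_eq0.
- by move=> u v _; apply.
- by [].
- by [].
- by [].
- by [].
- by case.
- by rewrite det_mx00 oner_eq0.
Defined.

Section Step.
Variables (w : seq (L -> 'rV[C]_N -> C)) (r : nat) (S : flow_state w r).
Variables (b : L -> 'rV[C]_N -> C) (sb : smooth_coefs U b).
Notation A := (fs_ring S).
Notation phi := (fs_map S).
Notation X := (deriv_op b).

(** The Taylor series in t of u(exp(t X)), with coefficients in the ring reached so far. In the
    normalisation of [hurwitz] the k-th coefficient is X^k u, without factorial, and the shift is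
    d/dt. *)
Definition exp_map u : hurwitz A := fun k => phi (iter k X u).

Lemma exp_map_shift u : hshift (exp_map u) = exp_map (X u).
Proof. by apply/funext => k; rewrite /hshift /exp_map iterSr. Qed.

Lemma iter_ext k u v : smooth_on U u -> (forall Z, U Z -> u Z = v Z) ->
  forall Z, U Z -> iter k X u Z = iter k X v Z.
Proof.
move=> su E; elim: k => [|k IH] Z UZ /=; first exact: E.
apply/esym; apply: (deriv_op_ext oU b IH _ UZ); exact: smooth_iter_deriv_op.
Qed.

Lemma exp_map_ext u v : smooth_on U u -> (forall Z, U Z -> u Z = v Z) ->
  exp_map u = exp_map v.
Proof.
move=> su E; apply/funext => k; apply: fs_ext; first exact: smooth_iter_deriv_op.
exact: iter_ext.
Qed.

Lemma exp_map_D u v : smooth_on U u -> smooth_on U v ->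
  exp_map (fun Z => u Z + v Z) = exp_map u + exp_map v.
Proof.
move=> su sv; apply/funext => k; rewrite hurwitzD.
elim: k u v su sv => [|k IH] u v su sv; first exact: fs_D.
have := IH _ _ (smooth_deriv_op oU sb su) (smooth_deriv_op oU sb sv).
rewrite /exp_map -!iterSr => <-; apply: fs_ext.
  exact: (smooth_iter_deriv_op oU k.+1 sb (smoothD oU su sv)).
move=> Z UZ; rewrite !iterSr; apply: iter_ext UZ; first exact: smooth_deriv_op (smoothD oU su sv).
by move=> W UW; apply: deriv_opD UW.
Qed.

Lemma exp_map_M u v : smooth_on U u -> smooth_on U v ->
  exp_map (fun Z => u Z * v Z) = exp_map u * exp_map v.
Proof.
move=> su sv; apply/funext => k.
elim: k u v su sv => [|k IH] u v su sv; first exact: fs_M.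
have sXu := smooth_deriv_op oU sb su; have sXv := smooth_deriv_op oU sb sv.
rewrite hurwitzMS !exp_map_shift -(IH _ _ sXu sv) -(IH _ _ su sXv) -hurwitzD.
rewrite -(exp_map_D (smoothM oU sXu sv) (smoothM oU su sXv)).
rewrite -[LHS]/(hshift _ k) exp_map_shift; congr (_ k).
apply: exp_map_ext; first exact: smooth_deriv_op (smoothM oU su sv).
by move=> Z UZ; apply: deriv_opM UZ.
Qed.

Lemma exp_map_cst c k : exp_map (fun=> c) k = if k is 0%N then phi (fun=> c) else 0.
Proof.
case: k => // k; rewrite -[LHS]/(hshift _ k) exp_map_shift deriv_op_cst.
by rewrite /exp_map; elim: k => [|k IH] /=; rewrite ?fs_0 // -iterS iterSr deriv_op_cst.
Qed.

Lemma exp_map_sum I (s : seq I) (P : pred I) (F : I -> 'rV[C]_N -> C) :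
  (forall i, P i -> smooth_on U (F i)) ->
  exp_map (fun Z => \sum_(i <- s | P i) F i Z) = \sum_(i <- s | P i) exp_map (F i).
Proof.
have e0 : exp_map (fun=> 0) = 0.
  by apply/funext => -[|k]; rewrite exp_map_cst ?fs_0.
move=> sF; elim: s => [|i s IH].
  rewrite big_nil -e0; congr exp_map; apply/funext => Z; exact: big_nil.
rewrite big_cons; case Pi: (P i).
  rewrite -IH -(exp_map_D (sF i Pi) (smooth_sum oU _ sF)); congr exp_map.
  by apply/funext => Z; rewrite big_cons Pi.
by rewrite -IH; congr exp_map; apply/funext => Z; rewrite big_cons Pi.
Qed.

Lemma exp_map_op u : smooth_on U u ->
  exp_map (X u) = \sum_l exp_map (b l) * exp_map (wirtinger l u).
Proof.
move=> su; rewrite exp_map_sum => [|l _]; last first.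
  exact: (smoothM oU (sb l) (smooth_wirtinger oU _ su)).
by apply: eq_bigr => l _; rewrite (exp_map_M (sb l) (smooth_wirtinger oU l su)).
Qed.

(* The image of a vector along the flow; [transport_chain] below says that it
   is again a vector, with components its values on the coordinates. *)
Definition tvec (c : L -> A) u : A := \sum_l c l * phi (wirtinger l u).
Lemma tvec_coord c l : tvec c (wcoord l) = c l.
Proof.
have E m : wirtinger m (wcoord l) = fun=> (m == l)%:R.
  by apply/funext => Z; rewrite wirtinger_coord.
rewrite /tvec (bigD1 l) //= E eqxx fs_1 mulr1 big1 ?addr0 // => m ml.
by rewrite E (negPf ml) fs_0 mulr0.
Qed.

Definition transport c u : hurwitz A := fun k => tvec c (iter k X u).

Lemma transport_shift c u : hshift (transport c u) = transport c (X u).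
Proof. by apply/funext => k; rewrite /hshift /transport iterSr. Qed.

Lemma tvec_ext c u v : smooth_on U u -> (forall Z, U Z -> u Z = v Z) -> tvec c u = tvec c v.
Proof.
move=> su E; apply: eq_bigr => l _; congr (_ * _); apply: fs_ext.
  exact: smooth_wirtinger.
by move=> Z UZ; apply/esym; apply: (wirtinger_ext oU l E su UZ).
Qed.

Lemma tvecD c u v : smooth_on U u -> smooth_on U v ->
  tvec c (fun Z => u Z + v Z) = tvec c u + tvec c v.
Proof.
move=> su sv; rewrite -big_split; apply: eq_bigr => l _ /=; rewrite -mulrDr; congr (_ * _).
rewrite -(fs_D S (smooth_wirtinger oU l su) (smooth_wirtinger oU l sv)); apply: fs_ext.
  exact: (smooth_wirtinger oU l (smoothD oU su sv)).
by move=> Z UZ; apply: wirtingerD UZ.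
Qed.

Lemma tvecM c u v : smooth_on U u -> smooth_on U v ->
  tvec c (fun Z => u Z * v Z) = tvec c u * phi v + phi u * tvec c v.
Proof.
move=> su sv; rewrite mulr_suml mulr_sumr -big_split; apply: eq_bigr => l _ /=.
have su' := smooth_wirtinger oU l su; have sv' := smooth_wirtinger oU l sv.
have -> : phi (wirtinger l (fun Z => u Z * v Z)) =
    phi (wirtinger l u) * phi v + phi u * phi (wirtinger l v).
  rewrite -(fs_M S su' sv) -(fs_M S su sv') -(fs_D S (smoothM oU su' sv) (smoothM oU su sv')).
  apply: fs_ext; first exact: (smooth_wirtinger oU l (smoothM oU su sv)).
  by move=> Z UZ; apply: wirtingerM UZ.
by move: (phi _) (phi _) (phi _) (phi _) => *; ring.
Qed.

Lemma transport_ext c u v : smooth_on U u -> (forall Z, U Z -> u Z = v Z) ->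
  transport c u = transport c v.
Proof.
move=> su E; apply/funext => k; apply: tvec_ext; first exact: smooth_iter_deriv_op.
exact: iter_ext.
Qed.

Lemma transportD c u v : smooth_on U u -> smooth_on U v ->
  transport c (fun Z => u Z + v Z) = transport c u + transport c v.
Proof.
move=> su sv; apply/funext => k; rewrite hurwitzD.
elim: k u v su sv => [|k IH] u v su sv; first exact: tvecD.
have sXu := smooth_deriv_op oU sb su; have sXv := smooth_deriv_op oU sb sv.
transitivity (transport c (fun Z => X u Z + X v Z) k); last first.
  rewrite (IH _ _ sXu sXv) -!transport_shift; reflexivity.
rewrite -[LHS]/(hshift _ k) transport_shift; congr (_ k).
apply: transport_ext; first exact: smooth_deriv_op (smoothD oU su sv).
by move=> Z UZ; apply: deriv_opD UZ.
Qed.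

Lemma transportM c u v : smooth_on U u -> smooth_on U v ->
  transport c (fun Z => u Z * v Z) = transport c u * exp_map v + exp_map u * transport c v.
Proof.
move=> su sv; apply/funext => k; rewrite hurwitzD.
elim: k u v su sv => [|k IH] u v su sv; first exact: tvecM.
have sXu := smooth_deriv_op oU sb su; have sXv := smooth_deriv_op oU sb sv.
rewrite !hurwitzMS !exp_map_shift !transport_shift.
rewrite -[LHS]/(hshift _ k) transport_shift.
rewrite (@transport_ext _ _ (fun Z => X u Z * v Z + u Z * X v Z)); last first.
- by move=> Z UZ; apply: deriv_opM UZ.
- exact: smooth_deriv_op (smoothM oU su sv).
rewrite (transportD c (smoothM oU sXu sv) (smoothM oU su sXv)).
by rewrite hurwitzD (IH _ _ sXu sv) (IH _ _ su sXv) addrACA.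
Qed.

Lemma transport_sum c I (s : seq I) (F : I -> 'rV[C]_N -> C) :
  (forall i, smooth_on U (F i)) ->
  transport c (fun Z => \sum_(i <- s) F i Z) = \sum_(i <- s) transport c (F i).
Proof.
move=> sF; elim: s => [|i s IH].
  rewrite big_nil (_ : (fun _ => _) = fun=> 0); last by apply/funext => Z; exact: big_nil.
  have t0 : transport c (fun=> 0) = transport c (fun=> 0) + transport c (fun=> 0).
    rewrite -transportD; try exact: smooth_cst; congr transport.
    by apply/funext => Z; rewrite addr0.
  by move/eqP: t0; rewrite -subr_eq0 opprD addNKr oppr_eq0 => /eqP.
rewrite big_cons -IH -(transportD c (sF i) (smooth_sum oU s (fun j _ => sF j))).
by congr transport; apply/funext => Z; rewrite big_cons.
Qed.

(** Induction on the degree, for all smaller degrees at once because a coefficient of a product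
    involves them. Applying [X] once produces derivatives of the coefficients [b l], matched by the
    induction hypothesis, and second derivatives of [u], exchanged by [wirtinger_comm]. *)
Lemma transport_chain c u : smooth_on U u ->
  transport c u = \sum_l transport c (wcoord l) * exp_map (wirtinger l u).
Proof.
suff H k : forall j, (j <= k)%N -> forall u, smooth_on U u -> transport c u j =
    (\sum_l transport c (wcoord l) * exp_map (wirtinger l u)) j.
  by move=> su; apply/funext => k; apply: (H k).
elim: k => [|k IH] j.
  rewrite leqn0 => /eqP -> {}u su; rewrite hurwitz_sum; apply: eq_bigr => l _.
  by rewrite hurwitzM0; congr (_ * _); apply/esym; exact: tvec_coord.
rewrite leq_eqVlt => /orP[/eqP -> {}u su|]; last by rewrite ltnS => /IH.
have sw l := smooth_wirtinger oU l su.
rewrite -[LHS]/(hshift _ k) transport_shift.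
rewrite (transport_sum c _ (fun l => smoothM oU (sb l) (sw l))).
under eq_bigr => l _ do rewrite (transportM c (sb l) (sw l)).
rewrite big_split /= hurwitzD.
rewrite [RHS](_ : _ =
    (\sum_l (transport c (b l) * exp_map (wirtinger l u) +
       transport c (wcoord l) * exp_map (X (wirtinger l u)))) k); last first.
  rewrite (hurwitz_sum _ _ _ k.+1) (hurwitz_sum _ _ _ k); apply: eq_bigr => l _.
  by rewrite hurwitzMS exp_map_shift transport_shift deriv_op_coord.
rewrite big_split /= hurwitzD; congr (_ + _).
transitivity ((\sum_m exp_map (b m) *
    \sum_l transport c (wcoord l) * exp_map (wirtinger l (wirtinger m u))) k).
  rewrite (hurwitz_sum _ _ _ k) [RHS](hurwitz_sum _ _ _ k); apply: eq_bigr => m _.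
  apply: hurwitzM_congr => i ik; exact: (IH i ik _ (sw m)).
apply: (congr1 (fun f : hurwitz A => f k)).
transitivity (\sum_m \sum_l exp_map (b m) *
    (transport c (wcoord l) * exp_map (wirtinger l (wirtinger m u)))).
  by apply: eq_bigr => m _; exact: mulr_sumr.
rewrite exchange_big /=; apply: eq_bigr => l _; rewrite (exp_map_op (sw l)) mulr_sumr.
apply: eq_bigr => m _; rewrite mulrCA; congr (_ * (_ * _)).
apply: exp_map_ext; first exact: (smooth_wirtinger oU l (sw m)).
by move=> Z UZ; exact: (wirtinger_comm oU l m su UZ).
Qed.

Section Extension.
Variable l0 : L.
Let erow (i : 'I_r.+1) (l : L) : A :=
  if unlift ord0 i is Some i' then fs_row S i' l else phi (b l).
Let ecol (j : 'I_r.+1) : L := if unlift ord0 j is Some j' then fs_col S j' else l0.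
Hypothesis bordered : \det (\matrix_(i, j) erow i (ecol j)) != 0.

(** The old vectors carried along by the flow, and the velocity of the flow itself. Both annihilate
    the new kernel. Their constant terms in t are the rows [erow], so a minor that is nonzero there
    is nonzero as a series. *)
Let hrow (i : 'I_r.+1) (l : L) : hurwitz A :=
  if unlift ord0 i is Some i' then transport (fs_row S i') (wcoord l) else exp_map (b l).

Definition flow_step : flow_state (b :: w) r.+1.
Proof.
apply: (@FlowState (b :: w) r.+1 (hurwitz A) _ _ exp_map exp_map_ext _ exp_map_D exp_map_M
  _ hrow _ ecol _).
- exact: (hurwitz_domain (@fs_domain _ _ S) (@fs_char _ _ S)).
- exact: (hurwitz_char (@fs_char _ _ S)).
- by apply/funext => -[|k]; rewrite exp_map_cst ?fs_1.
- move=> u su; split=> [u0 k|u0].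
    apply/fs_ker; first exact: smooth_iter_deriv_op.
    by rewrite -[LHS]/(exp_map u k) u0.
  apply/funext => k; apply/(fs_ker S); first exact: smooth_iter_deriv_op.
  exact: u0.
- move=> i u su u0; rewrite /hrow; case: (unlift ord0 i) => [i'|]; last first.
    by rewrite -exp_map_op // -exp_map_shift u0.
  rewrite -transport_chain //; apply/funext => k; apply: fs_tangent.
    exact: smooth_iter_deriv_op.
  by rewrite -[LHS]/(exp_map u k) u0.
apply/eqP => /(congr1 (fun f => heval0 f)); rewrite -det_map_mx rmorph0.
move/eqP: bordered => H E; apply: H; rewrite -E; congr (\det _); apply/matrixP => i j.
rewrite !mxE /hrow /erow; case: (unlift ord0 i) => [i'|] //.
by apply/esym; exact: tvec_coord.
Qed.

End Extension.

(** The known minor is bordered by the row of [X] and one more column. If some bordered minor is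
    nonzero, the rank grows. If all vanish, a multiple of [X] by the known minor is a combination of
    the known rows, which annihilate the kernel; the minor can be cancelled in a domain, so [X]
    preserves the kernel. *)
Lemma flow_step_or_stable :
  (forall u, smooth_on U u -> flow_kernel w u -> flow_kernel w (X u)) \/
  inhabited (flow_state (b :: w) r.+1).
Proof.
have [st|nst] := pselect (forall u, smooth_on U u -> flow_kernel w u -> flow_kernel w (X u)).
  by left.
right; pose erow (i : 'I_r.+1) (l : L) : A :=
  if unlift ord0 i is Some i' then fs_row S i' l else phi (b l).
pose M l : 'M[A]_r.+1 := \matrix_(i, j)
  erow i (if unlift ord0 j is Some j' then fs_col S j' else l).
have [[l0 Hl0]|all0] := pselect (exists l, \det (M l) != 0).
  by split; exact: (flow_step Hl0).
case: nst => u su /(fs_ker S su) u0; apply/(fs_ker S); first exact: smooth_deriv_op.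
(* These cofactors along the added column do not depend on [l], so one linear relation holds in all
   columns; the coefficient of the row of [X] is the known minor. *)
pose K (i : 'I_r.+1) : A := (-1) ^+ (i + (ord0 : 'I_r.+1)) *
  \det (\matrix_(a < r, c < r) erow (lift i a) (fs_col S c)).
have detM l : \sum_i erow i l * K i = 0.
  have /eqP : \det (M l) == 0 by apply/negPn/negP => h; apply: all0; exists l.
  rewrite (expand_det_col _ ord0) => E; rewrite -[RHS]E; apply: eq_bigr => i _.
  rewrite !mxE unlift_none; congr (_ * _); rewrite /cofactor; congr (_ * \det _).
  by apply/matrixP => a c; rewrite !mxE liftK.
have : \sum_l (\sum_i erow i l * K i) * phi (wirtinger l u) = 0.
  by rewrite big1 // => l _; rewrite detM mul0r.
under eq_bigr => l _ do rewrite mulr_suml.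
rewrite exchange_big big_ord_recl /= [X in _ + X]big1 ?addr0; last first.
  move=> i _; transitivity (K (lift ord0 i) * \sum_l fs_row S i l * phi (wirtinger l u)).
    rewrite mulr_sumr; apply: eq_bigr => l _; rewrite /erow liftK.
    by move: (K _) (phi _) (fs_row _ _ _) => *; ring.
  by rewrite fs_tangent // mulr0.
have -> : \sum_l erow ord0 l * K ord0 * phi (wirtinger l u) = K ord0 * phi (X u).
  rewrite fs_sum => [|l _]; last exact: (smoothM oU (sb l) (smooth_wirtinger oU _ su)).
  rewrite mulr_sumr; apply: eq_bigr => l _; rewrite (fs_M S (sb l) (smooth_wirtinger oU l su)).
  by rewrite /erow unlift_none; move: (K _) (phi _) (phi _) => *; ring.
move/(@fs_domain _ _ S) => [K0|//]; have := fs_minor S.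
move: K0; rewrite /K /= expr0 mul1r => K0; rewrite -K0 => /eqP[]; congr (\det _).
by apply/matrixP => i j; rewrite !mxE /erow liftK.
Qed.

End Step.

(** Pigeonhole on the columns: with more rows than derivations two columns of the minor coincide. *)
Lemma flow_state_rank w r : flow_state w r -> (r <= #|{: L}|)%N.
Proof.
move=> S; have := fs_minor S; rewrite leqNgt; apply: contraNN => rL.
have [i [j [ij cij]]] : exists i j, i != j /\ fs_col S i = fs_col S j.
  apply: contrapT => H; have inj : injective (fs_col S).
    move=> i j cij; apply/eqP/negPn/negP => ij; apply: H; exists i, j; split=> //.
  by have := leq_card _ inj; rewrite card_ord leqNgt rL.
apply/eqP; rewrite -det_tr; apply: (determinant_alternate ij) => k.
by rewrite !mxE cij.
Qed.

Theorem flow_kernel_stabilizes : exists w, [/\ all_in w, (size w <= N + N)%N &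
  forall b, B b -> forall u, smooth_on U u -> flow_kernel w u -> flow_kernel w (deriv_op b u)].
Proof.
apply: contrapT => H.
have card : #|{: L}| = (N + N)%N by rewrite card_prod card_bool card_ord mul2n addnn.
suff [w [_ _ [S]]] : exists w, [/\ all_in w, size w = (N + N).+1 &
    inhabited (flow_state w (N + N).+1)].
  by have := flow_state_rank S; rewrite card ltnn.
suff main r : (r <= (N + N).+1)%N -> exists w, [/\ all_in w, size w = r &
    inhabited (flow_state w r)] by exact: main.
elim: r => [_|r IH rN]; first by exists [::]; split=> //; split; exact: flow_state0.
have [w [wB sw [S]]] := IH (ltnW rN).
have [b [Bb nst]] : exists b, B b /\
    ~ (forall u, smooth_on U u -> flow_kernel w u -> flow_kernel w (deriv_op b u)).
  apply: contrapT => H'; apply: H; exists w; split=> //; first by rewrite sw.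
  by move=> b Bb; apply: contrapT => nst; apply: H'; exists b.
by have [//|S'] := flow_step_or_stable S (sB Bb); exists (b :: w); split=> //=; rewrite sw.
Qed.

End FormalOrbit.

(** * Integrals and holomorphic functions *)

Section RealPrimitive.
Context {R : realType}.
Notation mu := (@lebesgue_measure R).

Lemma ex_primitive (f : R -> R) a b : a <= b ->
  (forall t, a <= t <= b -> {for t, continuous f}) ->
  exists F : R -> R, forall t, a <= t <= b -> is_derive t (1 : R) F (f t).
Proof.
(* Clamping to [a, b] extends [f] to a continuous function on the line. Integrating from [a - 1],
   within an interval reaching to [b + 1], makes both endpoints interior, so that derivatives there
   are two-sided. *)
move=> ab cf; pose cl x : R := Num.max a (Num.min b x).
have cl_in x : a <= cl x <= b by rewrite /cl le_max lexx ge_max ab ge_min lexx.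
have cl_id x : a <= x <= b -> cl x = x.
  by move=> /andP[ax xb]; rewrite /cl (min_idPr xb) (max_idPr ax).
have cl_lip x y : `|cl x - cl y| <= `|x - y|.
  have lmax u v : `|Num.max a u - Num.max a v| <= `|u - v|.
    case: (leP a u) => h1; case: (leP a v) => h2; case: (ger0P (u - v)) => h3;
    first [by lra | rewrite ler_norml; apply/andP; split; lra].
  apply: le_trans (lmax _ _) _.
  case: (leP b x) => h1; case: (leP b y) => h2; case: (ger0P (x - y)) => h3;
  first [by lra | rewrite ler_norml; apply/andP; split; lra].
pose g x := f (cl x).
have cg : continuous g.
  move=> x; apply/cvgrPdist_lt => e e0.
  have /cvgrPdist_lt/(_ _ e0) /nbhs_ballP[d /= d0 dP] := cf (cl x) (cl_in x).
  apply/nbhs_ballP; exists d => // y xy; apply: dP.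
  by apply: le_lt_trans (cl_lip x y) _.
pose F x := (\int[mu]_(t in [set` `[a - 1, x]%R]) g t)%R.
exists F => t tab.
have ig : mu.-integrable `[a - 1, b + 1] (EFin \o g).
  apply: continuous_compact_integrable; first exact: segment_compact.
  exact: continuous_subspaceT.
have [//||dF F't] := @continuous_FTC1_closed R g (a - 1) t (b + 1) _ ig _ (cg t).
- by move/andP: tab => [? ?]; lra.
- by move/andP: tab => [? ?]; lra.
have := derivable_is_derive1 dF; rewrite F't /g cl_id //.
Qed.
End RealPrimitive.

(** * Complex-valued integrals and their dependence on parameters *)

Section ComplexIntegral.
Context {R : realType}.
Notation C := R[i].
Implicit Types (f g F G : R -> C) (a b t : R).

Definition ccont g t := forall e : R, 0 < e -> exists2 d : R, 0 < d &
  forall h, `|h| < d -> cn (g (t + h) - g t) < e.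

Lemma ccont_Re g t : ccont g t -> {for t, continuous (fun s => Re (g s))}.
Proof.
move=> H; apply/cvgrPdist_lt => e /H[d d0 dP]; apply/nbhs_ballP; exists d => // s.
rewrite /ball /= distrC => st; have := dP (s - t) st; rewrite (addrC t) subrK.
by apply: le_lt_trans; rewrite -normrN opprB; apply: le_trans (Re_cn _); rewrite !ReImE.
Qed.

Lemma ccont_Im g t : ccont g t -> {for t, continuous (fun s => Im (g s))}.
Proof.
move=> H; apply/cvgrPdist_lt => e /H[d d0 dP]; apply/nbhs_ballP; exists d => // s.
rewrite /ball /= distrC => st; have := dP (s - t) st; rewrite (addrC t) subrK.
by apply: le_lt_trans; rewrite -normrN opprB; apply: le_trans (Im_cn _); rewrite !ReImE.
Qed.

Lemma cderiv_ccont F t l : cderiv F t l -> ccont F t.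
Proof. exact: cderiv_cont. Qed.

Definition primitive_on a b F g := forall t, a <= t <= b -> cderiv F t (g t).

(** For [a <= b] the difference does not depend on the primitive; 0 stands for the absence of one.
    Rules for integrals thus reduce to rules for derivatives, and integration theory enters only
    through the existence of primitives. *)
Definition cint g a b : C :=
  xget 0 [set I | exists F, primitive_on a b F g /\ I = F b - F a].

Lemma primitive_incr_unique a b F G g : a <= b -> primitive_on a b F g ->
  primitive_on a b G g -> F b - F a = G b - G a.
Proof.
move=> ab pF pG; apply/eqP; rewrite -subr_eq0; apply/eqP; apply: cn_eq0.
have H : cn (F b - G b - (F a - G a) - (b - a)%:C%C * 0) <= 2%:R * 0 * (b - a).
  apply: (@cderiv_mvt _ (fun s => F s - G s) (fun=> 0) a b 0 0 ab) => t tab.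
    by have := cderivB (pF t tab) (pG t tab); rewrite subrr.
  by rewrite subrr cn0.
move: H; rewrite !mulr0 mul0r subr0; congr (cn _ <= _); ring.
Qed.

Lemma cint_primitive F g a b : a <= b -> primitive_on a b F g -> cint g a b = F b - F a.
Proof.
move=> ab pF; rewrite /cint; case: xgetP => [I -> [G [pG ->]]|/(_ (F b - F a))[]].
  exact: primitive_incr_unique pG pF.
by exists F.
Qed.

Lemma ex_cprimitive g a b : a <= b -> (forall t, a <= t <= b -> ccont g t) ->
  exists F, primitive_on a b F g.
Proof.
move=> ab cg.
have [F1 pF1] := ex_primitive ab (fun t tab => ccont_Re (cg t tab)).
have [F2 pF2] := ex_primitive ab (fun t tab => ccont_Im (cg t tab)).
by exists (fun t => (F1 t +i* F2 t)%C) => t tab; apply/cderivP; split; [exact: pF1 | exact: pF2].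
Qed.

Lemma ccontD f g t : ccont f t -> ccont g t -> ccont (fun s => f s + g s) t.
Proof.
move=> cf cg e e0; have e2 : 0 < e / 2%:R by rewrite divr_gt0.
have [d d0 dP] := cf _ e2; have [d' d'0 d'P] := cg _ e2.
exists (Num.min d d'); first by rewrite lt_min d0.
move=> h; rewrite lt_min => /andP[/dP h1 /d'P h2].
have := cnD (f (t + h) - f t) (g (t + h) - g t).
rewrite (_ : _ + _ = f (t + h) + g (t + h) - (f t + g t)); last by ring.
by lra.
Qed.

Lemma ccontZ c f t : ccont f t -> ccont (fun s => c * f s) t.
Proof.
move=> cf e e0; have c0 := cn_ge0 c; have k0 : 0 < e / (1 + cn c) by rewrite divr_gt0 //; lra.
have [d d0 dP] := cf _ k0; exists d => // h /dP; rewrite ltr_pdivlMr; last lra.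
have := cnM c (f (t + h) - f t); rewrite mulrBr.
by have := cn_ge0 (f (t + h) - f t); nra.
Qed.

Lemma ccontB f g t : ccont f t -> ccont g t -> ccont (fun s => f s - g s) t.
Proof.
move=> cf cg; have := ccontD cf (ccontZ (-1) cg); congr ccont.
by apply/funext => s; rewrite mulN1r.
Qed.

Lemma cint_ext f g a b : a <= b -> (forall t, a <= t <= b -> f t = g t) ->
  (forall t, a <= t <= b -> ccont f t) -> cint f a b = cint g a b.
Proof.
move=> ab E cf; have [F pF] := ex_cprimitive ab cf.
rewrite (cint_primitive ab pF) (cint_primitive (F := F) ab) // => t tab.
by rewrite -E //; exact: pF.
Qed.

Lemma cintZ c f a b : a <= b -> (forall t, a <= t <= b -> ccont f t) ->
  cint (fun t => c * f t) a b = c * cint f a b.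
Proof.
move=> ab cf; have [F pF] := ex_cprimitive ab cf.
rewrite (cint_primitive ab pF) (cint_primitive (F := fun t => c * F t) ab) ?mulrBr //.
by move=> t tab; apply: cderivZ; exact: pF.
Qed.

Lemma cintB f g a b : a <= b -> (forall t, a <= t <= b -> ccont f t) ->
  (forall t, a <= t <= b -> ccont g t) ->
  cint (fun t => f t - g t) a b = cint f a b - cint g a b.
Proof.
move=> ab cf cg; have [F pF] := ex_cprimitive ab cf; have [G pG] := ex_cprimitive ab cg.
rewrite (cint_primitive ab pF) (cint_primitive ab pG).
rewrite (cint_primitive (F := fun t => F t - G t) ab); first by ring.
by move=> t tab; apply: cderivB; [exact: pF | exact: pG].
Qed.

Lemma cint_cat f a b c : a <= b -> b <= c -> (forall t, a <= t <= c -> ccont f t) ->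
  cint f a c = cint f a b + cint f b c.
Proof.
move=> ab bc cf; have ac := le_trans ab bc; have [F pF] := ex_cprimitive ac cf.
rewrite (cint_primitive ac pF) (cint_primitive (F := F) ab) ?(cint_primitive (F := F) bc).
- by ring.
- by move=> t /andP[h1 h2]; apply: pF; rewrite h2 (le_trans ab).
- by move=> t /andP[h1 h2]; apply: pF; rewrite h1 (le_trans h2).
Qed.

Lemma cint_bound f a b l M : a <= b -> (forall t, a <= t <= b -> ccont f t) ->
  (forall t, a <= t <= b -> cn (f t - l) <= M) ->
  cn (cint f a b - (b - a)%:C%C * l) <= 2%:R * M * (b - a).
Proof.
move=> ab cf bf; have [F pF] := ex_cprimitive ab cf; rewrite (cint_primitive ab pF).
exact: (cderiv_mvt ab pF bf).
Qed.

Lemma cint_close f g a b M : a <= b -> (forall t, a <= t <= b -> ccont f t) ->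
  (forall t, a <= t <= b -> ccont g t) ->
  (forall t, a <= t <= b -> cn (f t - g t) <= M) ->
  cn (cint f a b - cint g a b) <= 2%:R * M * (b - a).
Proof.
move=> ab cf cg bfg; rewrite -cintB //.
have := @cint_bound (fun t => f t - g t) a b 0 M ab; rewrite mulr0 subr0; apply.
  by move=> t tab; apply: ccontB; [exact: cf | exact: cg].
by move=> t tab; rewrite subr0; exact: bfg.
Qed.

Lemma cint_cst c a b : a <= b -> cint (fun=> c) a b = (b - a)%:C%C * c.
Proof.
move=> ab; rewrite (cint_primitive (F := fun t => t%:C%C * c) ab).
  by rewrite (rmorphB (real_complex R)) mulrBl.
move=> t _; have := cderivM (cderiv_id t) (cderiv_cst c t).
by rewrite mul1r mulr0 addr0.
Qed.

Definition jcont N (G : R -> 'rV[C]_N -> C) t Z := forall e : R, 0 < e ->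
  exists2 d : R, 0 < d & forall s W, `|s| < d -> rn (W - Z) < d -> cn (G (t + s) W - G t Z) < e.

Lemma jcont_ccont N (G : R -> 'rV[C]_N -> C) t Z : jcont G t Z -> ccont (fun s => G s Z) t.
Proof.
by move=> H e /H[d d0 dP]; exists d => // h hd; apply: dP; rewrite // subrr rn0.
Qed.

(** Compactness of [a, b] turns joint continuity at each [(t, Z)] into an estimate uniform in [t],
    as needed under an integral. *)
Lemma tube N (G : R -> 'rV[C]_N -> C) a b Z : 
  (forall t, a <= t <= b -> jcont G t Z) -> forall e : R, 0 < e ->
  exists2 d : R, 0 < d & forall t W, a <= t <= b -> rn (W - Z) < d ->
    cn (G t W - G t Z) < e.
Proof.
move=> cG e e0; have e2 : 0 < e / 2%:R by rewrite divr_gt0.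
have /compact_near_coveringP cov := @segment_compact R a b.
pose P (d t : R) := forall W, rn (W - Z) < d -> cn (G t W - G t Z) < e.
have loc : forall t, `[a, b]%classic t -> \forall t' \near t & d \near 0^'+, P d t'.
  move=> t /=; rewrite in_itv /= => /cG /(_ _ e2) [d d0 dP].
  exists (ball t d, [set x | 0 < x < d]).
    split; first exact: nbhsx_ballx.
    change (\forall x \near (0:R)^'+, 0 < x < d).
    rewrite near_withinE; apply/nbhs_ballP; exists d => //= x.
    rewrite /ball /= sub0r normrN => xd x0; rewrite x0 /=.
    by rewrite gtr0_norm in xd.
  move=> [s x] /= [ts /andP[x0 xd]] W WZ.
  have hs : `|s - t| < d by rewrite distrC.
  have h1 := dP (s - t) W hs (lt_trans WZ xd).
  have h2 := dP (s - t) Z hs; rewrite subrr rn0 in h2.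
  have {}h2 := h2 d0; rewrite (addrC t) subrK in h1 h2.
  have := cnB (G s W - G t Z) (G s Z - G t Z).
  by rewrite (_ : _ - _ - (_ - _) = G s W - G s Z); [lra | ring].
have : \forall d \near (0:R)^'+, `[a, b]%classic `<=` P d by exact: cov.
rewrite near_withinE near_nbhs => /nbhs_ballP[d /= d0 dP].
exists (d / 2%:R); first by rewrite divr_gt0.
move=> t W tab WZ; apply: (dP (d / 2%:R)) => //=.
- by rewrite /ball /= sub0r normrN gtr0_norm ?divr_gt0 //; lra.
- by rewrite divr_gt0.
Qed.

Lemma continuous_cint N (G : R -> 'rV[C]_N -> C) a b Z : a <= b ->
  (exists2 r, 0 < r & forall t W, a <= t <= b -> rn (W - Z) < r -> jcont G t W) ->
  {for Z, continuous (fun W => cint (fun t => G t W) a b)}.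
Proof.
move=> ab [r r0 cG]; apply/cont_rVP => e e0.
pose e1 := e / (4%:R * (1 + (b - a))).
have k0 : 0 < 4%:R * (1 + (b - a)) by move: ab; lra.
have e10 : 0 < e1 by rewrite divr_gt0.
have cGZ t : a <= t <= b -> jcont G t Z by move=> tab; apply: cG; rewrite ?subrr ?rn0.
have [d d0 dP] := tube cGZ e10.
exists (Num.min d r); first by rewrite lt_min d0.
move=> W; rewrite lt_min => /andP[Wd Wr].
apply: le_lt_trans (_ : 2%:R * e1 * (b - a) < _).
  apply: cint_close => // t tab; first exact: jcont_ccont (cG t W tab Wr).
    exact: jcont_ccont (cGZ t tab).
  by rewrite ltW // dP.
have : e1 * (4%:R * (1 + (b - a))) = e by rewrite /e1 divfK // lt0r_neq0.
by move: ab e10; nra.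
Qed.

(** The mean value estimate in the parameter holds for each [t], and [tube] applied to [G'] makes
    its error uniform, so it survives integration. *)
Lemma pd_cint N (G G' : R -> 'rV[C]_N -> C) a b Z v : a <= b ->
  (exists2 r, 0 < r & forall t W, a <= t <= b -> rn (W - Z) < r ->
     [/\ jcont G t W, jcont G' t W & pd (G t) W v (G' t W)]) ->
  pd (fun W => cint (fun t => G t W) a b) Z v (cint (fun t => G' t Z) a b).
Proof.
move=> ab [r r0 cG] e e0.
pose e1 := e / (8%:R * (1 + (b - a))).
have k0 : 0 < 8%:R * (1 + (b - a)) by move: ab; lra.
have e10 : 0 < e1 by rewrite divr_gt0.
have inZ : rn (Z - Z) < r by rewrite subrr rn0.
have cG'Z t : a <= t <= b -> jcont G' t Z by move=> tab; have [] := cG t Z tab inZ.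
have [d d0 dP] := tube cG'Z e10.
have v0 := rn_ge0 v; have m0 : 0 < Num.min d r by rewrite lt_min d0.
exists (Num.min d r / (1 + rn v)); first by rewrite divr_gt0 //; lra.
move=> h; rewrite ltr_pdivlMr; last lra.
move=> hm; rewrite add0r (scale0r v) (addr0 Z).
have near s : `|s| <= `|h| -> rn (Z + s%:C%C *: v - Z) < Num.min d r.
  move=> sh; apply: le_lt_trans hm; rewrite (addrC Z) addrK rnZR.
  by have := normr_ge0 h; nra.
have nearh := near h (lexx _); move: (nearh); rewrite lt_min => /andP[hd hr].
have cW t : a <= t <= b -> ccont (fun t => G t (Z + h%:C%C *: v)) t.
  by move=> tab; have [/jcont_ccont] := cG t _ tab hr.
have cZ t : a <= t <= b -> ccont (fun t => G t Z) t.
  by move=> tab; have [/jcont_ccont] := cG t _ tab inZ.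
have c'Z t : a <= t <= b -> ccont (fun t => G' t Z) t.
  by move=> tab; have [_ /jcont_ccont] := cG t _ tab inZ.
rewrite -(cintB ab cW cZ) -(cintZ _ ab c'Z).
apply: le_trans (_ : 2%:R * (2%:R * e1 * `|h|) * (b - a) <= _).
  apply: cint_close => // t tab.
  - by apply: ccontB; [exact: cW | exact: cZ].
  - exact: ccontZ (c'Z t tab).
  have := @cderiv_mvt0 _ (fun s => G t (Z + s%:C%C *: v)) (fun s => G' t (Z + s%:C%C *: v))
    h (G' t Z) e1; rewrite (scale0r v) (addr0 Z); apply=> s /near; rewrite lt_min => /andP[s1 s2].
    by apply: pd_line; have [] := cG t _ tab s2.
  by rewrite ltW // dP.
have : e1 * (8%:R * (1 + (b - a))) = e by rewrite /e1 divfK // lt0r_neq0.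
have h0 := normr_ge0 h => E.
have : 2%:R * (2%:R * e1) * (b - a) <= e by move: ab e10; nra.
by move=> H; have := ler_wpM2r h0 H; lra.
Qed.

End ComplexIntegral.

(** * Goursat's theorem and the mean value property *)

Section Goursat.
Context {R : realType}.
Notation C := R[i].
Implicit Types (G : R -> R -> C).

Definition hdiff G x y := exists l : C, forall e : R, 0 < e -> exists2 d : R, 0 < d &
  forall h k, `|h| < d -> `|k| < d ->
    cn (G (x + h) (y + k) - G x y - (h +i* k)%C * l) <= e * (`|h| + `|k|).

Lemma hdiff_ccontx G x y : hdiff G x y -> ccont (fun s => G s y) x.
Proof.
move=> [l H]; apply: (@cderiv_ccont _ _ _ l) => e /H[d d0 dP]; exists d => // h hd.
have := dP h 0 hd; rewrite normr0 addr0 addr0; apply; exact: d0.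
Qed.

Lemma hdiff_cconty G x y : hdiff G x y -> ccont (fun s => G x s) y.
Proof.
move=> [l H]; apply: (@cderiv_ccont _ _ _ ('i%C * l)) => e /H[d d0 dP]; exists d => // k kd.
have := dP 0 k; rewrite normr0 add0r addr0 => /(_ d0 kd).
by rewrite mulrA (_ : (0 +i* k)%C = k%:C%C * 'i%C) //; apply: eqReIm; rewrite !ReImE /=; ring.
Qed.

(** The contour integral of G dz along the counterclockwise boundary of a rectangle; dz is i dy on
    the vertical sides. *)
Definition boundary G x0 x1 y0 y1 : C :=
  cint (fun s => G s y0) x0 x1 - cint (fun s => G s y1) x0 x1 +
  'i%C * (cint (G x1) y0 y1 - cint (G x0) y0 y1).

Lemma boundary_split G x0 xm x1 y0 ym y1 : x0 <= xm -> xm <= x1 -> y0 <= ym -> ym <= y1 ->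
  (forall x y, x0 <= x <= x1 -> y0 <= y <= y1 -> hdiff G x y) ->
  boundary G x0 x1 y0 y1 = boundary G x0 xm y0 ym + boundary G xm x1 y0 ym +
    (boundary G x0 xm ym y1 + boundary G xm x1 ym y1).
Proof.
move=> h1 h2 h3 h4 dG; have xx := le_trans h1 h2; have yy := le_trans h3 h4.
have cx y : y0 <= y <= y1 -> forall x, x0 <= x <= x1 -> ccont (fun s => G s y) x.
  by move=> Hy x Hx; apply: hdiff_ccontx; exact: dG.
have cy x : x0 <= x <= x1 -> forall y, y0 <= y <= y1 -> ccont (fun s => G x s) y.
  by move=> Hx y Hy; apply: hdiff_cconty; exact: dG.
have Hy0 : y0 <= y0 <= y1 by rewrite lexx.
have Hy1 : y0 <= y1 <= y1 by rewrite lexx andbT.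
have Hx0 : x0 <= x0 <= x1 by rewrite lexx.
have Hx1 : x0 <= x1 <= x1 by rewrite lexx andbT.
rewrite /boundary (cint_cat h1 h2 (cx _ Hy0)) (cint_cat h1 h2 (cx _ Hy1)).
rewrite (cint_cat h3 h4 (cy _ Hx0)) (cint_cat h3 h4 (cy _ Hx1)).
by move: (cint _ _ _) (cint _ _ _) (cint _ _ _) (cint _ _ _) (cint _ _ _) (cint _ _ _)
 (cint _ _ _) (cint _ _ _) (cint _ _ _) (cint _ _ _) (cint _ _ _) (cint _ _ _) => *; ring.
Qed.

(** The quadratic [P] is a primitive along horizontal lines and -i [P] one along vertical lines, so
    the corner values cancel. *)
Lemma boundary_affine A l z x0 x1 y0 y1 : x0 <= x1 -> y0 <= y1 ->
  boundary (fun x y => A + ((x +i* y)%C - z) * l) x0 x1 y0 y1 = 0.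
Proof.
move=> hx hy; pose P (x y : R) : C := A * (x +i* y)%C + ((x +i* y)%C - z) ^+ 2 * (l / 2%:R).
have two : 2%:R != 0 :> C by rewrite pnatr_eq0.
have dx x y : cderiv (fun s => P s y) x (A + ((x +i* y)%C - z) * l).
  have d1 : cderiv (fun s : R => (s +i* y)%C) x 1.
    have := cderivD (cderiv_id x) (cderiv_cst (0 +i* y)%C x); rewrite addr0.
    by congr cderiv; apply/funext => s; apply: eqReIm; rewrite !ReImE /=; ring.
  have d2 := cderivB d1 (cderiv_cst z x).
  have := cderivD (cderivM (cderiv_cst A x) d1) (cderivM (cderivM d2 d2) (cderiv_cst (l / 2%:R) x)).
  by congr cderiv; field.
have dy x y : cderiv (fun s => - 'i%C * P x s) y (A + ((x +i* y)%C - z) * l).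
  have d1 : cderiv (fun s : R => (x +i* s)%C) y 'i%C.
    have := cderivD (cderivZ 'i%C (cderiv_id y)) (cderiv_cst (x%:C)%C y); rewrite addr0 mulr1.
    by congr cderiv; apply/funext => s; apply: eqReIm; rewrite !ReImE /=; ring.
  have d2 := cderivB d1 (cderiv_cst z y).
  have := cderivZ (- 'i%C) (cderivD (cderivM (cderiv_cst A y) d1)
    (cderivM (cderivM d2 d2) (cderiv_cst (l / 2%:R) y))).
  congr cderiv; transitivity (- ('i%C * 'i%C) * (A + ((x +i* y)%C - z) * l)); first by field.
  by rewrite -expr2 sqr_i opprK mul1r.
rewrite /boundary (cint_primitive (F := fun s => P s y0) hx) //.
rewrite (cint_primitive (F := fun s => P s y1) hx) //.
rewrite (cint_primitive (F := fun s => - 'i%C * P x1 s) hy) //.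
rewrite (cint_primitive (F := fun s => - 'i%C * P x0 s) hy) //.
have alg (a b c d : C) : b - a - (d - c) + 'i%C * (- 'i%C * d - - 'i%C * b - (- 'i%C * c - - 'i%C * a)) = 0.
  transitivity ((b - a - (d - c)) * (1 + 'i%C * 'i%C)); first by ring.
  by rewrite -expr2 sqr_i subrr mulr0.
exact: alg.
Qed.

Lemma nested_point (X w : nat -> R) : (forall n, X n <= X n.+1) ->
  (forall n, X n.+1 + w n.+1 <= X n + w n) -> (forall n, 0 <= w n) ->
  exists x, forall n, X n <= x <= X n + w n.
Proof.
move=> incX decX w0.
have mX m k : X m <= X (m + k)%N.
  by elim: k => [|k IH]; rewrite ?addn0 // addnS; apply: le_trans IH _.
have mY m k : X (m + k)%N + w (m + k)%N <= X m + w m.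
  by elim: k => [|k IH]; rewrite ?addn0 // addnS; apply: le_trans IH.
have XY m n : X m <= X n + w n.
  have h1 := mX m n; have h2 := mY n m; have h3 := w0 (n + m)%N.
  by rewrite addnC in h1; lra.
pose S := [set X n | n in [set: nat]].
have Sne : S !=set0 by exists (X 0%N), 0%N.
have hS : has_sup S by split=> //; exists (X 0%N + w 0%N) => _ [m _ <-].
exists (sup S) => n; apply/andP; split.
  by apply: ub_le_sup; [case: hS | exists n].
by apply: ge_sup => // _ [m _ <-].
Qed.

Definition q n : R := (2%:R^-1) ^+ n.
Lemma q_gt0 n : 0 < q n. Proof. by rewrite exprn_gt0 // invr_gt0. Qed.
Lemma q_half n : q n.+1 + q n.+1 = q n.
Proof. by rewrite /q exprS; field. Qed.

Lemma q_small K d : 0 < K -> 0 < d -> exists n, K * q n < d.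
Proof.
move=> K0 d0; exists (Num.bound (K / d)).
have := archi_boundP (ltW (divr_gt0 K0 d0)); set n := Num.bound _ => Hn.
rewrite /q exprVn ltr_pdivrMr ?exprn_gt0 //.
rewrite ltr_pdivrMr // mulrC in Hn; apply: lt_le_trans Hn _.
by rewrite ler_pM2l // -natrX ler_nat ltnW // ltn_expl.
Qed.

Theorem goursat G x0 y0 a b : 0 <= a -> 0 <= b ->
  (forall x y, x0 <= x <= x0 + a -> y0 <= y <= y0 + b -> hdiff G x y) ->
  boundary G x0 (x0 + a) y0 (y0 + b) = 0.
Proof.
move=> a0 b0 dG; apply: cn_eq0; rewrite leNgt; apply/negP; set c := cn _ => c0.
pose sq (z : R * R * nat) : C := boundary G z.1.1 (z.1.1 + a * q z.2) z.1.2 (z.1.2 + b * q z.2).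
(* [z] is a corner with a level n, and the rectangle of level n retains at least the fraction 4^-n
   of the contour integral. *)
pose P (z : R * R * nat) : Prop := [/\ x0 <= z.1.1, z.1.1 + a * q z.2 <= x0 + a,
  y0 <= z.1.2, z.1.2 + b * q z.2 <= y0 + b & c * (q z.2 * q z.2) <= cn (sq z)].
(* Stating the bisection as an implication makes it total, so that [choice] provides a successor
   function. *)
pose Q z z' : Prop := P z -> [/\ P z', z'.2 = z.2.+1,
   z.1.1 <= z'.1.1 <= z.1.1 + a * q z.2.+1 & z.1.2 <= z'.1.2 <= z.1.2 + b * q z.2.+1].
have exQ z : exists z', Q z z'.
  have [Pz|nPz] := pselect (P z); last by exists z => /nPz.
  case: z Pz => [[x y] n] Pz; case: (Pz) => /= h1 h2 h3 h4 h5.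
  have qn := q_gt0 n; have qn1 := q_gt0 n.+1; have qh := q_half n.
  set w := a * q n.+1; set v := b * q n.+1.
  have w0 : 0 <= w by rewrite mulr_ge0 // ltW.
  have v0 : 0 <= v by rewrite mulr_ge0 // ltW.
  have ww : x + a * q n = x + w + w by rewrite -qh mulrDr addrA.
  have vv : y + b * q n = y + v + v by rewrite -qh mulrDr addrA.
  rewrite /sq /= ww vv in h5; rewrite ww in h2; rewrite vv in h4.
  have S : boundary G x (x + w + w) y (y + v + v) =
    sq (x, y, n.+1) + sq (x + w, y, n.+1) + (sq (x, y + v, n.+1) + sq (x + w, y + v, n.+1)).
    rewrite /sq /= -/w -/v; apply: boundary_split; rewrite ?lerDl //.
    move=> s t /andP[s1 s2] /andP[t1 t2].
    by apply: dG; apply/andP; split; lra.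
  rewrite S in h5.
  have : exists2 z', z' \in [:: (x, y); (x + w, y); (x, y + v); (x + w, y + v)] &
      c * (q n.+1 * q n.+1) <= cn (sq (z', n.+1)).
    apply: contrapT => H.
    have bad z' : z' \in [:: (x, y); (x + w, y); (x, y + v); (x + w, y + v)] ->
        cn (sq (z', n.+1)) < c * (q n.+1 * q n.+1).
      by move=> zz'; rewrite ltNge; apply/negP => h; apply: H; exists z'.
    have b1 := bad (x, y); have b2 := bad (x + w, y); have b3 := bad (x, y + v).
    have b4 := bad (x + w, y + v).
    rewrite !inE !eqxx ?orbT /= in b1 b2 b3 b4.
    have {}b1 := b1 isT; have {}b2 := b2 isT; have {}b3 := b3 isT; have {}b4 := b4 isT.
    have t1 := cnD (sq (x, y, n.+1) + sq (x + w, y, n.+1)) (sq (x, y + v, n.+1) + sq (x + w, y + v, n.+1)).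
    have t2 := cnD (sq (x, y, n.+1)) (sq (x + w, y, n.+1)).
    have t3 := cnD (sq (x, y + v, n.+1)) (sq (x + w, y + v, n.+1)).
    have E : c * (q n * q n) = 4%:R * (c * (q n.+1 * q n.+1)) by rewrite -qh; ring.
    by rewrite E in h5; lra.
  move=> [z' zz' hz']; exists (z', n.+1) => _ /=; rewrite -/w -/v.
  have [zx zy] : (z'.1 = x \/ z'.1 = x + w) /\ (z'.2 = y \/ z'.2 = y + v).
    by move: zz'; rewrite !inE => /or4P[] /eqP ->; split; [left|left|right|left|left|right|right|right].
  split=> //.
  - split; rewrite /= -/w -/v; [case: zx => ->; lra | case: zx => ->; lra |
      case: zy => ->; lra | case: zy => ->; lra | exact: hz'].
  - by case: zx => ->; lra.
  - by case: zy => ->; lra.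
have [nx nxQ] := choice exQ; pose f n := iter n nx (x0, y0, 0%N).
have f0 : f 0%N = (x0, y0, 0%N) by [].
have fQ n : Q (f n) (f n.+1) by exact: nxQ.
have Pf n : P (f n) /\ (f n).2 = n.
  elim: n => [|n [IH En]].
    rewrite f0; split; last by [].
    by split; rewrite /sq /= /q ?expr0 ?mulr1 lexx.
  by have [P' E' _ _] := fQ n IH; rewrite E' En.
have [x Hx] : exists x, forall n, (f n).1.1 <= x <= (f n).1.1 + a * q n.
  apply: (@nested_point (fun n => (f n).1.1) (fun n => a * q n)) => n.
  - by have [IH En] := Pf n; have [_ _ /andP[]] := fQ n IH.
  - have [IH En] := Pf n; have [_ _ /andP[_ h] _] := fQ n IH.
    by rewrite En in h; have := q_half n => E; rewrite -E; lra.
  - by rewrite mulr_ge0 // ltW // q_gt0.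
have [y Hy] : exists y, forall n, (f n).1.2 <= y <= (f n).1.2 + b * q n.
  apply: (@nested_point (fun n => (f n).1.2) (fun n => b * q n)) => n.
  - by have [IH En] := Pf n; have [_ _ _ /andP[]] := fQ n IH.
  - have [IH En] := Pf n; have [_ _ _ /andP[_ h]] := fQ n IH.
    by rewrite En in h; have := q_half n => E; rewrite -E; lra.
  - by rewrite mulr_ge0 // ltW // q_gt0.
have [l Hl] : hdiff G x y.
  have := Hx 0%N; have := Hy 0%N; rewrite f0 /= /q expr0 !mulr1; exact: (fun u v => dG x y v u).
have K0 : 0 < 1 + a + b by lra.
(* Approximating by the linear part bounds the contour integral at level n by [4 e ((a + b) q n)^2],
   which this [e] makes smaller than [c (q n)^2]; the 1 in the denominator allows degenerate
   rectangles. *)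
pose e := c / (8%:R * ((1 + a + b) * (1 + a + b))).
have e0 : 0 < e by rewrite divr_gt0 // !mulr_gt0.
have [d d0 dP] := Hl e e0; have [n Hn] := q_small K0 d0.
have [[h1 h2 h3 h4 hc] En] := Pf n; move: (Hx n) (Hy n); rewrite /sq En in h2 h4 hc *.
have qn := q_gt0 n; move: (f n).1.1 (f n).1.2 h1 h2 h3 h4 hc => xn yn h1 h2 h3 h4 hc.
move=> /andP[x1 x2] /andP[y1 y2].
have aq : 0 <= a * q n by rewrite mulr_ge0 // ltW.
have bq : 0 <= b * q n by rewrite mulr_ge0 // ltW.
pose lin (s t : R) : C := G x y + ((s +i* t)%C - (x +i* y)%C) * l.
have close s t : xn <= s <= xn + a * q n -> yn <= t <= yn + b * q n ->
    cn (G s t - lin s t) <= e * ((a + b) * q n).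
  move=> /andP[s1 s2] /andP[t1 t2].
  have sx : `|s - x| <= a * q n by rewrite ler_norml; apply/andP; split; lra.
  have ty : `|t - y| <= b * q n by rewrite ler_norml; apply/andP; split; lra.
  have Hd := dP (s - x) (t - y).
  have -> : lin s t = G x y + ((s - x) +i* (t - y))%C * l.
    by congr (_ + _ * _); apply: eqReIm; rewrite !ReImE.
  rewrite opprD addrA; rewrite !(addrC _ (_ - _)) !subrK in Hd.
  apply: le_trans (Hd _ _) _; [nra | nra |].
  by apply: ler_wpM2l; [exact: ltW | lra].
have dGn s t : xn <= s <= xn + a * q n -> yn <= t <= yn + b * q n -> hdiff G s t.
  by move=> /andP[s1 s2] /andP[t1 t2]; apply: dG; apply/andP; split; lra.
have dlin s t : hdiff lin s t.
  exists l => e' e'0; exists 1 => // h k _ _.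
  rewrite (_ : _ - _ - _ = 0) ?cn0; first by rewrite mulr_ge0 ?addr_ge0 // ltW.
  rewrite /lin (_ : ((s + h) +i* (t + k))%C = (s +i* t)%C + (h +i* k)%C); last exact: eqReIm.
  by ring.
have xn2 : xn <= xn + a * q n by rewrite lerDl.
have yn2 : yn <= yn + b * q n by rewrite lerDl.
pose M := e * ((a + b) * q n).
have sidex t : yn <= t <= yn + b * q n ->
    cn (cint (fun s => G s t) xn (xn + a * q n) - cint (fun s => lin s t) xn (xn + a * q n))
    <= 2%:R * M * (xn + a * q n - xn).
  move=> Ht; apply: cint_close => // s Hs.
  - exact: (hdiff_ccontx (dGn s t Hs Ht)).
  - exact: (hdiff_ccontx (dlin s t)).
  - exact: close.
have sidey s : xn <= s <= xn + a * q n ->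
    cn (cint (G s) yn (yn + b * q n) - cint (lin s) yn (yn + b * q n))
    <= 2%:R * M * (yn + b * q n - yn).
  move=> Hs; apply: cint_close => // t Ht.
  - exact: (hdiff_cconty (dGn s t Hs Ht)).
  - exact: (hdiff_cconty (dlin s t)).
  - exact: close.
have Hx0 : xn <= xn <= xn + a * q n by rewrite lexx.
have Hx1 : xn <= xn + a * q n <= xn + a * q n by rewrite lexx andbT.
have Hy0 : yn <= yn <= yn + b * q n by rewrite lexx.
have Hy1 : yn <= yn + b * q n <= yn + b * q n by rewrite lexx andbT.
have S1 := sidex _ Hy0; have S2 := sidex _ Hy1; have S3 := sidey _ Hx0; have S4 := sidey _ Hx1.
have Ex : xn + a * q n - xn = a * q n by ring.
have Ey : yn + b * q n - yn = b * q n by ring.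
rewrite Ex in S1 S2; rewrite Ey in S3 S4.
have lin0 : boundary lin xn (xn + a * q n) yn (yn + b * q n) = 0 by exact: boundary_affine.
have : cn (boundary G xn (xn + a * q n) yn (yn + b * q n)) <= 4%:R * M * ((a + b) * q n).
  rewrite -[boundary G _ _ _ _]subr0 -lin0 /boundary.
  have alg A1 A2 A3 A4 B1 B2 B3 B4 :
      cn ((A1 - A2 + 'i%C * (A3 - A4)) - (B1 - B2 + 'i%C * (B3 - B4)) : C) <=
      cn (A1 - B1) + cn (A2 - B2) + (cn (A3 - B3) + cn (A4 - B4)).
    rewrite (_ : _ - _ = ((A1 - B1) - (A2 - B2)) + 'i%C * ((A3 - B3) - (A4 - B4))); last by ring.
    apply: le_trans (cnD _ _) _; rewrite cni; apply: lerD; exact: cnB.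
  apply: le_trans (alg _ _ _ _ _ _ _ _) _.
  apply: le_trans (lerD (lerD S1 S2) (lerD S4 S3)) _.
  by rewrite le_eqVlt; apply/orP; left; apply/eqP; ring.
rewrite /M => hh; have := le_trans hc hh; rewrite leNgt => /negP[].
have E : e * (8%:R * ((1 + a + b) * (1 + a + b))) = c.
  by rewrite /e divfK // lt0r_neq0 // !mulr_gt0.
rewrite -E.
have -> : 4%:R * (e * ((a + b) * q n)) * ((a + b) * q n) = (e * (q n * q n)) * (4%:R * ((a + b) * (a + b))) by ring.
have -> : e * (8%:R * ((1 + a + b) * (1 + a + b))) * (q n * q n) = (e * (q n * q n)) * (8%:R * ((1 + a + b) * (1 + a + b))) by ring.
rewrite ltr_pM2l; last exact: (mulr_gt0 e0 (mulr_gt0 qn qn)).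
have s2 : 0 <= (a + b) * (a + b) by rewrite mulr_ge0 // addr_ge0.
by lra.
Qed.


Definition cdiff (g : C -> C) z := exists l : C, forall e : R, 0 < e ->
  exists2 d : R, 0 < d & forall w, cn w < d -> cn (g (z + w) - g z - w * l) <= e * cn w.

Definition unit_circle (t : R) : C := (cos t +i* sin t)%C.

Lemma cn_unit_circle t : cn (unit_circle t) <= 2%:R.
Proof. by rewrite /cn /=; have := cos_max t; have := sin_max t; lra. Qed.

Lemma unit_circleD s t : unit_circle (s + t) = unit_circle s * unit_circle t.
Proof. by apply: eqReIm; rewrite !ReImE /= ?cosD ?sinD; ring. Qed.

Lemma unit_circle_norm t : unit_circle t * (unit_circle t)^*%C = 1.
Proof.
by apply: eqReIm; rewrite !ReImE /=; [rewrite -(cos2Dsin2 t) !expr2; ring | ring].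
Qed.

Lemma unit_circle_2pi : unit_circle (pi *+ 2) = unit_circle 0.
Proof. by rewrite /unit_circle cos2pi sin2pi cos0 sin0. Qed.

Lemma exp_expand (e : R) : 0 < e -> exists2 d : R, 0 < d & forall h k : R, `|h| < d -> `|k| < d ->
  cn ((expR h)%:C%C * unit_circle k - 1 - (h +i* k)%C) <= e * (`|h| + `|k|).
Proof.
move=> e0; pose e1 := Num.min 1 (e / 8%:R).
have e10 : 0 < e1 by rewrite lt_min ltr01 divr_gt0.
have e11 : e1 <= 1 by rewrite ge_min lexx.
have e1e : e1 * 8%:R <= e by rewrite -ler_pdivlMr // ge_min lexx orbT.
clearbody e1.
have /is_derive_epsP/(_ _ e10)[d1 d10 H1] := is_derive_expR (0 : R).
have /is_derive_epsP/(_ _ e10)[d2 d20 H2] := is_derive_cos (0 : R).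
have /is_derive_epsP/(_ _ e10)[d3 d30 H3] := is_derive_sin (0 : R).
pose d := Num.min (Num.min d1 d2) (Num.min d3 (Num.min (8%:R^-1) e1)).
have d0 : 0 < d by rewrite !lt_min d10 d20 d30 e10 andbT; lra.
exists d => // h k; rewrite !lt_min => /andP[/andP[h1 _] /andP[_ /andP[h4 h5]]].
move=> /andP[/andP[_ k2] /andP[k3 /andP[k4 k5]]].
have := H1 h h1; have := H2 k k2; have := H3 k k3.
rewrite !add0r expR0 cos0 sin0 !oppr0 mulr0 !mulr1 !subr0 !addr0 => S Co E.
set x := expR h in E *; set c := cos k in Co *; set s := sin k in S *.
rewrite /cn !ReImE /= !mul0r !subr0 addr0 -/c -/s -/x {H1 H2 H3}.
clearbody x c s; clear d d0 d10 d20 d30.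
have x1 : `|x - 1| <= 2%:R * `|h|.
  have := ler_normD (x - 1 - h) h; rewrite subrK.
  by have := ler_wpM2r (normr_ge0 h) e11; lra.
have x2 : `|x| <= 2%:R.
  by have := ler_normD (x - 1) 1; rewrite subrK normr1; lra.
have t1 : `|x * c - 1 - h| <= e1 * `|h| + 2%:R * (e1 * `|k|).
  rewrite (_ : _ - _ - _ = (x - 1 - h) + x * (c - 1)); last by ring.
  apply: le_trans (ler_normD _ _) _; rewrite lerD // normrM.
  exact: (ler_pM (normr_ge0 _) (normr_ge0 _) x2 Co).
have t2 : `|x * s - k| <= 2%:R * (e1 * `|k|) + 2%:R * `|h| * e1.
  rewrite (_ : _ - _ = x * (s - k) + (x - 1) * k); last by ring.
  apply: le_trans (ler_normD _ _) _; rewrite !normrM; apply: lerD.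
    exact: (ler_pM (normr_ge0 _) (normr_ge0 _) x2 S).
  exact: (ler_pM (normr_ge0 _) (normr_ge0 _) x1 (ltW k5)).
have hk : e1 * 8%:R * (`|h| + `|k|) <= e * (`|h| + `|k|) by rewrite ler_wpM2r ?addr_ge0.
have h0 : 0 <= e1 * `|h| by rewrite mulr_ge0 // ltW.
have k0 : 0 <= e1 * `|k| by rewrite mulr_ge0 // ltW.
by lra.
Qed.

(** exp(s + i t) is complex differentiable in s + i t, so polar coordinates with logarithmic radius
    preserve complex differentiability. A punctured disc becomes a half-plane, to which the theorem
    on rectangles applies. *)
Lemma hdiff_polar (g : C -> C) c s t : cdiff g (c + (expR s)%:C%C * unit_circle t) ->
  hdiff (fun s t => g (c + (expR s)%:C%C * unit_circle t)) s t.
Proof.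
move=> [l H]; set z := _ * unit_circle t in H; exists (z * l) => e e0.
have Ez h k : (expR (s + h))%:C%C * unit_circle (t + k) = z * ((expR h)%:C%C * unit_circle k).
  rewrite expRD unit_circleD (rmorphM (real_complex R)) /z.
  by move: (unit_circle t) (unit_circle k) => *; ring.
have z0 := cn_ge0 z; have l0 := cn_ge0 l.
pose K := 1 + cn z; have K0 : 0 < K by rewrite /K; lra.
pose e1 := e / (4%:R * K); have e10 : 0 < e1 by rewrite divr_gt0 // mulr_gt0.
have [d d0 dP] := H e1 e10.
pose e2 := Num.min 1 (e / (2%:R * (1 + cn z * cn l))).
have m0 : 0 < 2%:R * (1 + cn z * cn l) by rewrite mulr_gt0 // ltr_wpDr // mulr_ge0.
have e20 : 0 < e2 by rewrite lt_min ltr01 divr_gt0.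
have e21 : e2 <= 1 by rewrite ge_min lexx.
have e2e : e2 * (2%:R * (1 + cn z * cn l)) <= e by rewrite -ler_pdivlMr // ge_min lexx orbT.
have [d' d'0 d'P] := exp_expand e20.
pose d2 := Num.min d' (d / (4%:R * K)).
have d20 : 0 < d2 by rewrite lt_min d'0 divr_gt0 // mulr_gt0.
exists d2 => // h k; rewrite !lt_min => /andP[h1 h2] /andP[k1 k2].
have := d'P h k h1 k1; rewrite Ez; set E := _ * unit_circle k.
set r := E - 1 - _ => Hr; set n := `|h| + `|k| in Hr *.
have n0 : 0 <= n by rewrite addr_ge0.
pose w := z * (E - 1).
have -> : c + z * E = c + z + w by rewrite /w; ring.
have Hhk : cn (h +i* k)%C = n by [].
have cE : cn (E - 1) <= 2%:R * n.
  have := cnD r (h +i* k)%C; rewrite subrK Hhk.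
  by have := ler_wpM2r n0 e21; lra.
have cw : cn w <= 2%:R * K * n.
  apply: le_trans (cnM _ _) _; rewrite /K; have := cn_ge0 (E - 1); nra.
have wd : cn w < d.
  apply: le_lt_trans cw _; rewrite ltr_pdivlMr ?mulr_gt0 // in h2.
  by rewrite ltr_pdivlMr ?mulr_gt0 // in k2; rewrite /n; lra.
have Hw := dP w wd.
rewrite (_ : _ - _ - _ = (g (c + z + w) - g (c + z) - w * l) + z * r * l); last first.
  by rewrite /w /r; move: (h +i* k)%C (g _) (g _) => *; ring.
apply: le_trans (cnD _ _) _.
have c1 : cn (z * r * l) <= cn z * cn l * (e2 * n).
  apply: le_trans (cnM _ _) _; have := cnM z r; have := cn_ge0 r.
  have := ler_wpM2l (mulr_ge0 z0 l0) Hr; have := cn_ge0 (z * r); nra.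
have c2 : e1 * cn w <= e / 2%:R * n.
  apply: le_trans (ler_wpM2l (ltW e10) cw) _.
  have -> : e1 * (2%:R * K * n) = e1 * (4%:R * K) * n / 2%:R by field.
  by rewrite /e1 divfK ?lt0r_neq0 ?mulr_gt0 //; lra.
have c3 : e2 * (2%:R * (1 + cn z * cn l)) * n <= e * n by rewrite ler_wpM2r.
by have := mulr_ge0 (ltW e20) n0; lra.
Qed.

Theorem mean_value (g : C -> C) c (rho r : R) : 0 < r < rho ->
  (forall s t : R, 0 < s < rho -> cdiff g (c + s%:C%C * unit_circle t)) ->
  (forall e : R, 0 < e -> exists2 d : R, 0 < d & forall w, cn w < d -> cn (g (c + w) - g c) < e) ->
  cint (fun t => g (c + r%:C%C * unit_circle t)) 0 (pi *+ 2) = (pi *+ 2)%:C%C * g c.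
Proof.
move=> /andP[r0 rrho] dg cg; pose G s t := g (c + (expR s)%:C%C * unit_circle t).
pose s1 := ln r; have Es1 : expR s1 = r by rewrite lnK // posrE.
have dG s t : s <= s1 -> hdiff G s t.
  move=> ss1; apply: hdiff_polar; apply: dg; rewrite expR_gt0 /=.
  by apply: le_lt_trans rrho; rewrite -Es1 ler_expR.
have p0 : 0 <= pi *+ 2 :> R by rewrite mulrn_wge0 // pi_ge0.
have flat s : s <= s1 -> cint (G s) 0 (pi *+ 2) = cint (G s1) 0 (pi *+ 2).
  move=> ss1; have := @goursat G s 0 (s1 - s) (pi *+ 2).
  rewrite subr_ge0 add0r (addrC s) subrK => /(_ ss1 p0) H.
  have /H : forall x y, s <= x <= s1 -> 0 <= y <= pi *+ 2 -> hdiff G x y.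
    by move=> x y /andP[_ xs] _; exact: dG.
  rewrite /boundary (_ : (fun s => G s (pi *+ 2)) = fun s => G s 0); last first.
    by apply/funext => x; rewrite /G unit_circle_2pi.
  rewrite subrr add0r => /eqP; rewrite mulf_eq0 => /orP[/eqP/(congr1 (@complex.Im R))/= /eqP|].
    by rewrite oner_eq0.
  by rewrite subr_eq0 => /eqP.
apply/eqP; rewrite -subr_eq0; apply/eqP; apply: cn_eq0.
apply/ler_addgt0Pl => e e0; rewrite addr0.
have pp : 0 < pi *+ 2 :> R by rewrite mulrn_wgt0 // pi_gt0.
have e10 : 0 < e / (2%:R * (pi *+ 2)) by rewrite divr_gt0 // mulr_gt0.
have [d d0 dP] := cg _ e10.
pose s := Num.min s1 (ln (d / 4%:R)).
have d40 : 0 < d / 4%:R by rewrite divr_gt0.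
have ss : s <= s1 by rewrite ge_min lexx.
have Es : expR s <= d / 4%:R.
  by rewrite -[leRHS]lnK ?posrE // ler_expR ge_min lexx orbT.
have -> : (fun t => g (c + r%:C%C * unit_circle t)) = G s1 by rewrite -Es1.
rewrite -(flat s ss).
have := @cint_bound _ (G s) 0 (pi *+ 2) (g c) (e / (2%:R * (pi *+ 2))) p0.
have Ee (P : R) : 0 < P -> 2%:R * (e / (2%:R * P)) * P = e.
  by move=> P0; field; rewrite lt0r_neq0.
rewrite subr0 (Ee _ pp).
apply=> t _; first exact: (hdiff_cconty (dG s t ss)).
rewrite ltW // dP // cnMR ger0_norm ?expR_ge0 //.
by have := cn_unit_circle t; have := expR_gt0 s; nra.
Qed.

End Goursat.

Section ComplexDerivative.
Context {R : realType}.
Notation C := R[i].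
Implicit Types (g : C -> C) (z w l : C).

Definition cdiffl g z l := forall e : R, 0 < e -> exists2 d : R, 0 < d &
  forall w, cn w < d -> cn (g (z + w) - g z - w * l) <= e * cn w.

Lemma cdiffl_cont g z l : cdiffl g z l -> forall e : R, 0 < e -> exists2 d : R, 0 < d &
  forall w, cn w < d -> cn (g (z + w) - g z) < e.
Proof.
move=> H e e0; have [d d0 dP] := H 1 ltr01; have c0 := cn_ge0 l.
have k0 : 0 < e / (1 + cn l) by rewrite divr_gt0 //; lra.
exists (Num.min d (e / (1 + cn l))); first by rewrite lt_min d0.
move=> w; rewrite lt_min => /andP[/dP h1]; rewrite ltr_pdivlMr; last lra.
move=> h2; have := cnD (g (z + w) - g z - w * l) (w * l); rewrite subrK.
by have := cnM w l; lra.
Qed.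

Lemma cdiffl_local g1 g2 z l : (exists2 d : R, 0 < d &
    forall w, cn w < d -> g1 (z + w) = g2 (z + w)) -> cdiffl g1 z l -> cdiffl g2 z l.
Proof.
move=> [d0 d00 E] H e e0; have [d d1 dP] := H e e0.
exists (Num.min d0 d); first by rewrite lt_min d00.
move=> w; rewrite lt_min => /andP[h1 h2].
have E0 : g1 z = g2 z by have := E 0; rewrite cn0 addr0; apply.
by rewrite -E // -E0; exact: dP.
Qed.

Lemma cdifflM g1 g2 z l1 l2 : cdiffl g1 z l1 -> cdiffl g2 z l2 ->
  cdiffl (fun w => g1 w * g2 w) z (l1 * g2 z + g1 z * l2).
Proof.
move=> H1 H2 e e0; set a := g1 z; set b := g2 z.
have a0 := cn_ge0 a; have b0 := cn_ge0 b; have c0 := cn_ge0 l1; have c1 := cn_ge0 l2.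
pose K := 3%:R * (1 + cn a + cn b + cn l1); have K0 : 0 < K by rewrite mulr_gt0 //; lra.
have e10 : 0 < e / K by rewrite divr_gt0.
have [d1 d10 P1] := H1 _ e10; have [d2 d20 P2] := H2 _ e10.
have m0 : 0 < Num.min 1 (e / K) by rewrite lt_min ltr01.
have [d3 d30 P3] := cdiffl_cont H2 m0.
exists (Num.min d1 (Num.min d2 d3)); first by rewrite !lt_min d10 d20.
move=> w; rewrite !lt_min => /and3P[/P1 h1 /P2 h2 /P3]; rewrite lt_min => /andP[h3 h4].
rewrite (_ : _ - _ - _ = (g1 (z + w) - a - w * l1) * (g2 (z + w) - b) +
  (g1 (z + w) - a - w * l1) * b + a * (g2 (z + w) - b - w * l2) +
  w * l1 * (g2 (z + w) - b)); last by rewrite /a /b; ring.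
set X := g1 (z + w) - a - w * l1 in h1 *; set Y := g2 (z + w) - b in h3 h4 *.
have w0 := cn_ge0 w; have x0 := cn_ge0 X; have y0 := cn_ge0 Y.
have eK : e / K * K = e by rewrite divfK // lt0r_neq0.
set k := e / K in h1 h2 h4 eK e10 *; have kw : 0 <= k * cn w by rewrite mulr_ge0 // ltW.
apply: le_trans (_ : _ <= cn X * cn Y + cn X * cn b + cn a * cn (Y - w * l2) + cn w * cn l1 * cn Y) _.
  apply: le_trans (cnD _ _) _; apply: lerD; last first.
    by apply: le_trans (cnM _ _) _; rewrite ler_wpM2r // cnM.
  apply: le_trans (cnD _ _) _; apply: lerD; last exact: cnM.
  by apply: le_trans (cnD _ _) _; apply: lerD; exact: cnM.
have t1 : cn X * cn Y <= k * cn w by rewrite -[leRHS]mulr1; apply: ler_pM => //; exact: ltW.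
have t2 := ler_wpM2r b0 h1; have t3 := ler_wpM2l a0 h2.
have t4 := ler_wpM2l (mulr_ge0 w0 c0) (ltW h4).
rewrite -eK /K.
have := mulr_ge0 kw a0; have := mulr_ge0 kw b0; have := mulr_ge0 kw c0.
by lra.
Qed.

(** [cn] is only submultiplicative; the 2 comes from (|x| + |y|)^2 <= 2 (x^2 + y^2). *)
Lemma cn_inv z : z != 0 -> cn z^-1 * cn z <= 2%:R.
Proof.
move=> z0; pose n := Re z ^+ 2 + Im z ^+ 2.
have n0 : 0 < n.
  rewrite lt_neqAle addr_ge0 ?sqr_ge0 // andbT eq_sym; apply: contra z0.
  by rewrite paddr_eq0 ?sqr_ge0 // !sqrf_eq0 => /andP[/eqP a /eqP b]; apply/eqP/eqReIm.
have zn : z * z^*%C = n%:C%C by apply: eqReIm; rewrite !ReImE /= /n; ring.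
have -> : z^-1 = (n^-1)%:C%C * z^*%C.
  apply: (mulfI z0); rewrite mulfV // mulrCA zn -(rmorphM (real_complex R)) mulVf //.
  exact: lt0r_neq0.
rewrite cnMR cnJ gtr0_norm ?invr_gt0 // -mulrA mulrC ler_pdivrMr //.
rewrite /cn /n -(real_normK (num_real (Re z))) -(real_normK (num_real (Im z))) !expr2.
have := normr_ge0 (Re z); have := normr_ge0 (Im z).
by have := sqr_ge0 (`|Re z| - `|Im z|); rewrite expr2; lra.
Qed.

Lemma cdifflV z : z != 0 -> cdiffl (fun w => w^-1) z (- (z^-1 * z^-1)).
Proof.
move=> z0 e e0; have c0 : 0 < cn z.
  by rewrite lt_neqAle cn_ge0 andbT eq_sym; apply: contra z0 => /eqP h; apply/eqP/cn_eq0; rewrite h.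
pose b := cn (z^-1 * z^-1); have b0 : 0 <= b := cn_ge0 _.
pose K := (1 + b) * 4%:R / cn z; have K0 : 0 < K by rewrite !mulr_gt0 ?invr_gt0 //; lra.
exists (Num.min (cn z / 2%:R) (e / K)).
  by rewrite lt_min (divr_gt0 e0 K0) andbT (divr_gt0 c0).
move=> w; rewrite lt_min => /andP[h1 h2].
have zw : cn z / 2%:R < cn (z + w).
  by have := cnB (z + w) w; rewrite addrK; lra.
have zw0 : z + w != 0.
  by apply/eqP => E; move: zw; rewrite E cn0; lra.
rewrite (_ : _ - _ - _ = w * w * (z^-1 * z^-1) * (z + w)^-1); last by field; rewrite ?z0 ?zw0.
have c1 := cn_inv zw0; have i0 := cn_ge0 (z + w)^-1.
have c2 : cn (z + w)^-1 * cn z <= 4%:R.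
  by have := ler_wpM2l i0 (ltW zw); lra.
have w0 := cn_ge0 w.
apply: le_trans (cnM _ _) _.
have c3 : cn (w * w * (z^-1 * z^-1)) <= cn w * cn w * b.
  by apply: le_trans (cnM _ _) _; rewrite ler_wpM2r // cnM.
apply: le_trans (ler_wpM2r i0 c3) _.
rewrite ltr_pdivlMr // /K mulrA ltr_pdivrMr // in h2.
have c4 : cn w * cn w * b * (cn (z + w)^-1 * cn z) <= cn w * (e * cn z).
  apply: le_trans (ler_wpM2l (mulr_ge0 (mulr_ge0 w0 w0) b0) c2) _.
  rewrite -!mulrA ler_wpM2l //; lra.
rewrite -(ler_pM2r c0); lra.
Qed.

End ComplexDerivative.

Section JointContinuity.
Context {R : realType} {N : nat}.
Notation C := R[i].
Implicit Types (F G : R -> 'rV[C]_N -> C) (c : R -> C) (t : R) (Z v : 'rV[C]_N).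

Lemma jcontM F G t Z : jcont F t Z -> jcont G t Z -> jcont (fun t Z => F t Z * G t Z) t Z.
Proof.
move=> cF cG e e0; have a0 := cn_ge0 (F t Z); have b0 := cn_ge0 (G t Z).
pose K := 2%:R * (1 + cn (F t Z) + cn (G t Z)); have K0 : 0 < K by rewrite /K; lra.
have e2 : 0 < Num.min 1 (e / K) by rewrite lt_min ltr01 divr_gt0.
have [d d0 dP] := cF _ e2; have [d' d'0 d'P] := cG _ e2.
exists (Num.min d d'); first by rewrite lt_min d0.
move=> s W; rewrite !lt_min => /andP[s1 s2] /andP[W1 W2].
have := dP s W s1 W1; have := d'P s W s2 W2.
rewrite !lt_min => /andP[h1]; rewrite ltr_pdivlMr // => h2.
move=> /andP[h3]; rewrite ltr_pdivlMr // => h4.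
rewrite (_ : _ - _ = (F (t + s) W - F t Z) * (G (t + s) W - G t Z) +
  (F t Z * (G (t + s) W - G t Z) + (F (t + s) W - F t Z) * G t Z)); last by ring.
set X := F (t + s) W - F t Z in h3 h4 *; set Y := G (t + s) W - G t Z in h1 h2 *.
have H1 := cnM X Y; have H2 := cnM (F t Z) Y; have H3 := cnM X (G t Z).
apply: le_lt_trans (cnD _ _) _; have := cnD (F t Z * Y) (X * G t Z).
have x0 := cn_ge0 X; have y0 := cn_ge0 Y.
by rewrite /K in h2 h4; nra.
Qed.

Lemma jcontB F G t Z : jcont F t Z -> jcont G t Z -> jcont (fun t Z => F t Z - G t Z) t Z.
Proof.
move=> cF cG e e0; have e2 : 0 < e / 2%:R by rewrite divr_gt0.
have [d d0 dP] := cF _ e2; have [d' d'0 d'P] := cG _ e2.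
exists (Num.min d d'); first by rewrite lt_min d0.
move=> s W; rewrite !lt_min => /andP[s1 s2] /andP[W1 W2].
have := dP s W s1 W1; have := d'P s W s2 W2.
have := cnB (F (t + s) W - F t Z) (G (t + s) W - G t Z).
rewrite (_ : _ - _ - (_ - _) = F (t + s) W - G (t + s) W - (F t Z - G t Z)); last by ring.
by lra.
Qed.

Lemma jcont_time c t Z : ccont c t -> jcont (fun t _ => c t) t Z.
Proof. by move=> H e /H[d d0 dP]; exists d => // s W /dP. Qed.

Lemma jcont_shift (f : 'rV[C]_N -> C) c v t Z : {for (Z + c t *: v), continuous f} ->
  ccont c t -> jcont (fun t W => f (W + c t *: v)) t Z.
Proof.
move=> /cont_rVP cf cc e /cf[d d0 dP]; have v0 := rn_ge0 v.
have k0 : 0 < d / (2%:R * (1 + rn v)) by rewrite divr_gt0 // mulr_gt0 //; lra.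
have [d' d'0 d'P] := cc _ k0.
exists (Num.min d' (d / 2%:R)); first by rewrite lt_min d'0 divr_gt0.
move=> s W; rewrite !lt_min => /andP[/d'P s1 _] /andP[_ W2]; apply: dP.
rewrite (_ : _ - _ = (W - Z) + (c (t + s) - c t) *: v); last first.
  by rewrite scalerBl opprD addrACA.
apply: le_lt_trans (rnD _ _) _.
have := rnZ (c (t + s) - c t) v; rewrite ltr_pdivlMr in s1; last by rewrite mulr_gt0 //; lra.
by have := cn_ge0 (c (t + s) - c t); nra.
Qed.

Lemma jcont_cst (f : 'rV[C]_N -> C) t Z : {for Z, continuous f} -> jcont (fun _ W => f W) t Z.
Proof. by move=> /cont_rVP cf e /cf[d d0 dP]; exists d => // s W _ /dP. Qed.

Lemma cderiv_unit_circle t : cderiv unit_circle t ('i%C * unit_circle t).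
Proof.
apply/cderivP; rewrite !ReImE /=; split.
  by have := is_derive_cos t; congr is_derive; ring.
by have := is_derive_sin t; congr is_derive; ring.
Qed.

(** Up to the factor [r], the difference quotient of [f] along [v] at the point [r] e^(i t) of the
    circle: the conjugate of [unit_circle t] is its inverse. *)
Definition cauchy_kernel (f : 'rV[C]_N -> C) (r : R) v : R -> 'rV[C]_N -> C := fun t Z =>
  (f (Z + (r%:C%C * unit_circle t) *: v) - f Z) * (unit_circle t)^*%C.

Lemma jcont_cauchy_kernel f (r : R) v t Z : {for Z, continuous f} ->
  {for Z + (r%:C%C * unit_circle t) *: v, continuous f} -> jcont (cauchy_kernel f r v) t Z.
Proof.
move=> cZ cZt; apply: jcontM.
  apply: jcontB; last exact: jcont_cst.
  apply: (jcont_shift (c := fun t => r%:C%C * unit_circle t) cZt).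
  by apply: ccontZ; apply: cderiv_ccont; exact: cderiv_unit_circle.
apply: (@jcont_time (fun t => (unit_circle t)^*%C)).
by apply: cderiv_ccont; apply: cderivJ; exact: cderiv_unit_circle.
Qed.

End JointContinuity.

(** * Cauchy's formula and the smoothness of holomorphic functions *)

Section Holomorphic.
Context {R : realType} {N : nat}.
Notation C := R[i].
Implicit Types (f g : 'rV[C]_N -> C) (Z v w : 'rV[C]_N) (U : set 'rV[C]_N).

(** Only continuity and complex derivatives along complex lines are asked; Cauchy's formula, applied
    line by line, recovers joint differentiability. *)
Definition hol U f := forall Z, U Z -> {for Z, continuous f} /\
  forall v, exists l, cdiffl (fun z => f (Z + z *: v)) 0 l.

Lemma hol_cdiffl U f Z v : hol U f -> U Z ->
  cdiffl (fun z => f (Z + z *: v)) 0 (real_derive v f Z).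
Proof.
move=> Hf UZ; have [_ /(_ v)[l Hl]] := Hf Z UZ.
suff H : pd f Z v l by rewrite (pd_real_derive H).2.
move=> e /Hl[d d0 dP]; exists d => // h hd.
have := dP h%:C%C; rewrite cnR !add0r => /(_ hd).
by rewrite (scale0r v) (addr0 Z).
Qed.

Lemma hol_pd U f Z v : hol U f -> U Z -> pd f Z v (real_derive v f Z).
Proof.
move=> Hf UZ e /(hol_cdiffl v Hf UZ)[d d0 dP]; exists d => // h hd.
have := dP h%:C%C; rewrite cnR !add0r => /(_ hd).
by rewrite (scale0r v) (addr0 Z).
Qed.

Lemma cdiffl_unique (g : C -> C) z l l' : cdiffl g z l -> cdiffl g z l' -> l = l'.
Proof.
move=> H H'; have D m : cdiffl g z m -> cderiv (fun t : R => g (z + t%:C%C)) 0 m.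
  move=> Hm e /Hm[d d0 dP]; exists d => // h hd.
  by have := dP h%:C%C; rewrite cnR add0r (_ : (0 : R)%:C%C = 0) ?addr0 //; apply.
exact: cderiv_unique (D _ H) (D _ H').
Qed.

Lemma hol_real_deriveZ U f Z v (a : C) : hol U f -> U Z ->
  real_derive (a *: v) f Z = a * real_derive v f Z.
Proof.
move=> Hf UZ; apply: cdiffl_unique (hol_cdiffl (a *: v) Hf UZ) _.
move=> e e0; have c0 := cn_ge0 a.
have k0 : 0 < e / (1 + cn a) by rewrite divr_gt0 //; lra.
have [d d0 dP] := hol_cdiffl v Hf UZ k0.
exists (d / (1 + cn a)); first by rewrite divr_gt0 //; lra.
move=> w; rewrite ltr_pdivlMr; last lra.
have w0 := cn_ge0 w => wd; have wa := cnM w a.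
have := dP (w * a); rewrite !scalerA !add0r !mul0r mulrA => H.
apply: le_trans (H _) _; first by lra.
have : e / (1 + cn a) * (1 + cn a) = e by rewrite divfK //; lra.
move: (e / (1 + cn a)) k0 => k k0 E; rewrite -E.
by have := ler_wpM2l (ltW k0) wa; have := mulr_ge0 (ltW k0) w0; lra.
Qed.

(** The 4 allows for the gauge: Cauchy's formula uses circles of radius below [2 r], and
    [cn (unit_circle t)] can only be bounded by 2. *)
Lemma line_near U Z0 v : open U -> U Z0 -> exists2 r : R, 0 < r &
  forall Z (z : C), rn (Z - Z0) < r -> cn z < 4%:R * r -> U (Z + z *: v).
Proof.
move=> oU U0; have /nbhs_rVP[d d0 dP] := open_nbhs_nbhs (conj oU U0).
have v0 := rn_ge0 v; pose r := d / (2%:R + 4%:R * rn v).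
have r0 : 0 < r by rewrite divr_gt0 //; lra.
have Er : r * (2%:R + 4%:R * rn v) = d by rewrite /r divfK //; lra.
exists r => // Z z Zr zr; apply: dP; rewrite addrAC.
apply: le_lt_trans (rnD _ _) _; have := rnZ z v; have := cn_ge0 z; nra.
Qed.

(** This is the mean value property of the difference quotient [z |-> (f (Z + z v) - f Z) / z],
    completed at 0 by the derivative, where it is continuous. *)
Lemma cauchy_formula U f Z v (r : R) : 0 < r -> hol U f ->
  (forall z, cn z < 4%:R * r -> U (Z + z *: v)) ->
  cint (fun t => cauchy_kernel f r v t Z) 0 (pi *+ 2) =
  ((pi *+ 2) * r)%:C%C * real_derive v f Z.
Proof.
move=> r0 Hf UZ.
have Z0 : U Z by have := UZ 0; rewrite cn0 (scale0r v) (addr0 Z); apply; lra.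
pose D := real_derive v f Z.
pose g z : C := if z == 0 then D else (f (Z + z *: v) - f Z) / z.
have HD := hol_cdiffl v Hf Z0.
have two_r : 0 < r < 2%:R * r by lra.
have := @mean_value R g 0 (2%:R * r) r two_r.
have -> : g 0 = D by rewrite /g eqxx.
rewrite (_ : (fun t => g (0 + _)) = fun t => (r^-1)%:C%C * cauchy_kernel f r v t Z); last first.
  apply/funext => t; rewrite add0r /g /cauchy_kernel.
  have u0 : unit_circle t != 0 :> C.
    apply/eqP => E; have := unit_circle_norm t; rewrite E mul0r => /esym/eqP.
    by rewrite oner_eq0.
  have r0' : r%:C%C != 0 :> C by rewrite (fmorph_eq0 (real_complex R)) lt0r_neq0.
  rewrite (negPf (mulf_neq0 r0' u0)).
  have -> : (unit_circle t)^*%C = (unit_circle t)^-1 :> C.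
    by apply: (mulfI u0); rewrite unit_circle_norm mulfV.
  have -> : (r^-1)%:C%C = (r%:C%C)^-1 :> C by exact: (fmorphV (real_complex R)).
  by move: (f _) (f Z) => *; field; rewrite u0.
move=> H; have cK t : 0 <= t <= pi *+ 2 -> ccont (fun t => cauchy_kernel f r v t Z) t.
  move=> _; apply: jcont_ccont; apply: jcont_cauchy_kernel; first by have [] := Hf Z Z0.
  suff h : U (Z + (r%:C%C * unit_circle t) *: v) by have [] := Hf _ h.
  by apply: UZ; rewrite cnMR gtr0_norm //; have := cn_unit_circle t; nra.
have p0 : 0 <= pi *+ 2 :> R by rewrite mulrn_wge0 // pi_ge0.
rewrite (cintZ _ p0 cK) in H.
have r1 : (r)%:C%C * (r^-1)%:C%C = 1 :> C.
  by rewrite -(rmorphM (real_complex R)) mulfV // lt0r_neq0.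
rewrite (rmorphM (real_complex R)) (mulrC (pi *+ 2)%:C%C) -mulrA -/D -H.
  by rewrite mulrA r1 mul1r.
- move=> s t /andP[s0 s2]; rewrite add0r; set z := _ * unit_circle t.
  have z0 : z != 0.
    apply: mulf_neq0; first by rewrite (fmorph_eq0 (real_complex R)) lt0r_neq0.
    apply/eqP => E; have := unit_circle_norm t; rewrite E mul0r => /esym/eqP.
    by rewrite oner_eq0.
  have zr : cn z < 4%:R * r.
    by rewrite cnMR gtr0_norm //; have := cn_unit_circle t; nra.
  have Hz : cdiffl (fun y : C => f (Z + y *: v) + - f Z) z (real_derive v f (Z + z *: v)).
    move=> e /(hol_cdiffl v Hf (UZ z zr))[d d0 dP]; exists d => // w /dP.
    rewrite add0r (scale0r v) (addr0 (Z + _)).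
    rewrite (_ : Z + z *: v + w *: v = Z + (z + w) *: v); last by rewrite scalerDl addrA.
    by congr (cn _ <= _); ring.
  exists (real_derive v f (Z + z *: v) * z^-1 + (f (Z + z *: v) + - f Z) * - (z^-1 * z^-1)).
  apply: cdiffl_local (cdifflM Hz (cdifflV z0)).
  have zc : 0 < cn z.
    by rewrite lt_neqAle cn_ge0 andbT eq_sym; apply: contra z0 => /eqP h; apply/eqP/cn_eq0; rewrite h.
  exists (cn z) => // w wz; rewrite /g ifF //; apply/negP => /eqP E.
  by move: wz; rewrite -(cnN w) -[- w]add0r -E addrK ltxx.
move=> e e0; have [d d0 dP] := HD _ (divr_gt0 e0 (ltr0n R 4)).
exists d => // w wd; rewrite add0r /g.
have [_|w0] := eqVneq w 0; first by rewrite subrr cn0.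
have := dP w wd; rewrite !add0r (scale0r v) (addr0 Z) => Hw.
have -> : (f (Z + w *: v) - f Z) / w - D = (f (Z + w *: v) - f Z - w * D) * w^-1.
  by field.
apply: le_lt_trans (cnM _ _) _; have i0 := cn_ge0 w^-1.
by have := ler_wpM2r i0 Hw; have := cn_inv w0; nra.
Qed.

(** One radius serves all points near [Z0]. The derivative is then an integral in which [Z] enters
    only through shifts of [f], so continuity and derivatives in [Z] pass under the integral. *)
Lemma cauchy_formula_near U f Z0 v : open U -> hol U f -> U Z0 -> exists2 r : R, 0 < r &
  forall Z, rn (Z - Z0) < r -> [/\ U Z,
    forall t, U (Z + (r%:C%C * unit_circle t) *: v) &
    real_derive v f Z = (((pi *+ 2) * r)^-1)%:C%C *
      cint (fun t => cauchy_kernel f r v t Z) 0 (pi *+ 2)].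
Proof.
move=> oU Hf U0; have [r r0 rP] := line_near v oU U0; exists r => // Z Zr.
have h z : cn z < 4%:R * r -> U (Z + z *: v) by exact: rP.
split.
- by have := h 0; rewrite cn0 (scale0r v) (addr0 Z); apply; lra.
- by move=> t; apply: h; rewrite cnMR gtr0_norm //; have := cn_unit_circle t; nra.
rewrite (cauchy_formula r0 Hf h) mulrA -(rmorphM (real_complex R)) mulVf ?mul1r //.
by rewrite mulf_neq0 // lt0r_neq0 // mulrn_wgt0 // pi_gt0.
Qed.

Lemma hol_cont_real_derive U f v Z0 : open U -> hol U f -> U Z0 ->
  {for Z0, continuous (real_derive v f)}.
Proof.
move=> oU Hf U0; have [r r0 rP] := cauchy_formula_near v oU Hf U0.
have p0 : 0 <= pi *+ 2 :> R by rewrite mulrn_wge0 // pi_ge0.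
have E : \near Z0, (((pi *+ 2) * r)^-1)%:C%C *
    cint (fun t => cauchy_kernel f r v t Z0) 0 (pi *+ 2) = real_derive v f Z0.
  by apply/nbhs_rVP; exists r => // Z /rP[_ _ ->].
apply: near_eq_continuous E _.
apply: continuous_C_M; first exact: cst_continuous.
apply: continuous_cint => //; exists r => // t W _ /rP[UW UWt _].
apply: jcont_cauchy_kernel; first by have [] := Hf W UW.
by have [] := Hf _ (UWt t).
Qed.

Lemma hol_C1 U f : open U -> hol U f -> C1 U f.
Proof.
move=> oU Hf; split.
- by move=> Z UZ; have [] := Hf Z UZ.
- by move=> Z v UZ; exact: (pd_real_derive (hol_pd v Hf UZ)).1.
by move=> Z v UZ; exact: hol_cont_real_derive oU Hf UZ.
Qed.

(** The Cauchy-Riemann equations make the real differential C-linear on each complex line, and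
    [C1_estimate] then gives the complex derivative. *)
Lemma C1_hol U g : open U -> C1 U g ->
  (forall Z v, U Z -> real_derive ('i%C *: v) g Z = 'i%C * real_derive v g Z) -> hol U g.
Proof.
move=> oU Cg Ig Z UZ; have [cg _ _] := Cg; split; first exact: cg.
move=> v; exists (real_derive v g Z) => e e0; have v0 := rn_ge0 v.
have k0 : 0 < e / (1 + rn v) by rewrite divr_gt0 //; lra.
have [d d0 dP] := C1_estimate oU Cg UZ k0.
exists (d / (1 + rn v)); first by rewrite divr_gt0 //; lra.
move=> z; rewrite ltr_pdivlMr; last lra.
move=> zd; rewrite add0r (scale0r v) (addr0 Z).
have z0 := cn_ge0 z; have zv := rnZ z v.
have := dP 0 (z *: v); rewrite rn0 add0r (addr0 Z).
have -> : real_differential g Z (z *: v) = z * real_derive v g Z.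
  rewrite {1}(_ : z *: v = (Re z)%:C%C *: v + (Im z)%:C%C *: ('i%C *: v)); last first.
    rewrite scalerA -scalerDl; congr (_ *: _); apply: eqReIm; rewrite !ReImE /=; ring.
  rewrite real_differentialD !real_differentialZ -!(C1_real_derive _ oU Cg UZ) Ig //.
  rewrite mulrA -mulrDl; congr (_ * _); apply: eqReIm; rewrite !ReImE /=; ring.
move=> H; apply: le_trans (H _) _; first by lra.
have : e / (1 + rn v) * (1 + rn v) = e by rewrite divfK //; lra.
move: (e / (1 + rn v)) k0 => k k0 E; rewrite -E.
by have := ler_wpM2l (ltW k0) zv; have := mulr_ge0 (ltW k0) z0; lra.
Qed.

(** Differentiating Cauchy's integral along [w] replaces [f] in the kernel by its derivative along
    [w]. As that derivative commutes with multiplication of [w] by i, the result satisfies the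
    Cauchy-Riemann equations and [C1_hol] applies. *)
Lemma hol_real_derive U f v : open U -> hol U f -> hol U (real_derive v f).
Proof.
move=> oU Hf; have p0 : 0 <= pi *+ 2 :> R by rewrite mulrn_wge0 // pi_ge0.
have key Z0 : U Z0 -> exists2 r : R, 0 < r & forall Z, rn (Z - Z0) < r ->
    [/\ U Z, forall t, U (Z + (r%:C%C * unit_circle t) *: v) &
    forall w, pd (real_derive v f) Z w ((((pi *+ 2) * r)^-1)%:C%C *
      cint (fun t => cauchy_kernel (real_derive w f) r v t Z) 0 (pi *+ 2))].
  move=> U0; have [r r0 rP] := cauchy_formula_near v oU Hf U0; exists r => // Z Zr.
  have [UZ UZt _] := rP Z Zr; split=> // w.
  pose a : C := (((pi *+ 2) * r)^-1)%:C%C.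
  have inr W : rn (W - Z) < r - rn (Z - Z0) -> rn (W - Z0) < r.
    by move=> WZ; have := rnD (W - Z) (Z - Z0); rewrite addrA subrK; lra.
  apply: (@pd_local _ _ (fun Z => a * cint (fun t => cauchy_kernel f r v t Z) 0 (pi *+ 2))).
    apply/nbhs_rVP; exists (r - rn (Z - Z0)); first by lra.
    by move=> W /inr /rP[_ _ ->].
  apply: cderivZ; apply: pd_cint p0 _; exists (r - rn (Z - Z0)); first by lra.
  move=> t W _ /inr /rP[UW UWt _].
  have [cW _] := Hf W UW; have [cWt _] := Hf _ (UWt t); split.
  - exact: jcont_cauchy_kernel.
  - apply: jcont_cauchy_kernel; first exact: hol_cont_real_derive oU Hf UW.
    exact: hol_cont_real_derive oU Hf (UWt t).
  have P1 := hol_pd w Hf (UWt t); have P2 := hol_pd w Hf UW.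
  have P3 : pd (fun W => f (W + (r%:C%C * unit_circle t) *: v)) W w
      (real_derive w f (W + (r%:C%C * unit_circle t) *: v)).
    rewrite /pd; have -> : (fun s : R => f (W + s%:C%C *: w + (r%:C%C * unit_circle t) *: v)) =
        fun s => f (W + (r%:C%C * unit_circle t) *: v + s%:C%C *: w).
      by apply/funext => s; rewrite addrAC.
    exact: P1.
  have := cderivM (cderivB P3 P2) (cderiv_cst (unit_circle t)^*%C 0).
  by rewrite mulr0 addr0.
apply: (C1_hol oU).
  split.
  - by move=> Z UZ; exact: hol_cont_real_derive oU Hf UZ.
  - move=> Z w /key[r r0 rP].
    have Zr : rn (Z - Z) < r by rewrite subrr rn0.
    by have [_ _ H] := rP Z Zr; exact: (pd_real_derive (H w)).1.
  move=> Z w /key[r r0 rP].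
  have E : \near Z, (((pi *+ 2) * r)^-1)%:C%C *
      cint (fun t => cauchy_kernel (real_derive w f) r v t Z) 0 (pi *+ 2) =
      real_derive w (real_derive v f) Z.
    by apply/nbhs_rVP; exists r => // W /rP[_ _ /(_ w) H]; rewrite (pd_real_derive H).2.
  apply: near_eq_continuous E _.
  apply: continuous_C_M; first exact: cst_continuous.
  apply: continuous_cint p0 _; exists r => // t W _ /rP[UW UWt _].
  apply: jcont_cauchy_kernel; first exact: hol_cont_real_derive oU Hf UW.
  exact: hol_cont_real_derive oU Hf (UWt t).
move=> Z w /key[r r0 rP].
have Zr : rn (Z - Z) < r by rewrite subrr rn0.
have [UZ UZt H] := rP Z Zr.
rewrite (pd_real_derive (H ('i%C *: w))).2 (pd_real_derive (H w)).2 mulrCA; congr (_ * _).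
have E : cauchy_kernel (real_derive ('i%C *: w) f) r v ^~ Z =
    (fun t => 'i%C * cauchy_kernel (real_derive w f) r v t Z).
  apply/funext => t; rewrite /cauchy_kernel (hol_real_deriveZ _ _ Hf UZ).
  by rewrite (hol_real_deriveZ _ _ Hf (UZt t)) mulrA mulrBr.
rewrite E; apply: cintZ p0 _ => t _; apply: jcont_ccont.
apply: jcont_cauchy_kernel; first exact: hol_cont_real_derive oU Hf UZ.
exact: hol_cont_real_derive oU Hf (UZt t).
Qed.

Lemma hol_smooth U f : open U -> hol U f -> smooth_on U f.
Proof.
move=> oU Hf vs; suff H : hol U (foldr real_derive f vs).
  move=> Z UZ; have [cg _] := H Z UZ; split; first exact: cg.
  by move=> v; exact: (pd_real_derive (hol_pd v H UZ)).1.
by elim: vs => [|v vs IH]; [exact: Hf | exact: hol_real_derive oU IH].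
Qed.

Lemma hol_dZbar U f k Z : hol U f -> U Z -> dZbar k f Z = 0.
Proof.
move=> Hf UZ; rewrite /dZbar (hol_real_deriveZ _ _ Hf UZ) mulrA -expr2 sqr_i mulN1r subrr.
by rewrite mul0r.
Qed.

Lemma hol_dZ U f k Z : hol U f -> U Z -> dZ k f Z = real_derive (delta_mx 0 k) f Z.
Proof.
move=> Hf UZ; rewrite /dZ (hol_real_deriveZ _ _ Hf UZ) mulrA -expr2 sqr_i mulN1r opprK.
by field.
Qed.

Lemma hol_ext U f g : open U -> (forall Z, U Z -> f Z = g Z) -> hol U f -> hol U g.
Proof.
move=> oU E Hf; apply: (C1_hol oU).
  have := smooth_C1 (smooth_ext oU E (hol_smooth oU Hf)); exact.
move=> Z v UZ; have H w := real_derive_ext oU w E (hol_smooth oU Hf) UZ.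
by rewrite (H v) (H ('i%C *: v)); exact: hol_real_deriveZ Hf UZ.
Qed.

Lemma hol_of_dZ U f k : open U -> hol U f -> hol U (dZ k f).
Proof.
move=> oU Hf; apply: hol_ext oU _ (hol_real_derive (delta_mx 0 k) oU Hf) => Z UZ.
exact/esym/(hol_dZ k Hf UZ).
Qed.

Lemma holB U f g : open U -> hol U f -> hol U g -> hol U (fun Z => f Z - g Z).
Proof.
move=> oU Hf Hg; have sf := hol_smooth oU Hf; have sg := hol_smooth oU Hg.
apply: (C1_hol oU); first exact: (smooth_C1 (smoothB oU sf sg)).
move=> Z v UZ.
have E w : real_derive w (fun Z => f Z - g Z) Z = real_derive w f Z - real_derive w g Z.
  have H : pd (fun Z => f Z - g Z) Z w (real_derive w f Z - real_derive w g Z) :=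
    cderivB (hol_pd w Hf UZ) (hol_pd w Hg UZ).
  exact: (pd_real_derive H).2.
rewrite (E v) (E ('i%C *: v)) (hol_real_deriveZ _ _ Hf UZ) (hol_real_deriveZ _ _ Hg UZ).
by rewrite mulrBr.
Qed.

End Holomorphic.

(** * Flat holomorphic functions *)

Section FlatFunctions.
Context {R : realType} {N : nat}.
Notation C := R[i].
Implicit Types (f g : 'rV[C]_N -> C) (Z p v w : 'rV[C]_N) (U : set 'rV[C]_N) (s : seq 'I_N).

Definition dZs s f : 'rV[C]_N -> C := foldr (fun k g => dZ k g) f s.

Lemma hol_dZs U f s : open U -> hol U f -> hol U (dZs s f).
Proof. by move=> oU Hf; elim: s => [|k s IH]; [exact: Hf|exact: hol_of_dZ]. Qed.

Lemma hol_differential U f Z w : open U -> hol U f -> U Z ->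
  real_derive w f Z = \sum_k w 0 k * dZ k f Z.
Proof.
move=> oU Hf UZ; rewrite (C1_real_derive w oU (hol_C1 oU Hf) UZ).
by apply: eq_bigr => k _; rewrite (hol_dZbar k Hf UZ) mulr0 addr0.
Qed.

(** All first derivatives are flat too; the mean value estimate on the segment from [p] turns their
    bound of order [n] into one of order [n + 1] for [f]. *)
Lemma flat_bound U f p n : open U -> U p -> hol U f -> (forall s, dZs s f p = 0) ->
  exists K d : R, [/\ 0 <= K, 0 < d &
    forall w, rn w < d -> cn (f (p + w)) <= K * rn w ^+ n].
Proof.
move=> oU Up; elim: n f => [|n IH] f Hf flat.
  have [cf _] := Hf p Up; have /cont_rVP/(_ _ ltr01)[d d0 dP] := cf.
  have f0 : f p = 0 by exact: (flat [::]).
  exists 1, d; split=> // w wd; rewrite expr0 mulr1.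
  by have := dP (p + w); rewrite (addrC p) addrK f0 subr0 => /(_ wd) /ltW.
have : forall k, exists Kd : R * R, [/\ 0 <= Kd.1, 0 < Kd.2 &
    forall w, rn w < Kd.2 -> cn (dZ k f (p + w)) <= Kd.1 * rn w ^+ n].
  move=> k; have flat' s : dZs s (dZ k f) p = 0.
    by have := flat (rcons s k); rewrite /dZs foldr_rcons.
  by have [K [d Kd]] := IH _ (hol_of_dZ k oU Hf) flat'; exists (K, d).
move=> /choice[Kd KdP].
have /nbhs_rVP[d1 d10 d1P] := open_nbhs_nbhs (conj oU Up).
pose K := 2%:R * \sum_k (Kd k).1; have K0 : 0 <= K.
  by rewrite mulr_ge0 // sumr_ge0 // => k _; case: (KdP k).
pose d := \big[Num.min/d1]_k (Kd k).2.
have d0 : 0 < d.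
  by rewrite /d; elim/big_ind: _ => // [x y x0 y0|k _]; [rewrite lt_min x0|case: (KdP k)].
have dd1 : d <= d1 by exact: bigmin_le_id.
exists K, d; split=> // w wd; have w0 := rn_ge0 w.
have f0 : f p = 0 by exact: (flat [::]).
have := @cderiv_mvt R (fun t => f (p + t%:C%C *: w)) (fun t => real_derive w f (p + t%:C%C *: w))
  0 1 0 ((\sum_k (Kd k).1) * rn w ^+ n.+1) ler01.
rewrite subr0 mulr1 mulr0 subr0 (scale0r w) (addr0 p) f0 subr0 scale1r.
have tw t : 0 <= t <= 1 -> rn (t%:C%C *: w) <= rn w.
  by move=> /andP[t0 t1]; rewrite rnZR ger0_norm //; nra.
have inU t : 0 <= t <= 1 -> U (p + t%:C%C *: w).
  move=> /tw h; apply: d1P; rewrite (addrC p) addrK; apply: le_lt_trans h _.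
  exact: lt_le_trans wd dd1.
move=> H; apply: le_trans (H _ _) _.
- by move=> t /inU Ut; apply: pd_line; exact: hol_pd Hf Ut.
- move=> t t01; rewrite subr0 (hol_differential _ oU Hf (inU t t01)).
  apply: le_trans (cn_sum _ _ _) _; rewrite mulr_suml; apply: ler_sum => k _.
  apply: le_trans (cnM _ _) _; have [k0 _ /(_ (t%:C%C *: w)) hk] := KdP k.
  have {}hk : cn (dZ k f (p + t%:C%C *: w)) <= (Kd k).1 * rn w ^+ n.
    apply: le_trans (hk _) _.
      apply: le_lt_trans (tw t t01) _; apply: lt_le_trans wd _; exact: bigmin_le_cond.
    by rewrite ler_wpM2l // lerXn2r ?nnegrE ?rn_ge0 // tw.
  rewrite exprS mulrCA; apply: ler_pM; rewrite ?cn_ge0 //; exact: cn_le_rn.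
by rewrite /K mulrA.
Qed.

Lemma cdiffl_expV (z : C) n : z != 0 -> exists l, cdiffl (fun w : C => w^-1 ^+ n) z l.
Proof.
move=> z0; elim: n => [|n [l IH]].
  by exists 0 => e e0; exists 1 => // w _; rewrite subrr mulr0 subr0 cn0 mulr_ge0 ?cn_ge0 // ltW.
exists (- (z^-1 * z^-1) * z^-1 ^+ n + z^-1 * l).
have := cdifflM (cdifflV z0) IH; congr (cdiffl _ _ _).
by apply/funext => w; rewrite exprS.
Qed.

Lemma cnX (z : C) n : cn (z ^+ n) <= cn z ^+ n.
Proof.
elim: n => [|n IH]; first by rewrite !expr0 /cn /= normr1 normr0 addr0.
by rewrite !exprS; apply: le_trans (cnM _ _) _; rewrite ler_wpM2l ?cn_ge0.
Qed.

Lemma cn_gt0 (z : C) : z != 0 -> 0 < cn z.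
Proof.
move=> z0; rewrite lt_neqAle cn_ge0 andbT eq_sym; apply: contra z0 => /eqP h.
by apply/eqP/cn_eq0; rewrite h.
Qed.

(* Apply the mean value property of g(z) / z^n, which extends holomorphically
   by 0 at 0, to the circle |z - 1| = 9: there |z| >= 8, so that g(1) is
   O(4^-n). *)
Lemma flat_line (g : C -> C) : (forall z, cn z < 32%:R -> exists l, cdiffl g z l) ->
  (forall z, cn z < 32%:R -> cn (g z) <= 1) ->
  (forall n, exists K d : R, [/\ 0 <= K, 0 < d & forall z, cn z < d -> cn (g z) <= K * cn z ^+ n]) ->
  g 1 = 0.
Proof.
move=> dg bg fg; apply: cn_eq0; apply/ler_addgt0Pl => e e0; rewrite addr0.
have [n Hn] := q_small (ltr0n R 2) e0.
pose Q z : C := g z * z^-1 ^+ n.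
have dQ z : cn z < 32%:R -> cdiff Q z.
  move=> z32; have [->|z0] := eqVneq z 0; last first.
    have [l Hl] := dg z z32; have [l' Hl'] := cdiffl_expV n z0.
    by eexists; exact: cdifflM Hl Hl'.
  (* Order [n + 2] leaves |z|^2 after division by z^n, so that [Q] has derivative 0 at 0, where its
     value is 0. *)
  have [K [d [K0 d0 dP]]] := fg n.+2.
  pose K' := K * 2%:R ^+ n; have K'0 : 0 <= K' by rewrite mulr_ge0 // exprn_ge0.
  have g0 : g 0 = 0.
    apply: cn_eq0; have := dP 0; rewrite cn0 => /(_ d0).
    by rewrite expr0n mulr0.
  exists 0 => e' e'0; exists (Num.min d (e' / (1 + K'))).
    by rewrite lt_min d0 divr_gt0 //; lra.
  move=> w; rewrite lt_min => /andP[wd]; rewrite ltr_pdivlMr; last lra.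
  move=> we; rewrite add0r mulr0 subr0 /Q g0 mul0r subr0.
  have [->|w0] := eqVneq w 0; first by rewrite g0 mul0r cn0 mulr0.
  have c0 := cn_gt0 w0; have i0 := cn_ge0 w^-1.
  apply: le_trans (cnM _ _) _.
  apply: le_trans (ler_pM (cn_ge0 _) (cn_ge0 _) (dP w wd) (cnX _ _)) _.
  have h : (cn w^-1 * cn w) ^+ n <= 2%:R ^+ n.
    by rewrite lerXn2r ?nnegrE ?mulr_ge0 // ?(ltW c0) // cn_inv.
  have -> : K * cn w ^+ n.+2 * cn w^-1 ^+ n = K * (cn w^-1 * cn w) ^+ n * cn w * cn w.
    by rewrite !exprS exprMn; ring.
  rewrite ler_wpM2r ?(ltW c0) //.
  have : K * (cn w^-1 * cn w) ^+ n * cn w <= K' * cn w.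
    by rewrite ler_wpM2r ?(ltW c0) // ler_wpM2l.
  by nra.
have u1 t : 1 <= cn (unit_circle t : C).
  rewrite /cn /= ; have := cos2Dsin2 t.
  rewrite -(real_normK (num_real (cos t))) -(real_normK (num_real (sin t))) !expr2.
  have := cos_max t; have := sin_max t; have := normr_ge0 (cos t); have := normr_ge0 (sin t).
  by nra.
have c1 : cn (1 : C) = 1 by rewrite /cn /= normr1 normr0 addr0.
have inD (s t : R) : 0 < s < 10%:R -> cn (1 + s%:C%C * unit_circle t : C) < 32%:R.
  move=> /andP[s0 s10]; apply: le_lt_trans (cnD _ _) _; rewrite cnMR gtr0_norm // c1.
  by have := cn_unit_circle t; nra.
have r9 : 0 < 9%:R :> R by rewrite ltr0n.
have r10 : 9%:R < 10%:R :> R by lra.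
have r910 := introT andP (conj r9 r10).
have one32 : cn (1 : C) < 32%:R by rewrite c1; lra.
have [l Hl] := dQ 1 one32.
have MV := @mean_value R Q 1 10%:R 9%:R r910 (fun a t st => dQ _ (inD a t st)) (cdiffl_cont Hl).
have Q1 : Q 1 = g 1 by rewrite /Q invr1 expr1n mulr1.
rewrite Q1 in MV.
have p0 : 0 < pi *+ 2 :> R by rewrite mulrn_wgt0 // pi_gt0.
have := @cint_bound R (fun t => Q (1 + 9%:R%:C%C * unit_circle t)) 0 (pi *+ 2) 0 (q n) (ltW p0).
rewrite MV mulr0 subr0 cnMR (gtr0_norm p0) subr0 => H.
have {}H : pi *+ 2 * cn (g 1) <= 2%:R * q n * (pi *+ 2).
  apply: H => t _.
    have [l' Hl'] := dQ _ (inD 9%:R t r910).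
    move=> e' /(cdiffl_cont Hl')[d d0 dP].
    have cu := ccontZ (9%:R%:C%C : C) (cderiv_ccont (cderiv_unit_circle t)).
    have [d' d'0 d'P] := cu _ d0; exists d' => // h /d'P /dP.
    have E (x y : C) : 1 + x + (y - x) = 1 + y by ring.
    by rewrite E.
  rewrite subr0 /Q; set z := 1 + _.
  have z32 : cn z < 32%:R by exact: inD.
  have z8 : 8%:R <= cn z.
    have := cnB z 1; rewrite {1}/z (addrC 1) addrK cnMR c1 ger0_norm //.
    by have := u1 t; lra.
  have z0 : z != 0 by apply/eqP => E; move: z8; rewrite E cn0; lra.
  (* The bound 2/8 given by [cn_inv] is weakened to 1/2, to compare with [q n]. *)
  have iz : cn z^-1 <= 2%:R^-1.
    by have := cn_inv z0; have := cn_ge0 z^-1; nra.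
  apply: le_trans (cnM _ _) _; rewrite -[leRHS]mul1r; apply: ler_pM; rewrite ?cn_ge0 ?bg //.
  by apply: le_trans (cnX _ _) _; rewrite lerXn2r ?nnegrE ?cn_ge0.
rewrite mulrC ler_pM2r // in H; exact: le_trans H (ltW Hn).
Qed.

Theorem hol_flat_eq0 U f p : open U -> U p -> hol U f -> (forall s, dZs s f p = 0) ->
  \forall Z \near p, f Z = 0.
Proof.
move=> oU Up Hf flat; have f0 : f p = 0 by exact: (flat [::]).
have /nbhs_rVP[d1 d10 d1P] := open_nbhs_nbhs (conj oU Up).
have [cf _] := Hf p Up; have /cont_rVP/(_ _ ltr01)[d2 d20 d2P] := cf.
have m0 : 0 < Num.min d1 d2 by rewrite lt_min d10.
(* For [Z] this close to [p], the disc of radius 32 on the complex line through [p] and [Z] stays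
   where [f] is holomorphic and bounded by 1, and [Z] is its point 1. *)
apply/nbhs_rVP; exists (Num.min d1 d2 / 32%:R); first by rewrite divr_gt0.
move=> Z; rewrite ltr_pdivlMr // => Zd; set w := Z - p in Zd.
have inm (z : C) : cn z < 32%:R -> rn (z *: w) < Num.min d1 d2.
  move=> z32; apply: le_lt_trans (rnZ _ _) _; apply: le_lt_trans Zd.
  by have := rn_ge0 w; have := cn_ge0 z; nra.
have inU (z : C) : cn z < 32%:R -> U (p + z *: w).
  by move=> /inm; rewrite lt_min => /andP[h _]; apply: d1P; rewrite (addrC p) addrK.
have := @flat_line (fun z => f (p + z *: w)).
rewrite (scale1r w) /w (addrC p) subrK -/w; apply.
- move=> z /inU Uz; exists (real_derive w f (p + z *: w)).
  move=> e /(hol_cdiffl w Hf Uz)[d d0 dP]; exists d => // y /dP.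
  rewrite add0r (scale0r w) (addr0 (p + _)).
  by rewrite (_ : p + z *: w + y *: w = p + (z + y) *: w) // scalerDl addrA.
- move=> z /inm; rewrite lt_min => /andP[_ h]; have := d2P (p + z *: w).
  by rewrite (addrC p) addrK f0 subr0 => /(_ h) /ltW.
move=> n; have [K [d [K0 d0 dP]]] := flat_bound n oU Up Hf flat.
have w0 := rn_ge0 w.
exists (K * rn w ^+ n), (d / (1 + rn w)); split.
- by rewrite mulr_ge0 // exprn_ge0.
- by rewrite divr_gt0 //; lra.
move=> z; rewrite ltr_pdivlMr; last lra.
move=> zd; have zw := rnZ z w; have z0 := cn_ge0 z.
apply: le_trans (dP _ _) _; first by apply: le_lt_trans zw _; lra.
rewrite -mulrA ler_wpM2l // mulrC -exprMn lerXn2r ?nnegrE ?rn_ge0 //.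
by rewrite mulr_ge0.
Qed.

End FlatFunctions.

(** * Complex partial derivatives of holomorphic maps *)

Section HolomorphicMaps.
Context {R : realType} {N m : nat}.
Notation C := R[i].
Implicit Types (H G : 'rV[C]_N -> 'rV[C]_m) (Z p v w : 'rV[C]_N) (U : set 'rV[C]_N).

Lemma derivable_cdiffl H Z v l : derivable H Z v ->
  cdiffl (fun z => H (Z + z *: v) 0 l) 0 (('D_v H Z) 0 l).
Proof.
move=> dH e e0.
have cv : h^-1 *: ((H \o shift Z) (h *: v) - H Z) @[h --> (0 : C)^'] --> 'D_v H Z by [].
have N1 : nbhs ('D_v H Z) [set W | rn (W - 'D_v H Z) < e] by apply/nbhs_rVP; exists e.
have : \forall h \near (0 : C)^', rn (h^-1 *: ((H \o shift Z) (h *: v) - H Z) - 'D_v H Z) < e.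
  exact: cv N1.
rewrite near_withinE near_nbhs => /nbhs_CP[d d0 dP]; exists d => // w wd.
rewrite add0r (scale0r v) (addr0 Z).
have [->|w0] := eqVneq w 0.
  by rewrite (scale0r v) (addr0 Z) subrr mul0r subr0 cn0 mulr0.
have := dP w; rewrite subr0 => /(_ wd w0) /= h.
have := le_lt_trans (cn_le_rn _ l) h; rewrite !mxE /shift /= (addrC (w *: v)) => {}h.
have -> : H (Z + w *: v) 0 l - H Z 0 l - w * ('D_v H Z) 0 l =
    w * (w^-1 * (H (Z + w *: v) 0 l - H Z 0 l) - ('D_v H Z) 0 l).
  by rewrite mulrBr mulrA mulfV // mul1r.
apply: le_trans (cnM _ _) _; rewrite mulrC ler_wpM2r ?cn_ge0 //; exact: ltW.
Qed.

Lemma cdiffl_derive H Z v (D : 'rV[C]_m) :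
  (forall l, cdiffl (fun z => H (Z + z *: v) 0 l) 0 (D 0 l)) -> 'D_v H Z = D.
Proof.
move=> dH; apply: cvg_lim => //; move=> P /nbhs_rVP[e e0 eP].
change (\forall h \near (0 : C)^', P (h^-1 *: ((H \o shift Z) (h *: v) - H Z))).
rewrite near_withinE.
have e1 : 0 < e / (2%:R * m.+1%:R) / 2%:R by rewrite !divr_gt0.
have : \forall y \near (0 : C), forall l, cn (H (Z + y *: v) 0 l - H Z 0 l - y * D 0 l) <=
    e / (2%:R * m.+1%:R) / 2%:R * cn y.
  apply: (@filter_forall _ _ (fun l (y : C) => cn (H (Z + y *: v) 0 l - H Z 0 l - y * D 0 l) <=
    e / (2%:R * m.+1%:R) / 2%:R * cn y) (nbhs (0 : C))) => l; apply/nbhs_CP; have [d d0 dP] := dH l _ e1; exists d => // w.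
  by rewrite subr0 => /dP; rewrite add0r (scale0r v) (addr0 Z).
apply: filterS => w Hw w0; apply: eP.
apply: (@le_lt_trans _ _ (\sum_(k < m) e / (2%:R * m.+1%:R))).
  apply: ler_sum => l _; rewrite !mxE /shift /= (addrC (w *: v)).
  have -> : w^-1 * (H (Z + w *: v) 0 l - H Z 0 l) - D 0 l =
      w^-1 * (H (Z + w *: v) 0 l - H Z 0 l - w * D 0 l).
    by move: (H (Z + w *: v) 0 l) (H Z 0 l) (D 0 l) => *; field.
  apply: le_trans (cnM _ _) _; apply: le_trans (ler_wpM2l (cn_ge0 _) (Hw l)) _.
  rewrite mulrCA; apply: le_trans (ler_wpM2l (ltW e1) (cn_inv w0)) _.
  by rewrite divfK // pnatr_eq0.
rewrite sumr_const card_ord -[_ *+ m]mulr_natr mulrAC ltr_pdivrMr ?mulr_gt0 // ltr_pM2l //.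
by rewrite -natrM ltr_nat mul2n -addnn ltn_addr.
Qed.

Lemma holomorphic_on_hol U H l : holomorphic_on U H -> hol U (fun Z => H Z 0 l).
Proof.
move=> HH Z UZ; have dH := HH Z UZ; split.
  have cH := differentiable_continuous dH.
  by apply: (@continuous_comp _ _ _ H (fun W : 'rV[C]_m => W 0 l)) => //; exact: coord_continuous.
by move=> v; exists (('D_v H Z) 0 l); apply: derivable_cdiffl; exact: diff_derivable.
Qed.

Lemma partial_derivative_dZ U H a Z l : open U -> holomorphic_on U H -> U Z ->
  partial_derivative a H Z 0 l = multi_iter (fun k => dZ k) a (fun Z => H Z 0 l) Z.
Proof.
move=> oU HH; rewrite /partial_derivative /multi_iter.
suff main s : forall l, hol U (foldr (fun i g => iter (a i) (dZ i) g) (fun Z => H Z 0 l) s) /\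
    forall Z, U Z -> (foldr (fun i g => iter (a i) (fun G => 'D_(delta_mx 0 i) G) g) H s) Z 0 l =
      foldr (fun i g => iter (a i) (dZ i) g) (fun Z => H Z 0 l) s Z.
  by move=> UZ; have [_ ->] := main (enum 'I_N) l.
elim: s {l Z} => [|i s IH] l /=; first by split=> //; exact: holomorphic_on_hol.
elim: (a i) l => [|n IHn] l /=; first exact: IH.
have [Hn En] := IHn l; split; first exact: hol_of_dZ.
move=> Z UZ; set G := iter n _ _ in IHn En *; set g := iter n _ _ in Hn En *.
pose gl l := iter n (dZ i) (foldr (fun i g => iter (a i) (dZ i) g) (fun Z => H Z 0 l) s).
rewrite (@cdiffl_derive G Z (delta_mx 0 i) (\row_l dZ i (gl l) Z)) ?mxE // => l'.
have [Hl' El'] := IHn l'; rewrite mxE (hol_dZ i Hl' UZ).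
apply: cdiffl_local (hol_cdiffl (delta_mx 0 i) Hl' UZ).
have [r r0 rP] := line_near (delta_mx 0 i) oU UZ; exists (4%:R * r); first by rewrite mulr_gt0.
move=> z zr; rewrite El' // add0r; apply: rP zr; by rewrite subrr rn0.
Qed.

End HolomorphicMaps.

(** * Multi-indices and lists of derivations *)

Section MultiIndices.
Context {R : realType} {N : nat}.
Notation C := R[i].
Implicit Types (f g : 'rV[C]_N -> C) (Z p : 'rV[C]_N) (U : set 'rV[C]_N) (s : seq 'I_N).

Lemma dZ_ext U k f g Z : open U -> (forall W, U W -> f W = g W) -> smooth_on U f -> U Z ->
  dZ k g Z = dZ k f Z.
Proof. by move=> oU E sf UZ; exact: (wirtinger_ext oU (true, k) E sf UZ). Qed.

Lemma dZ_comm U k j f Z : open U -> smooth_on U f -> U Z -> dZ k (dZ j f) Z = dZ j (dZ k f) Z.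
Proof. by move=> oU sf UZ; exact: (wirtinger_comm oU (true, k) (true, j) sf UZ). Qed.

Lemma hol_iter_dZ U i n f : open U -> hol U f -> hol U (iter n (dZ i) f).
Proof. by move=> oU Hf; elim: n => [|n IH]; [exact: Hf|exact: hol_of_dZ]. Qed.

Lemma hol_foldr_dZ U a s f : open U -> hol U f ->
  hol U (foldr (fun i g => iter (a i) (dZ i) g) f s).
Proof. by move=> oU Hf; elim: s => [|k s IH] //=; exact: hol_iter_dZ. Qed.

Lemma dZ_iter_comm U k i n f Z : open U -> hol U f -> U Z ->
  dZ k (iter n (dZ i) f) Z = iter n (dZ i) (dZ k f) Z.
Proof.
move=> oU Hf; elim: n Z => [|n IH] Z UZ; first by [].
rewrite !iterS; have Hn := hol_iter_dZ i n oU Hf.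
rewrite (dZ_comm k i oU (hol_smooth oU Hn) UZ).
apply/esym; apply: (dZ_ext i oU _ (hol_smooth oU (hol_of_dZ k oU Hn)) UZ) => W UW.
exact: IH.
Qed.

Lemma iter_dZ_ext U i n f g Z : open U -> hol U f -> (forall W, U W -> f W = g W) -> U Z ->
  iter n (dZ i) g Z = iter n (dZ i) f Z.
Proof.
move=> oU Hf E; elim: n Z => [|n IH] Z UZ /=; first by rewrite E.
apply: (dZ_ext i oU _ (hol_smooth oU (hol_iter_dZ i n oU Hf)) UZ) => W UW.
exact/esym/IH.
Qed.

Lemma dZ_foldr U k a e f Z : open U -> hol U f -> uniq e -> k \in e -> U Z ->
  dZ k (foldr (fun i g => iter (a i) (dZ i) g) f e) Z =
  foldr (fun i g => iter (a i + (i == k)) (dZ i) g) f e Z.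
Proof.
move=> oU Hf; have notin e' : k \notin e' ->
    foldr (fun i g => iter (a i + (i == k)) (dZ i) g) f e' = foldr (fun i g => iter (a i) (dZ i) g) f e'.
  elim: e' => [|i e' IH] //=; rewrite in_cons negb_or => /andP[ki ke].
  by rewrite (IH ke) eq_sym (negPf ki) addn0.
elim: e Z => [|i e IH] Z //= /andP[ie ue]; rewrite in_cons => /orP[/eqP ki|ke] UZ.
  by rewrite -ki eqxx addn1 iterS notin // ki.
have ik : (i == k) = false by apply/negP => /eqP E; move: ie; rewrite E ke.
rewrite ik addn0 (dZ_iter_comm k i (a i) oU (hol_foldr_dZ a e oU Hf) UZ).
have Hd := hol_foldr_dZ (fun i => (a i + (i == k))%N) e oU Hf.
apply: (iter_dZ_ext i (a i) oU Hd _ UZ) => W UW.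
exact/esym/IH.
Qed.

(** Derivations commute, so a list of them depends only on its multiplicities. Lists allow induction
    one derivative at a time; multi-indices are the form of the hypothesis on the jets. *)
Lemma dZs_multi_iter U s f Z : open U -> hol U f -> U Z ->
  dZs s f Z = multi_iter (fun k => dZ k) (fun i => count_mem i s) f Z.
Proof.
move=> oU Hf; elim: s Z => [|k s IH] Z UZ /=.
  by rewrite /multi_iter; elim: (enum 'I_N) => [|i e IH] //=.
have H := hol_foldr_dZ (fun i => count_mem i s) (enum 'I_N) oU Hf.
rewrite (dZ_ext k oU _ (hol_smooth oU H) UZ); last by move=> W UW; exact/esym/IH.
have kin : k \in enum 'I_N by rewrite mem_enum.
rewrite (dZ_foldr (fun i => count_mem i s) oU Hf (enum_uniq _) kin UZ) /multi_iter.
have -> : forall e, foldr (fun i g => iter (count_mem i s + (i == k)) (dZ i) g) f e =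
    foldr (fun i g => iter (count_mem i (k :: s)) (dZ i) g) f e.
  by elim=> [|i e IHe] //=; rewrite IHe addnC (eq_sym k).
by [].
Qed.

Lemma sum_count_mem s : (\sum_(i < N) count_mem i s)%N = size s.
Proof.
elim: s => [|k s IH] /=; first by rewrite big1.
by rewrite big_split /= IH (bigD1 k) //= eqxx big1 ?addn0 // => i ik; rewrite eq_sym (negPf ik).
Qed.

Lemma jets_agree m (U : set 'rV[C]_N) (H H' : 'rV[C]_N -> 'rV[C]_m) p K s l : open U -> U p ->
  holomorphic_on U H -> holomorphic_on U H' ->
  (forall a : 'I_N -> nat, (\sum_i a i <= K)%N ->
     partial_derivative a H p = partial_derivative a H' p) ->
  (size s <= K)%N -> dZs s (fun Z => H Z 0 l) p = dZs s (fun Z => H' Z 0 l) p.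
Proof.
move=> oU Up HH HH' E sK.
rewrite (dZs_multi_iter s oU (holomorphic_on_hol l HH) Up).
rewrite (dZs_multi_iter s oU (holomorphic_on_hol l HH') Up).
by rewrite -!(partial_derivative_dZ _ _ oU) // E // sum_count_mem.
Qed.

Lemma dZB U k f g Z : smooth_on U f -> smooth_on U g -> open U -> U Z ->
  dZ k (fun W => f W - g W) Z = dZ k f Z - dZ k g Z.
Proof.
move=> sf sg oU UZ; have sN : smooth_on U (fun W => -1 * g W).
  exact: (smoothM oU (smooth_cst oU (-1)) sg).
have -> : (fun W => f W - g W) = fun W => f W + -1 * g W.
  by apply/funext => W; rewrite mulN1r.
apply: etrans (wirtingerD (true, k) sf sN UZ) _.
rewrite (wirtingerM (true, k) (smooth_cst oU (-1)) sg UZ) wirtinger_cst mul0r add0r.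
by rewrite mulN1r.
Qed.

Lemma dZsB U s f g Z : open U -> hol U f -> hol U g -> U Z ->
  dZs s (fun W => f W - g W) Z = dZs s f Z - dZs s g Z.
Proof.
move=> oU Hf Hg; elim: s Z => [|k s IH] Z UZ //=.
have H1 := hol_dZs s oU Hf; have H2 := hol_dZs s oU Hg.
rewrite -(dZB k (hol_smooth oU H1) (hol_smooth oU H2) oU UZ).
apply: (dZ_ext k oU _ (hol_smooth oU (holB oU H1 H2)) UZ) => W UW.
exact/esym/IH.
Qed.

End MultiIndices.

(** * Tangent vectors annihilate functions vanishing on M *)

(** Completeness of the real row vectors, for the fixed point theorem in [level_set_curve]. *)
HB.instance Definition _ (R : realType) (m n : nat) := Complete.on 'M[R]_(m, n).

Section Tangency.
Context {R : realType} {N : nat}.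
Notation C := R[i].
Implicit Types (f g : 'rV[C]_N -> C) (Z v w : 'rV[C]_N) (M U V : set 'rV[C]_N).

Lemma mx_entry_norm n (c : 'rV[R]_n) j : `|c 0 j| <= `|c|.
Proof.
rewrite [leRHS]mx_normrE; exact: (le_bigmax_cond _ (fun i : 'I_1 * 'I_n => `|c i.1 i.2|) (j := (0, j))).
Qed.

Lemma mx_norm_le n (c : 'rV[R]_n) e : 0 <= e -> (forall j, `|c 0 j| <= e) -> `|c| <= e.
Proof.
move=> e0 H; rewrite [leLHS]mx_normrE; apply: bigmax_le => // -[i j] _ /=.
by rewrite ord1.
Qed.

Lemma real_differential_bound f Z w :
  cn (real_differential f Z w) <= (\sum_k (cn (dZ k f Z) + cn (dZbar k f Z))) * rn w.
Proof.
apply: le_trans (cn_sum _ _ _) _; rewrite mulr_suml; apply: ler_sum => k _.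
apply: le_trans (cnD _ _) _; rewrite mulrDl; apply: lerD.
  by apply: le_trans (cnM _ _) _; rewrite mulrC ler_wpM2l ?cn_ge0 // cn_le_rn.
apply: le_trans (cnM _ _) _; rewrite cnJ mulrC ler_wpM2l ?cn_ge0 //; exact: cn_le_rn.
Qed.

Definition real_comb n (V : 'M[C]_(n, N)) (c : 'rV[R]_n) : 'rV[C]_N :=
  \sum_j (c 0 j)%:C%C *: row j V.

Lemma real_combB n (V : 'M[C]_(n, N)) c c' :
  real_comb V (c - c') = real_comb V c - real_comb V c'.
Proof.
rewrite /real_comb -sumrB; apply: eq_bigr => j _.
by rewrite !mxE rmorphB scalerBl.
Qed.

Lemma real_comb_bound n (V : 'M[C]_(n, N)) c :
  rn (real_comb V c) <= (\sum_j rn (row j V)) * `|c|.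
Proof.
rewrite /real_comb mulr_suml.
have rn_sum (I : Type) (s : seq I) (F : I -> 'rV[C]_N) : rn (\sum_(i <- s) F i) <= \sum_(i <- s) rn (F i).
  elim: s => [|i s IH]; first by rewrite !big_nil rn0.
  by rewrite !big_cons; apply: le_trans (rnD _ _) _; rewrite lerD2l.
apply: le_trans (rn_sum _ _ _) _; apply: ler_sum => j _.
by rewrite rnZR mulrC ler_wpM2l ?rn_ge0 ?mx_entry_norm.
Qed.

(* The fixed point of [c |-> c - rho (Z0 + t w + V c)] corrects the point
   [Z0 + t w] to a zero of [rho]. *)
Lemma level_set_curve n U (rho : 'I_n -> 'rV[C]_N -> R) Z0 w (V : 'M[C]_(n, N)) r :
  open U -> U Z0 -> (forall j, smooth_on U (fun Z => (rho j Z)%:C%C)) ->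
  (forall j, rho j Z0 = 0) ->
  (forall j, real_differential (fun Z => (rho j Z)%:C%C) Z0 w = 0) ->
  (forall j c, real_differential (fun Z => (rho j Z)%:C%C) Z0 (real_comb V c) = (c 0 j)%:C%C) ->
  0 < r -> exists2 d : R, 0 < d & forall t, 0 < t < d ->
    exists2 c : 'rV[R]_n, `|c| <= r * t &
      forall j, rho j (Z0 + t%:C%C *: w + real_comb V c) = 0.
Proof.
move=> oU UZ0 srho rho0 rhow rhoV r0.
pose K := \sum_j rn (row j V); have K0 : 0 <= K by apply: sumr_ge0 => j _; exact: rn_ge0.
have w0 := rn_ge0 w.
(* The first bound makes the map [Phi] below contract by 1/2; the second places the image of 0 in
   half the ball of radius [r t]. Together they make the ball invariant. *)
pose e := Num.min (2%:R^-1 / (1 + K)) (2%:R^-1 * r / (1 + rn w)).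
have e0 : 0 < e.
  rewrite lt_min; apply/andP; split; first by rewrite divr_gt0 // ?invr_gt0 //; lra.
  by rewrite divr_gt0 // ?mulr_gt0 // ?invr_gt0 //; lra.
have eK : e * K <= 2%:R^-1.
  have : e <= 2%:R^-1 / (1 + K) by by rewrite ge_min lexx.
  by rewrite ler_pdivlMr; [nra|lra].
have ew : e * rn w <= 2%:R^-1 * r.
  have : e <= 2%:R^-1 * r / (1 + rn w) by by rewrite ge_min lexx orbT.
  by rewrite ler_pdivlMr; [nra|lra].
have : exists2 d : R, 0 < d & forall j y v, rn y + rn v < d ->
    cn ((rho j (Z0 + y + v))%:C%C - (rho j (Z0 + y))%:C%C
      - real_differential (fun Z => (rho j Z)%:C%C) Z0 v) <= e * rn v.
  have h j := C1_estimate oU (smooth_C1 (srho j)) UZ0 e0.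
  have /choice[dj djP] : forall j, exists d : R, 0 < d /\ forall y v, rn y + rn v < d ->
    cn ((rho j (Z0 + y + v))%:C%C - (rho j (Z0 + y))%:C%C
      - real_differential (fun Z => (rho j Z)%:C%C) Z0 v) <= e * rn v.
    by move=> j; have [d d0 dP] := h j; exists d.
  exists (\big[Num.min/1]_j dj j).
    by elim/big_ind: _ => // [x y x0 y0|j _]; [rewrite lt_min x0|case: (djP j)].
  move=> j y v yv; have [_ dP] := djP j; apply: dP; apply: lt_le_trans yv _.
  exact: bigmin_le_cond.
move=> [d d0 dP].
have rd0 : 0 < rn w + 4%:R * K * r + 1 by nra.
exists (d / (rn w + 4%:R * K * r + 1)); first by rewrite divr_gt0.
move=> t /andP[t0]; rewrite ltr_pdivlMr // => td.
have small (c : 'rV[R]_n) : `|c| <= r * t -> rn (real_comb V c) <= K * (r * t).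
  by move=> ct; apply: le_trans (real_comb_bound _ _) _; rewrite ler_wpM2l.
pose Phi (c : 'rV[R]_n) : 'rV[R]_n :=
  \row_j (c 0 j - rho j (Z0 + t%:C%C *: w + real_comb V c)).
have twE : rn (t%:C%C *: w) = t * rn w by rewrite rnZR gtr0_norm.
have Phi0 : `|Phi 0| <= 2%:R^-1 * (r * t).
  apply: mx_norm_le => [|j]; first by rewrite !mulr_ge0 ?invr_ge0 // ltW.
  have E0 : real_comb V 0 = 0 by rewrite -(subrr 0) real_combB subrr.
  rewrite !mxE E0 addr0 sub0r normrN.
  have := dP j 0 (t%:C%C *: w); rewrite rn0 add0r twE addr0 rho0 subr0.
  rewrite real_differentialZ rhow mulr0 subr0 cnR => H.
  apply: le_trans (H _) _; first by have := mulr_ge0 (ltW t0) (mulr_ge0 K0 (ltW r0)); lra.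
  by have := ler_wpM2l (ltW t0) ew; lra.
have lip (c c' : 'rV[R]_n) : `|c| <= r * t -> `|c'| <= r * t ->
    `|Phi c - Phi c'| <= 2%:R^-1 * `|c - c'|.
  move=> ct c't; apply: mx_norm_le => [|j]; first by rewrite mulr_ge0 ?invr_ge0.
  have := dP j (t%:C%C *: w + real_comb V c') (real_comb V (c - c')).
  have -> : Z0 + (t%:C%C *: w + real_comb V c') + real_comb V (c - c') =
      Z0 + t%:C%C *: w + real_comb V c by rewrite real_combB !addrA (addrAC _ (real_comb V c') (real_comb V c)) addrK.
  rewrite rhoV addrA -!rmorphB cnR !mxE => H.
  rewrite (_ : _ - _ - _ = - (rho j (Z0 + t%:C%C *: w + real_comb V c) -
    rho j (Z0 + t%:C%C *: w + real_comb V c') - (c 0 j - c' 0 j))); last by lra.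
  rewrite normrN; apply: le_trans (H _) _; last first.
    have := real_comb_bound V (c - c'); rewrite -/K; have := normr_ge0 (c - c').
    by move: (rn _) `|_| => x y; nra.
  rewrite real_combB; apply: le_lt_trans (lerD (rnD _ _) (rnD _ _)) _; rewrite rnN twE.
  have := small _ ct; have := small _ c't; have := mulr_ge0 (ltW t0) (mulr_ge0 K0 (ltW r0)).
  by move: (rn (real_comb V c)) (rn (real_comb V c')) => x y; lra.
pose D := [set c : 'rV[R]_n | `|c| <= r * t].
have PhiD : {homo Phi : c / D c >-> D c}.
  move=> c Dc; rewrite /D /=.
  have D0 : D 0 by rewrite /D /= normr0 mulr_ge0 // ltW.
  have := lip _ _ Dc D0; rewrite subr0 => H.
  have := ler_normD (Phi c - Phi 0) (Phi 0); rewrite subrK => H'.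
  by rewrite /D /= in Dc; nra.
have cD : closed D.
  have -> : D = closed_ball_ Num.norm (0 : 'rV[R]_n) (r * t).
    by apply/seteqP; split=> c; rewrite /D /closed_ball_ /= sub0r normrN.
  exact: closed_closed_ball_.
have D0 : D 0 by rewrite /D /= normr0 mulr_ge0 // ltW.
have ctr : is_contraction (mkfun_fun PhiD).
  have h2 : 0 <= 2%:R^-1 :> R by rewrite invr_ge0.
  exists (NngNum h2); split; first by rewrite /= invf_lt1 // ltr1n.
  by move=> [c c'] [/= Dc Dc']; exact: lip.
have [c Dc cE] := @banach_fixed_point R ('rV[R]_n : completeNormedModType R) D (mkfun_fun PhiD) ctr cD (ex_intro _ 0 D0).
exists c => // j; have := congr1 (fun c : 'rV[R]_n => c 0 j) cE.
rewrite /= mxE => E; move: (rho j _) E => x; lra.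
Qed.

Lemma dZbar_real U (rho : 'rV[C]_N -> R) k Z : open U ->
  smooth_on U (fun W => (rho W)%:C%C) -> U Z ->
  dZbar k (fun W => (rho W)%:C%C) Z = (dZ k (fun W => (rho W)%:C%C) Z)^*%C.
Proof.
move=> oU srho UZ; have := wirtingerJ (false, k) srho UZ.
rewrite (_ : (fun W => ((rho W)%:C%C)^*%C) = fun W => (rho W)%:C%C) //.
by apply/funext => W; rewrite conjc_real.
Qed.

Lemma real_differential_real U (rho : 'rV[C]_N -> R) w Z : open U ->
  smooth_on U (fun W => (rho W)%:C%C) -> U Z ->
  real_differential (fun W => (rho W)%:C%C) Z w =
  \sum_k w 0 k * dZ k (fun W => (rho W)%:C%C) Z +
  (\sum_k w 0 k * dZ k (fun W => (rho W)%:C%C) Z)^*%C.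
Proof.
move=> oU srho UZ; rewrite /real_differential big_split /= rmorph_sum; congr (_ + _).
by apply: eq_bigr => k _; rewrite (dZbar_real k oU srho UZ) -rmorphM.
Qed.

(** [level_set_curve] supplies zeros of [rho] at [Z0 + t w] up to an error of order [e t]. There [f]
    vanishes, so the differential of [f] along [w] is of order [e], for every [e]. *)
Lemma real_tangent_vanishing n U (rho : 'I_n -> 'rV[C]_N -> R) f Z0 w (V : 'M[C]_(n, N)) :
  open U -> U Z0 -> (forall j, smooth_on U (fun Z => (rho j Z)%:C%C)) ->
  (forall j, rho j Z0 = 0) ->
  (forall j, real_differential (fun Z => (rho j Z)%:C%C) Z0 w = 0) ->
  (forall j c, real_differential (fun Z => (rho j Z)%:C%C) Z0 (real_comb V c) = (c 0 j)%:C%C) ->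
  smooth_on U f -> (forall Z, U Z -> (forall j, rho j Z = 0) -> f Z = 0) ->
  real_differential f Z0 w = 0.
Proof.
move=> oU UZ0 srho rho0 rhow rhoV sf f0.
have /nbhs_rVP[dU dU0 dUP] := open_nbhs_nbhs (conj oU UZ0).
pose K := \sum_j rn (row j V); have K0 : 0 <= K by apply: sumr_ge0 => j _; exact: rn_ge0.
pose Kf := \sum_k (cn (dZ k f Z0) + cn (dZbar k f Z0)).
have Kf0 : 0 <= Kf by apply: sumr_ge0 => k _; rewrite addr_ge0 ?cn_ge0.
have w0 := rn_ge0 w.
suff H e : 0 < e -> e <= 1 -> cn (real_differential f Z0 w) <= e * (rn w + K + Kf * K).
  have A0 : 0 <= rn w + K + Kf * K by rewrite !addr_ge0 ?mulr_ge0.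
  apply: cn_eq0; apply/ler_addgt0Pl => e e0; rewrite addr0.
  have m0 : 0 < Num.min 1 (e / (1 + (rn w + K + Kf * K))).
    by rewrite lt_min ltr01 divr_gt0 //; lra.
  have m1 : Num.min 1 (e / (1 + (rn w + K + Kf * K))) <= 1 by rewrite ge_min lexx.
  apply: le_trans (H _ m0 m1) _.
  have : Num.min 1 (e / (1 + (rn w + K + Kf * K))) <= e / (1 + (rn w + K + Kf * K)).
    by rewrite ge_min lexx orbT.
  by rewrite ler_pdivlMr; [nra|lra].
move=> e0 e1.
have [d1 d10 d1P] := level_set_curve oU UZ0 srho rho0 rhow rhoV e0.
have [d2 d20 d2P] := C1_estimate oU (smooth_C1 sf) UZ0 e0.
pose d := Num.min d1 (Num.min d2 dU).
have dd1 : d <= d1 by rewrite ge_min lexx.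
have dd2 : d <= d2 by rewrite !ge_min lexx orbT.
have ddU : d <= dU by rewrite !ge_min lexx !orbT.
have d0 : 0 < d by rewrite !lt_min d10 d20 dU0.
pose t := d / (2%:R + rn w + K).
have t0 : 0 < t by rewrite divr_gt0 //; lra.
have tE : t * (2%:R + rn w + K) = d by rewrite /t divfK //; lra.
have tK := mulr_ge0 (ltW t0) K0; have tw := mulr_ge0 (ltW t0) w0.
clearbody d t.
have td1 : t < d1 by nra.
have [c ct cP] := d1P t (introT andP (conj t0 td1)).
set y := t%:C%C *: w + real_comb V c.
have c0 := normr_ge0 c.
have yK : rn (real_comb V c) <= e * (t * K).
  by apply: le_trans (real_comb_bound _ _) _; rewrite -/K; nra.
have ty : rn y <= t * (rn w + K).
  apply: le_trans (rnD _ _) _; rewrite rnZR gtr0_norm // mulrDr lerD2l.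
  by apply: le_trans yK _; rewrite ler_piMl.
have Uy : U (Z0 + y).
  apply: dUP; rewrite (addrC Z0) addrK; apply: le_lt_trans ty _; nra.
have fy : f (Z0 + y) = 0 by apply: f0 => // j; rewrite /y addrA.
have := d2P 0 y; rewrite rn0 add0r addr0 fy (f0 Z0 UZ0 rho0) subr0 sub0r cnN => H.
have {}H : cn (real_differential f Z0 y) <= e * rn y by apply: H; nra.
rewrite /y real_differentialD real_differentialZ in H.
have H1 := cnB (t%:C%C * real_differential f Z0 w + real_differential f Z0 (real_comb V c))
  (real_differential f Z0 (real_comb V c)).
rewrite addrK cnMR gtr0_norm // in H1.
have H2 := real_differential_bound f Z0 (real_comb V c).
have H3 : t * cn (real_differential f Z0 w) <= t * (e * (rn w + K + Kf * K)).
  have H4 : e * rn y <= e * (t * (rn w + K)) by rewrite ler_pM2l.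
  have H5 := ler_wpM2l Kf0 yK; rewrite -/Kf in H2.
  rewrite /y in H4; move: H H1 H2 H4 H5.
  move: (cn (real_differential f Z0 w)) (cn (real_differential f Z0 (real_comb V c))) => x1 x2.
  by move: (rn _) (rn _) (rn _) (cn (_ + _)) => *; lra.
by rewrite ler_pM2l in H3.
Qed.

Lemma vector_applyD Z (v v' : cvector R N) (a a' : C) f :
  vector_apply Z (a *: v + a' *: v') f = a * vector_apply Z v f + a' * vector_apply Z v' f.
Proof.
rewrite /vector_apply !mulr_sumr -big_split; apply: eq_bigr => k _ /=.
rewrite !mxE; move: (dZ k f Z) (dZbar k f Z) => *; ring.
Qed.

Theorem tangent_vanishing d M U f Z0 (v : cvector R N) : open U -> U Z0 -> M Z0 -> smooth_on U f ->
  (forall Z, (M `&` U) Z -> f Z = 0) -> ctangent d M Z0 v -> vector_apply Z0 v f = 0.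
Proof.
move=> oU UZ0 MZ0 sf f0 [U1 [rho [[oU1 U1Z0] [srho ME wedge] tv]]].
have oU2 : open (U `&` U1) by exact: openI.
have U2Z0 : (U `&` U1) Z0 by [].
have srho2 j : smooth_on (U `&` U1) (fun Z => (rho j Z)%:C%C).
  exact: smooth_sub (@subIsetr _ _ _) (srho j).
have sf2 : smooth_on (U `&` U1) f by exact: smooth_sub (@subIsetl _ _ _) sf.
have rho0 j : rho j Z0 = 0.
  have : (M `&` U1) Z0 by []. 
  by rewrite ME => -[].
have f02 Z : (U `&` U1) Z -> (forall j, rho j Z = 0) -> f Z = 0.
  move=> [UZ U1Z] rZ; apply: f0; split=> //.
  have : (M `&` U1) Z by rewrite ME.
  by case.
have [W] := wedge Z0 (conj MZ0 U1Z0); rewrite /gradient_wedge => detW.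
pose A := \matrix_(j < d) complex_gradient (rho j) Z0; rewrite -/A in detW.
(* Half a right inverse of the gradient matrix: the real differential of [rho j] is twice the real
   part of its complex gradient. *)
pose V : 'M[C]_(d, N) := \matrix_(j, k) ((W *m invmx (A *m W)) k j / 2%:R).
have rhoV j c : real_differential (fun Z => (rho j Z)%:C%C) Z0 (real_comb V c) = (c 0 j)%:C%C.
  rewrite (real_differential_real _ oU2 (srho2 j) U2Z0).
  have -> : \sum_k (real_comb V c) 0 k * dZ k (fun W => (rho j W)%:C%C) Z0 =
      (c 0 j)%:C%C / 2%:R.
    transitivity (\sum_i (c 0 i)%:C%C / 2%:R * (A *m (W *m invmx (A *m W))) j i).
      under eq_bigr do rewrite summxE mulr_suml.
      rewrite exchange_big; apply: eq_bigr => i _ /=.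
      rewrite mxE mulr_sumr; apply: eq_bigr => k _.
      rewrite !mxE -/(mxE _) ; move: (dZ _ _ _) => x; ring.
    have inv : A *m (W *m invmx (A *m W)) = 1%:M.
      by rewrite mulmxA mulmxV // unitmxE unitfE.
    rewrite inv (bigD1 j) //= big1 ?addr0 => [|i ij]; rewrite !mxE ?eqxx ?mulr1 //.
    by rewrite eq_sym (negPf ij) mulr0.
  have -> : (c 0 j)%:C%C / 2%:R = (c 0 j / 2%:R)%:C%C :> C by rewrite rmorphM fmorphV rmorph_nat.
  by rewrite conjc_real -rmorphD; congr (_%:C%C); lra.
(* The real direction a + conj(b) corresponds to v + conj(v) for v = (a, b), and conj(v) is tangent
   with v as [rho] is real. Then v is recovered from 2 v = (v + conj(v)) - i (i v + conj(i v)). *)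
have tangent_re (a b : 'rV[C]_N) :
    (forall j, vector_apply Z0 (a, b) (fun W => (rho j W)%:C%C) = 0) ->
    real_differential f Z0 (a + map_mx (fun z => z^*%C) b) = 0.
  move=> tab; apply: (real_tangent_vanishing oU2 U2Z0 srho2 rho0 _ rhoV sf2 f02) => j.
  rewrite (real_differential_real _ oU2 (srho2 j) U2Z0) rmorph_sum -big_split /=.
  have := tab j; rewrite /vector_apply /= => h.
  have h' := congr1 (fun z : C => z^*%C) h; rewrite rmorph_sum rmorph0 /= in h'.
  apply: etrans (etrans (congr2 +%R h h') (addr0 0)); rewrite -big_split /=.
  apply: eq_bigr => k _.
  rewrite (dZbar_real k oU2 (srho2 j) U2Z0) !mxE.
  move: (dZ k _ Z0) (a 0 k) (b 0 k) => x y z.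
  by rewrite !(rmorphM, rmorphD) /= !conjcK; ring.
have h1 : real_differential f Z0 (v.1 + map_mx (fun z => z^*%C) v.2) = 0.
  by apply: tangent_re => j; rewrite -surjective_pairing.
have h2 : real_differential f Z0 ('i%C *: v.1 + map_mx (fun z => z^*%C) ('i%C *: v.2)) = 0.
  apply: tangent_re => j; have := vector_applyD Z0 v 0 'i%C 0 (fun W => (rho j W)%:C%C).
  by rewrite scaler0 addr0 tv mulr0 mul0r addr0.
have : 2%:R * vector_apply Z0 v f = real_differential f Z0 (v.1 + map_mx (fun z => z^*%C) v.2)
    - 'i%C * real_differential f Z0 ('i%C *: v.1 + map_mx (fun z => z^*%C) ('i%C *: v.2)).
  rewrite /vector_apply /real_differential !mulr_sumr -sumrB; apply: eq_bigr => k _.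
  rewrite !mxE; move: (dZ k f Z0) (dZbar k f Z0) (v.1 0 k) (v.2 0 k) => x y a b.
  have cM (c c' : C) : (c * c')^*%C = c^*%C * c'^*%C by rewrite rmorphM.
  have cD (c c' : C) : (c + c')^*%C = c^*%C + c'^*%C by rewrite rmorphD.
  have ci : ('i%C)^*%C = - 'i%C :> C by apply: eqReIm; rewrite /= ?oppr0.
  rewrite !(cM, cD) !conjcK ci.
  move: a^*%C b^*%C => a' b'.
  have ii : 'i%C * 'i%C = -1 :> C by rewrite -expr2 sqr_i.
  by move: 'i%C ii => i ii; ring: ii.
by rewrite h1 h2 mulr0 subr0 => /eqP; rewrite mulf_eq0 pnatr_eq0 /= => /eqP.
Qed.

End Tangency.

(** * Jets and Hadamard's lemma *)

#[local] Transparent real_derive.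

Section Slices.
Context {R : realType} {N : nat}.
Notation C := R[i].

(** The real parameter is made a further complex coordinate, so that smoothness in parameter and
    point together is [smooth_on] in C^(1 + N). *)
Definition slice_point (t : R) (Z : 'rV[C]_N) : 'rV[C]_(1 + N) := row_mx (const_mx t%:C%C) Z.

Definition slice_dir (v : 'rV[C]_N) : 'rV[C]_(1 + N) := row_mx 0 v.

Lemma slice_pointD t Z (a : C) v :
  slice_point t Z + a *: slice_dir v = slice_point t (Z + a *: v).
Proof. by rewrite /slice_point scale_row_mx add_row_mx scaler0 addr0. Qed.

Lemma real_derive_slice t v f :
  real_derive v (fun Z => f (slice_point t Z)) =
  fun Z => real_derive (slice_dir v) f (slice_point t Z).
Proof.
apply/funext => Z; rewrite /real_derive.
have E (part : C -> R) : (fun s : R => part (f (slice_point t (Z + s%:C%C *: v)))) =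
    fun s : R => part (f (slice_point t Z + s%:C%C *: slice_dir v)).
  by apply/funext => s; rewrite slice_pointD.
by rewrite (E (@complex.Re R)) (E (@complex.Im R)).
Qed.

Lemma rn_slice t s Z W : rn (slice_point s W - slice_point t Z) = `|s - t| + rn (W - Z).
Proof.
rewrite /rn /slice_point opp_row_mx add_row_mx big_split_ord big_ord1 /=; congr (_ + _).
  by rewrite row_mxEl !mxE -rmorphB cnR.
by apply: eq_bigr => k _; rewrite row_mxEr.
Qed.

End Slices.

#[local] Opaque real_derive.

Section SmoothMatrices.
Context {R : realType} {N : nat}.
Notation C := R[i].
Variable U : set 'rV[C]_N.
Hypothesis oU : open U.

Lemma smooth_det n (A : 'rV[C]_N -> 'M[C]_n) :
  (forall i j, smooth_on U (fun Z => A Z i j)) -> smooth_on U (fun Z => \det (A Z)).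
Proof.
move=> sA; rewrite /determinant.
apply: (smooth_sum oU) => s _; apply: (smoothM oU (smooth_cst oU _)).
by apply: (smooth_prod oU) => i _; exact: sA.
Qed.

Lemma smooth_adj n (A : 'rV[C]_N -> 'M[C]_n) i j :
  (forall i j, smooth_on U (fun Z => A Z i j)) -> smooth_on U (fun Z => (\adj (A Z)) i j).
Proof.
move=> sA; rewrite (_ : (fun Z => _) = fun Z => (-1) ^+ (j + i) * \det (row' j (col' i (A Z)))).
  apply: (smoothM oU (smooth_cst oU _)); apply: smooth_det => k l.
  rewrite (_ : (fun Z => _) = fun Z => A Z (lift j k) (lift i l)); first exact: sA.
  by apply/funext => Z; rewrite !mxE.
by apply/funext => Z; rewrite mxE.
Qed.

Lemma smooth_comp m (V : set 'rV[C]_m) f (G : 'rV[C]_N -> 'rV[C]_m) : open V ->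
  (forall Z, U Z -> V (G Z)) -> (forall k, smooth_on U (fun Z => G Z 0 k)) ->
  smooth_on V f -> smooth_on U (fun Z => f (G Z)).
Proof.
move=> oV GV sG /smooth_onP sf; apply/smooth_onP => n; apply: (Ck_comp oU oV GV) => //.
by move=> k; have /smooth_onP := sG k; apply.
Qed.

Lemma open_smooth_preimage m (V : set 'rV[C]_m) (G : 'rV[C]_N -> 'rV[C]_m) : open V ->
  (forall k, smooth_on U (fun Z => G Z 0 k)) -> open (U `&` [set Z | V (G Z)]).
Proof.
move=> oV sG; rewrite openE => Z [UZ VZ]; apply: filterI.
  exact: open_nbhs_nbhs.
have /nbhs_rVP[d d0 dP] := open_nbhs_nbhs (conj oV VZ).
have e0 : 0 < d / m.+1%:R by rewrite divr_gt0.
have : \forall W \near Z, forall k, cn (G W 0 k - G Z 0 k) < d / m.+1%:R.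
  apply: (@filter_forall _ _ (fun k W => cn (G W 0 k - G Z 0 k) < d / m.+1%:R) (nbhs Z)) => k.
  have /cont_rVP/(_ _ e0)[d' d'0 d'P] := smooth_cont (sG k) UZ.
  by apply/nbhs_rVP; exists d'.
apply: filterS => W WP; apply: dP.
apply: (@le_lt_trans _ _ (\sum_(k < m) d / m.+1%:R)).
  by apply: ler_sum => k _; rewrite !mxE ltW.
rewrite sumr_const card_ord -[_ *+ m]mulr_natr mulrAC ltr_pdivrMr // ltr_pM2l //.
by rewrite ltr_nat.
Qed.

Lemma real_derive_comp m (V : set 'rV[C]_m) f (G : 'rV[C]_N -> 'rV[C]_m) v Z : open V ->
  (forall Z, U Z -> V (G Z)) -> (forall k, smooth_on U (fun Z => G Z 0 k)) ->
  smooth_on V f -> U Z ->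
  real_derive v (fun Z => f (G Z)) Z = real_differential f (G Z)
    (\row_k real_derive v (fun Z => G Z 0 k) Z).
Proof.
move=> oV GV sG sf UZ; have := @C1_curve R m V f (fun s => G (Z + s%:C%C *: v))
  (\row_k real_derive v (fun Z => G Z 0 k) Z) 0 oV (smooth_C1 sf).
rewrite (scale0r v) (addr0 Z) => /(_ (GV Z UZ)) H; apply: (pd_real_derive _).2; apply: H => k.
by rewrite mxE; exact: smooth_pd (sG k) UZ.
Qed.

End SmoothMatrices.

(** * Smoothness of integrals depending on a parameter *)

Section ParametricIntegrals.
Context {R : realType} {N : nat}.
Notation C := R[i].
Variables (U : set 'rV[C]_N) (D : set 'rV[C]_(1 + N)).
Hypotheses (oU : open U) (oD : open D).
Hypothesis UD : forall t Z, 0 <= t <= 1 -> U Z -> D (slice_point t Z).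
Implicit Types (f : 'rV[C]_(1 + N) -> C) (Z v : 'rV[C]_N).

Definition slice_cint f Z : C := cint (fun t => f (slice_point t Z)) 0 1.

Lemma slice_jcont f t Z : smooth_on D f -> 0 <= t <= 1 -> U Z ->
  jcont (fun t Z => f (slice_point t Z)) t Z.
Proof.
move=> sf t01 UZ e e0.
have /cont_rVP/(_ _ e0)[d d0 dP] := smooth_cont sf (UD t01 UZ).
exists (d / 2%:R); first by rewrite divr_gt0.
move=> s W sd Wd; apply: dP; rewrite rn_slice (addrC t) addrK; lra.
Qed.

Lemma slice_near Z : U Z -> exists2 r : R, 0 < r & forall W, rn (W - Z) < r -> U W.
Proof. by move=> UZ; have /nbhs_rVP := open_nbhs_nbhs (conj oU UZ). Qed.

Lemma pd_slice_cint f Z v : smooth_on D f -> U Z ->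
  pd (slice_cint f) Z v (slice_cint (real_derive (slice_dir v) f) Z).
Proof.
move=> sf UZ; apply: (@pd_cint R N (fun t Z => f (slice_point t Z))
  (fun t Z => real_derive (slice_dir v) f (slice_point t Z)) 0 1 Z v ler01).
have [r r0 rP] := slice_near UZ; exists r => // t W t01 /rP UW; split.
- exact: slice_jcont.
- exact: slice_jcont (smooth_real_derive (slice_dir v) sf) t01 UW.
move=> e /(smooth_pd (slice_dir v) sf (UD t01 UW))[d d0 dP]; exists d => // h /dP.
by rewrite !slice_pointD.
Qed.

Lemma continuous_slice_cint f Z : smooth_on D f -> U Z -> {for Z, continuous (slice_cint f)}.
Proof.
move=> sf UZ; apply: (@continuous_cint R N (fun t Z => f (slice_point t Z)) 0 1 Z ler01).
have [r r0 rP] := slice_near UZ; exists r => // t W t01 /rP UW; exact: slice_jcont.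
Qed.

Lemma smooth_slice_cint f : smooth_on D f -> smooth_on U (slice_cint f).
Proof.
move=> sf; apply/smooth_onP => n; elim: n f sf => [|n IH] f sf.
  by split=> // Z UZ; exact: continuous_slice_cint.
apply: (Ck_intro oU (f' := fun v Z => slice_cint (real_derive (slice_dir v) f) Z)).
- by move=> Z UZ; exact: continuous_slice_cint.
- by move=> Z v UZ; exact: pd_slice_cint.
by move=> v; exact: (IH _ (smooth_real_derive (slice_dir v) sf)).
Qed.

Lemma real_derive_slice_cint f v Z : smooth_on D f -> U Z ->
  real_derive v (slice_cint f) Z = slice_cint (real_derive (slice_dir v) f) Z.
Proof. by move=> sf UZ; exact: (pd_real_derive (pd_slice_cint v sf UZ)).2. Qed.

End ParametricIntegrals.

(** * Equality of jets at a point *)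

Section Jets.
Context {R : realType} {N : nat}.
Notation C := R[i].
Variables (U : set 'rV[C]_N) (p : 'rV[C]_N).
Hypotheses (oU : open U) (Up : U p).
Implicit Types (f g : 'rV[C]_N -> C) (Z v : 'rV[C]_N).

(** All real directional derivatives are compared, since the relation must pass through conjugates
    and through smooth functions such as [rho']. For holomorphic functions the d/dZ derivatives
    suffice, by [jet_eq_hol]. *)
Fixpoint jet_eq k f g : Prop :=
  f p = g p /\
  if k is k'.+1 then forall v, jet_eq k' (real_derive v f) (real_derive v g) else True.

Lemma jet_eq_value k f g : jet_eq k f g -> f p = g p.
Proof. by case: k => [|k] []. Qed.

Lemma jet_eq_refl k f : jet_eq k f f.
Proof. by elim: k f => [|k IH] f; split. Qed.

Lemma jet_eq_sym k f g : jet_eq k f g -> jet_eq k g f.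
Proof.
by elim: k f g => [|k IH] f g [E D]; split=> // v; apply: IH; exact: D.
Qed.

Lemma jet_eqS k f g : jet_eq k.+1 f g -> jet_eq k f g.
Proof.
by elim: k f g => [|k IH] f g [E D]; split=> // v; apply: IH; exact: D.
Qed.

Lemma jet_eq_ext k f f' g g' : smooth_on U f -> smooth_on U g ->
  (forall Z, U Z -> f Z = f' Z) -> (forall Z, U Z -> g Z = g' Z) ->
  jet_eq k f g -> jet_eq k f' g'.
Proof.
elim: k f f' g g' => [|k IH] f f' g g' sf sg Ef Eg [E D]; split=> //.
- by rewrite -Ef // -Eg.
- by rewrite -Ef // -Eg.
move=> v; apply: (IH _ _ _ _ (smooth_real_derive v sf) (smooth_real_derive v sg) _ _ (D v)).
- by move=> Z UZ; rewrite (real_derive_ext oU v Ef sf UZ).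
- by move=> Z UZ; rewrite (real_derive_ext oU v Eg sg UZ).
Qed.

Lemma jet_eqD k f f' g g' : smooth_on U f -> smooth_on U f' -> smooth_on U g -> smooth_on U g' ->
  jet_eq k f g -> jet_eq k f' g' -> jet_eq k (fun Z => f Z + f' Z) (fun Z => g Z + g' Z).
Proof.
elim: k f f' g g' => [|k IH] f f' g g' sf sf' sg sg' [E D] [E' D']; split=> //=.
- by rewrite E E'.
- by rewrite E E'.
move=> v; have sdf := smooth_real_derive v sf; have sdf' := smooth_real_derive v sf'.
have sdg := smooth_real_derive v sg; have sdg' := smooth_real_derive v sg'.
apply: (jet_eq_ext (smoothD oU sdf sdf') (smoothD oU sdg sdg') _ _
  (IH _ _ _ _ sdf sdf' sdg sdg' (D v) (D' v))) => Z UZ.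
- by rewrite (real_deriveD v sf sf' UZ).
- by rewrite (real_deriveD v sg sg' UZ).
Qed.

Lemma jet_eqM k f f' g g' : smooth_on U f -> smooth_on U f' -> smooth_on U g -> smooth_on U g' ->
  jet_eq k f g -> jet_eq k f' g' -> jet_eq k (fun Z => f Z * f' Z) (fun Z => g Z * g' Z).
Proof.
elim: k f f' g g' => [|k IH] f f' g g' sf sf' sg sg' J J'.
  by case: J J' => E _ [E' _]; split=> //=; rewrite E E'.
split; first by rewrite (jet_eq_value J) (jet_eq_value J').
move=> v; have sdf := smooth_real_derive v sf; have sdf' := smooth_real_derive v sf'.
have sdg := smooth_real_derive v sg; have sdg' := smooth_real_derive v sg'.
have J1 := IH _ _ _ _ sdf sf' sdg sg' (J.2 v) (jet_eqS J').
have J2 := IH _ _ _ _ sf sdf' sg sdg' (jet_eqS J) (J'.2 v).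
have s1 := smoothM oU sdf sf'; have s2 := smoothM oU sf sdf'.
have s3 := smoothM oU sdg sg'; have s4 := smoothM oU sg sdg'.
apply: (jet_eq_ext (smoothD oU s1 s2) (smoothD oU s3 s4) _ _ (jet_eqD s1 s2 s3 s4 J1 J2)) => Z UZ.
- by rewrite (real_deriveM v sf sf' UZ).
- by rewrite (real_deriveM v sg sg' UZ).
Qed.

Lemma jet_eqJ k f g : smooth_on U f -> smooth_on U g ->
  jet_eq k f g -> jet_eq k (fun Z => (f Z)^*%C) (fun Z => (g Z)^*%C).
Proof.
elim: k f g => [|k IH] f g sf sg [E D]; split=> //; [by rewrite E|by rewrite E|].
move=> v; have sdf := smooth_real_derive v sf; have sdg := smooth_real_derive v sg.
apply: (jet_eq_ext (smoothJ oU sdf) (smoothJ oU sdg) _ _ (IH _ _ sdf sdg (D v))) => Z UZ.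
- by rewrite (real_deriveJ v sf UZ).
- by rewrite (real_deriveJ v sg UZ).
Qed.

Lemma jet_eq_sum k I (s : seq I) (f g : I -> 'rV[C]_N -> C) :
  (forall i, smooth_on U (f i)) -> (forall i, smooth_on U (g i)) ->
  (forall i, jet_eq k (f i) (g i)) ->
  jet_eq k (fun Z => \sum_(i <- s) f i Z) (fun Z => \sum_(i <- s) g i Z).
Proof.
move=> sf sg J; elim: s => [|i s IH].
  rewrite (_ : (fun Z => _) = fun=> 0); last by apply/funext => Z; rewrite big_nil.
  rewrite (_ : (fun Z : 'rV[C]_N => \sum_(i <- [::]) g i Z) = fun=> 0); first exact: jet_eq_refl.
  by apply/funext => Z; rewrite big_nil.
have E (h : I -> 'rV[C]_N -> C) :
    (fun Z => \sum_(j <- i :: s) h j Z) = fun Z => h i Z + \sum_(j <- s) h j Z.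
  by apply/funext => Z; rewrite big_cons.
rewrite !E; apply: (jet_eqD (sf i) _ (sg i) _ (J i) IH).
- exact: (smooth_sum oU s (fun j _ => sf j)).
- exact: (smooth_sum oU s (fun j _ => sg j)).
Qed.

Lemma jet_eq_deriv_op k b f g : smooth_coefs U b -> smooth_on U f -> smooth_on U g ->
  jet_eq k.+1 f g -> jet_eq k (deriv_op b f) (deriv_op b g).
Proof.
move=> sb sf sg J; apply: jet_eq_sum => l.
- exact: (smoothM oU (sb l) (smooth_wirtinger oU l sf)).
- exact: (smoothM oU (sb l) (smooth_wirtinger oU l sg)).
apply: (jet_eqM (sb l) (smooth_wirtinger oU l sf) (sb l) (smooth_wirtinger oU l sg)).
  exact: jet_eq_refl.
have E h : wirtinger l h = fun Z => (real_derive (delta_mx 0 l.2) h Z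
   + wsign l * real_derive ('i%C *: delta_mx 0 l.2) h Z) * 2%:R^-1.
  by apply/funext => Z; rewrite wirtingerE.
rewrite !E.
set e := delta_mx 0 l.2; set e' := 'i%C *: e.
have sfe := smooth_real_derive e sf; have sge := smooth_real_derive e sg.
have sc (c : C) := smooth_cst oU c.
have sfe' := smoothM oU (sc (wsign l)) (smooth_real_derive e' sf).
have sge' := smoothM oU (sc (wsign l)) (smooth_real_derive e' sg).
apply: (jet_eqM (smoothD oU sfe sfe') (sc _) (smoothD oU sge sge') (sc _) _ (jet_eq_refl _ _)).
apply: (jet_eqD sfe sfe' sge sge' (J.2 e)).
by apply: (jet_eqM (sc _) _ (sc _) _ (jet_eq_refl _ _) (J.2 e')); exact: smooth_real_derive.
Qed.

Lemma jet_eq_hol k f g : hol U f -> hol U g ->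
  (forall s, (size s <= k)%N -> dZs s f p = dZs s g p) -> jet_eq k f g.
Proof.
elim: k f g => [|k IH] f g Hf Hg E; have E0 : f p = g p := E [::] isT; first by split.
split=> // v.
have E' h : hol U h -> forall Z, U Z ->
    \sum_(l <- index_enum 'I_N) v 0 l * dZ l h Z = real_derive v h Z.
  by move=> Hh Z UZ; rewrite (hol_differential v oU Hh UZ).
have sc (c : C) := smooth_cst oU c.
have sd h l : hol U h -> smooth_on U (dZ l h).
  by move=> Hh; exact: (hol_smooth oU (hol_of_dZ l oU Hh)).
have sm h l : hol U h -> smooth_on U (fun Z => v 0 l * dZ l h Z).
  by move=> Hh; exact: (smoothM oU (sc _) (sd _ _ Hh)).
apply: (jet_eq_ext _ _ (E' f Hf) (E' g Hg)).
- by apply: (smooth_sum oU) => l _; exact: sm.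
- by apply: (smooth_sum oU) => l _; exact: sm.
apply: (jet_eq_sum (index_enum 'I_N) (fun l => sm f l Hf) (fun l => sm g l Hg)) => l.
apply: (jet_eqM (sc _) (sd f l Hf) (sc _) (sd g l Hg) (jet_eq_refl _ _)).
apply: (IH _ _ (hol_of_dZ l oU Hf) (hol_of_dZ l oU Hg)) => s sk.
by have := E (rcons s l); rewrite /dZs !foldr_rcons size_rcons; apply.
Qed.

Lemma jet_eq_comp k m (V : set 'rV[C]_m) (g : 'rV[C]_m -> C) (A B : 'rV[C]_N -> 'rV[C]_m) : open V ->
  (forall Z, U Z -> V (A Z)) -> (forall Z, U Z -> V (B Z)) ->
  (forall l, smooth_on U (fun Z => A Z 0 l)) -> (forall l, smooth_on U (fun Z => B Z 0 l)) ->
  smooth_on V g -> (forall l, jet_eq k (fun Z => A Z 0 l) (fun Z => B Z 0 l)) ->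
  jet_eq k (fun Z => g (A Z)) (fun Z => g (B Z)).
Proof.
move=> oV VA VB sA sB; elim: k g => [|k IH] g sg J.
  by split=> //; congr g; apply/rowP => l; exact: jet_eq_value (J l).
split; first by congr g; apply/rowP => l; exact: jet_eq_value (J l).
move=> v.
have chain (G : 'rV[C]_N -> 'rV[C]_m) : (forall Z, U Z -> V (G Z)) ->
    (forall l, smooth_on U (fun Z => G Z 0 l)) -> forall Z, U Z ->
    \sum_(l <- index_enum 'I_m) (real_derive v (fun Z => G Z 0 l) Z * dZ l g (G Z) +
      (real_derive v (fun Z => G Z 0 l) Z)^*%C * dZbar l g (G Z)) =
    real_derive v (fun Z => g (G Z)) Z.
  move=> VG sG Z UZ; rewrite (real_derive_comp v oV VG sG sg UZ).
  by apply: eq_bigr => l _; rewrite mxE.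
have Jk l := jet_eqS (J l).
have J1 l := IH _ (smooth_dZ oV l sg) Jk; have J2 l := IH _ (smooth_dZbar oV l sg) Jk.
have s1 (G : 'rV[C]_N -> 'rV[C]_m) (VG : forall Z, U Z -> V (G Z))
  (sG : forall l, smooth_on U (fun Z => G Z 0 l)) l :=
  smooth_comp oU oV VG sG (smooth_dZ oV l sg).
have s2 (G : 'rV[C]_N -> 'rV[C]_m) (VG : forall Z, U Z -> V (G Z))
  (sG : forall l, smooth_on U (fun Z => G Z 0 l)) l :=
  smooth_comp oU oV VG sG (smooth_dZbar oV l sg).
have sd (G : 'rV[C]_N -> 'rV[C]_m) (sG : forall l, smooth_on U (fun Z => G Z 0 l)) l :=
  smooth_real_derive v (sG l).
have st (G : 'rV[C]_N -> 'rV[C]_m) (VG : forall Z, U Z -> V (G Z))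
  (sG : forall l, smooth_on U (fun Z => G Z 0 l)) l :=
  smoothD oU (smoothM oU (sd G sG l) (s1 G VG sG l)) (smoothM oU (smoothJ oU (sd G sG l)) (s2 G VG sG l)).
apply: (jet_eq_ext _ _ (chain A VA sA) (chain B VB sB)).
- by apply: (smooth_sum oU) => l _; exact: st.
- by apply: (smooth_sum oU) => l _; exact: st.
apply: (jet_eq_sum (index_enum 'I_m) (st A VA sA) (st B VB sB)) => l.
have Jl := (J l).2 v.
apply: (jet_eqD _ _ _ _ (jet_eqM (sd A sA l) (s1 A VA sA l) (sd B sB l) (s1 B VB sB l) Jl (J1 l))
  (jet_eqM (smoothJ oU (sd A sA l)) (s2 A VA sA l) (smoothJ oU (sd B sB l)) (s2 B VB sB l)
   (jet_eqJ (sd A sA l) (sd B sB l) Jl) (J2 l))).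
- exact: (smoothM oU (sd A sA l) (s1 A VA sA l)).
- exact: (smoothM oU (smoothJ oU (sd A sA l)) (s2 A VA sA l)).
- exact: (smoothM oU (sd B sB l) (s1 B VB sB l)).
- exact: (smoothM oU (smoothJ oU (sd B sB l)) (s2 B VB sB l)).
Qed.

Lemma jet_eq_slice_cint (D : set 'rV[C]_(1 + N)) k (f : 'rV[C]_(1 + N) -> C) g : open D ->
  (forall t Z, 0 <= t <= 1 -> U Z -> D (slice_point t Z)) ->
  smooth_on D f -> smooth_on U g ->
  (forall t : R, 0 <= t <= 1 -> jet_eq k (fun Z => f (slice_point t Z)) g) ->
  jet_eq k (slice_cint f) g.
Proof.
move=> oD UD; elim: k f g => [|k IH] f g sf sg J; have v0 : slice_cint f p = g p.
- rewrite /slice_cint (cint_ext ler01 (g := fun=> g p)).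
  + by rewrite (cint_cst _ ler01) subr0 mul1r.
  + by move=> t /J[].
  by move=> t t01; exact: jcont_ccont (slice_jcont UD sf t01 Up).
- by [].
- rewrite /slice_cint (cint_ext ler01 (g := fun=> g p)).
  + by rewrite (cint_cst _ ler01) subr0 mul1r.
  + by move=> t /J[].
  by move=> t t01; exact: jcont_ccont (slice_jcont UD sf t01 Up).
split=> // v.
have sdf := smooth_real_derive (slice_dir v) sf; have sdg := smooth_real_derive v sg.
have J' : jet_eq k (slice_cint (real_derive (slice_dir v) f)) (real_derive v g).
  by apply: (IH _ _ sdf sdg) => t /J[_ /(_ v)]; rewrite real_derive_slice.
apply: (jet_eq_ext (smooth_slice_cint oU UD sdf) sdg _ _ J') => // Z UZ.
by rewrite (real_derive_slice_cint oU UD v sf UZ).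
Qed.

End Jets.

(** * Hadamard's lemma for a real function along two maps *)

Section Hadamard.
Context {R : realType} {N m : nat}.
Notation C := R[i].
Variables (U : set 'rV[C]_N) (V : set 'rV[C]_m) (oU : open U) (oV : open V).
Variables (rho : 'rV[C]_m -> R) (q : 'rV[C]_m) (r : R) (H H' : 'rV[C]_N -> 'rV[C]_m).
Hypothesis srho : smooth_on V (fun y => (rho y)%:C%C).
Hypothesis ballV : forall y, rn (y - q) < r -> V y.
Hypotheses (Hball : forall Z, U Z -> rn (H Z - q) < r) (H'ball : forall Z, U Z -> rn (H' Z - q) < r).
Hypothesis sH : forall l, smooth_on U (fun Z => H Z 0 l).
Hypothesis sH' : forall l, smooth_on U (fun Z => H' Z 0 l).
Implicit Types (Z v : 'rV[C]_N) (W : 'rV[C]_(1 + N)).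

Local Notation rhoC := (fun y => (rho y)%:C%C).

Definition interpolation W : 'rV[C]_m := \row_l
  (W 0 (lshift N 0) * H (rsubmx W) 0 l + (1 - W 0 (lshift N 0)) * H' (rsubmx W) 0 l).

Lemma interpolation_slice (t : R) Z :
  interpolation (slice_point t Z) = H' Z + t%:C%C *: (H Z - H' Z).
Proof.
apply/rowP => l; rewrite !mxE row_mxKr (unsplitK (inl _)) mxE.
by move: (H Z 0 l) (H' Z 0 l) => *; ring.
Qed.

Let U1 := [set W : 'rV[C]_(1 + N) | U (rsubmx W)].

Let oU1 : open U1.
Proof.
have -> : U1 = setT `&` [set W | U (rsubmx W)] by rewrite setTI.
apply: (open_smooth_preimage openT oU) => k.
rewrite (_ : (fun W : 'rV[C]_(1 + N) => _) = fun W => W 0 (rshift 1 k)).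
  exact: (smooth_coord openT (rshift 1 k)).
by apply/funext => W; rewrite mxE.
Qed.

Let smooth_rsub (G : 'rV[C]_N -> 'rV[C]_m) l : smooth_on U (fun Z => G Z 0 l) ->
  smooth_on U1 (fun W => G (rsubmx W) 0 l).
Proof.
move=> sG; apply: (smooth_comp oU1 oU (G := fun W => rsubmx W) _ _ sG) => // k.
rewrite (_ : (fun W : 'rV[C]_(1 + N) => _) = fun W => W 0 (rshift 1 k)).
  exact: (smooth_coord oU1 (rshift 1 k)).
by apply/funext => W; rewrite mxE.
Qed.

Let smooth_interpolation l : smooth_on U1 (fun W => interpolation W 0 l).
Proof.
rewrite (_ : (fun W => _) = fun W => (W 0 (lshift N 0) * H (rsubmx W) 0 l +
    (1 - W 0 (lshift N 0)) * H' (rsubmx W) 0 l)); last by apply/funext => W; rewrite mxE.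
have sc := smooth_coord oU1 (lshift N 0).
apply: (smoothD oU1 (smoothM oU1 sc (smooth_rsub (sH l)))).
exact: (smoothM oU1 (smoothB oU1 (smooth_cst oU1 1) sc) (smooth_rsub (sH' l))).
Qed.

Let D := U1 `&` [set W | V (interpolation W)].

Let oD : open D. Proof. exact: (open_smooth_preimage (G := interpolation) oU1 oV smooth_interpolation). Qed.

Let segmentV (t : R) Z : 0 <= t <= 1 -> U Z -> V (H' Z + t%:C%C *: (H Z - H' Z)).
Proof.
move=> /andP[t0 t1] UZ; apply: ballV.
have -> : H' Z + t%:C%C *: (H Z - H' Z) - q =
    t%:C%C *: (H Z - q) + (1 - t)%:C%C *: (H' Z - q).
  move: (H Z) (H' Z) => x y; apply/rowP => l; rewrite !mxE rmorphB rmorph1.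
  by move: (x 0 l) (y 0 l) (q 0 l) => *; ring.
apply: le_lt_trans (rnD _ _) _; rewrite !rnZR !ger0_norm ?subr_ge0 //.
have := Hball UZ; have := H'ball UZ; move: (rn _) (rn _) => x y; case: (leP x y) => xy; nra.
Qed.

Let UD (t : R) Z : 0 <= t <= 1 -> U Z -> D (slice_point t Z).
Proof.
move=> t01 UZ; split; first by rewrite /U1 /= row_mxKr.
by rewrite /= interpolation_slice; exact: segmentV.
Qed.

Definition hadamard_coef l : 'rV[C]_N -> C :=
  slice_cint (fun W => dZ l rhoC (interpolation W)).

Let smooth_integrand l : smooth_on D (fun W => dZ l rhoC (interpolation W)).
Proof.
apply: (smooth_comp oD oV _ _ (smooth_dZ oV l srho)); first by move=> W [].
by move=> k; exact: smooth_sub (@subIsetl _ _ _) (smooth_interpolation k).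
Qed.

Lemma smooth_hadamard_coef l : smooth_on U (hadamard_coef l).
Proof. exact (smooth_slice_cint oU UD (smooth_integrand l)). Qed.

(** The fundamental theorem of calculus on the segment from [H' Z] to [H Z], which stays in the ball
    around [q] by convexity. The conjugate terms appear because [rho] is real. *)
Lemma hadamard_formula Z : U Z -> (rho (H Z))%:C%C - (rho (H' Z))%:C%C =
  \sum_l (hadamard_coef l Z * (H Z 0 l - H' Z 0 l)
          + (hadamard_coef l Z)^*%C * (H Z 0 l - H' Z 0 l)^*%C).
Proof.
move=> UZ; pose seg (t : R) := H' Z + t%:C%C *: (H Z - H' Z).
have dseg t : 0 <= t <= 1 -> cderiv (fun s => rhoC (seg s)) t
    (real_differential rhoC (seg t) (H Z - H' Z)).
  move=> t01; apply: (C1_curve oV (smooth_C1 srho) (segmentV t01 UZ)) => k.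
  have := cderivD (cderiv_cst (H' Z 0 k) t) (cderivM (cderiv_id t) (cderiv_cst ((H Z - H' Z) 0 k) t)).
  rewrite add0r mul1r mulr0 addr0; congr (cderiv _ _ _).
  by apply/funext => s; rewrite !mxE.
have -> : rhoC (H Z) = rhoC (seg 1) by rewrite /seg scale1r addrC subrK.
have -> : rhoC (H' Z) = rhoC (seg 0) by rewrite /seg scale0r addr0.
rewrite -(cint_primitive ler01 dseg).
have /choice[F HF] : forall l : 'I_m, exists F : R -> C,
    primitive_on 0 1 F (fun t => dZ l rhoC (interpolation (slice_point t Z))).
  move=> l; apply: ex_cprimitive ler01 _ => t t01.
  exact: jcont_ccont (slice_jcont UD (smooth_integrand l) t01 UZ).
have FE l : hadamard_coef l Z = F l 1 - F l 0 by exact: cint_primitive ler01 (HF l).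
pose a l := H Z 0 l - H' Z 0 l.
rewrite (cint_primitive (F := fun t => \sum_l (F l t * a l + (F l t)^*%C * (a l)^*%C)) ler01).
  rewrite -sumrB; apply: eq_bigr => l _; rewrite FE -/(a l) rmorphB /=.
  move: (F l 1)^*%C (F l 0)^*%C (a l)^*%C (F l 1) (F l 0) (a l) => *; ring.
move=> t t01; rewrite (real_differential_real _ oV srho (segmentV t01 UZ)) rmorph_sum -big_split /=.
apply: cderiv_sum => l _; have h := HF l t t01; rewrite interpolation_slice in h.
have -> : (H Z - H' Z) 0 l = a l by rewrite !mxE.
move: (dZ l _ _) h => D1 h.
have := cderivD (cderivM h (cderiv_cst (a l) t)) (cderivM (cderivJ h) (cderiv_cst (a l)^*%C t)).
by rewrite !mulr0 !addr0 rmorphM /= (mulrC (a l)) (mulrC (a l)^*%C).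
Qed.

(** When [H] and [H'] have the same k-jet, so does every point of the segment between them, and
    averaging over the segment changes nothing. Nondegeneracy, a condition on the gradient along [H]
    at [p], thereby passes to the Hadamard coefficients. *)
Lemma jet_eq_hadamard_coef p k l : U p ->
  (forall j, jet_eq p k (fun Z => H Z 0 j) (fun Z => H' Z 0 j)) ->
  jet_eq p k (hadamard_coef l) (fun Z => dZ l rhoC (H Z)).
Proof.
move=> Up J; have VH Z : U Z -> V (H Z) by move=> /Hball/ballV.
apply: (jet_eq_slice_cint oU Up oD UD (smooth_integrand l)
  (smooth_comp oU oV VH sH (smooth_dZ oV l srho))) => t t01.
have EI Z j : interpolation (slice_point t Z) 0 j = t%:C%C * H Z 0 j + (1 - t%:C%C) * H' Z 0 j.
  rewrite interpolation_slice !mxE; move: (H Z 0 j) (H' Z 0 j) => *; ring.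
have sc (c : C) := smooth_cst oU c.
have s1 j := smoothM oU (sc t%:C%C) (sH j).
have s2 j := smoothM oU (sc (1 - t%:C%C)) (sH' j).
have s3 j := smoothM oU (sc (1 - t%:C%C)) (sH j).
apply: (jet_eq_comp oU Up oV (A := fun Z => interpolation (slice_point t Z))
  (B := H) _ VH _ sH (smooth_dZ oV l srho)).
- by move=> Z UZ; rewrite interpolation_slice; exact: segmentV.
- move=> j; rewrite (_ : (fun Z => _) = fun Z => t%:C%C * H Z 0 j + (1 - t%:C%C) * H' Z 0 j).
    exact: (smoothD oU (s1 j) (s2 j)).
  by apply/funext => Z; exact: EI.
move=> j; apply: (jet_eq_ext oU Up (smoothD oU (s1 j) (s2 j)) (smoothD oU (s1 j) (s3 j))).
- by move=> Z _; rewrite EI.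
- by move=> Z _; move: (H Z 0 j) => *; ring.
apply: (jet_eqD oU Up (s1 j) (s2 j) (s1 j) (s3 j) (jet_eq_refl _ _ _)).
apply: (jet_eqM oU Up (sc _) (sH' j) (sc _) (sH j) (jet_eq_refl _ _ _)).
by exact: jet_eq_sym (J j).
Qed.

End Hadamard.

(** * Reflection along CR and anti-CR fields *)

Section FieldsAsOperators.
Context {R : realType} {N : nat}.
Notation C := R[i].
Notation L := (bool * 'I_N)%type.
Implicit Types (X Y : cfield R N) (u v : 'rV[C]_N -> C) (b : L -> 'rV[C]_N -> C) (Z : 'rV[C]_N).

Definition field_coefs X : L -> 'rV[C]_N -> C :=
  fun l Z => if l.1 then (X Z).1 0 l.2 else (X Z).2 0 l.2.

Lemma deriv_opE b u Z : deriv_op b u Z =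
  \sum_k b (true, k) Z * dZ k u Z + \sum_k b (false, k) Z * dZbar k u Z.
Proof.
transitivity (\sum_e \sum_k b (e, k) Z * wirtinger (e, k) u Z); last by rewrite big_bool.
by rewrite pair_bigA; apply: eq_bigr => -[].
Qed.

Lemma field_applyE X u : field_apply X u = deriv_op (field_coefs X) u.
Proof.
apply/funext => Z; rewrite deriv_opE /field_apply /vector_apply big_split.
by [].
Qed.

Lemma smooth_field_coefs U V X : U `<=` V -> smooth_field V X -> smooth_coefs U (field_coefs X).
Proof.
by move=> UV sX [[] k]; have [s1 s2] := sX k; [exact: smooth_sub UV s1|exact: smooth_sub UV s2].
Qed.

Lemma deriv_op_vector_apply X u Z : deriv_op (field_coefs X) u Z = vector_apply Z (X Z) u.
Proof. by rewrite -field_applyE. Qed.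

Lemma field_coefs_bracket X Y l Z : field_coefs (bracket X Y) l Z =
  deriv_op (field_coefs X) (field_coefs Y l) Z - deriv_op (field_coefs Y) (field_coefs X l) Z.
Proof. by case: l => -[] k; rewrite -!field_applyE /field_coefs /= mxE. Qed.

Variable U : set 'rV[C]_N.
Hypothesis oU : open U.

Lemma smooth_field_bracket X Y : smooth_field U X -> smooth_field U Y ->
  smooth_field U (bracket X Y).
Proof.
move=> sX sY k; have bX := smooth_field_coefs (@subset_refl _ U) sX.
have bY := smooth_field_coefs (@subset_refl _ U) sY.
have s l : smooth_on U (field_coefs (bracket X Y) l).
  rewrite (_ : field_coefs _ l = fun Z => deriv_op (field_coefs X) (field_coefs Y l) Z -
    deriv_op (field_coefs Y) (field_coefs X l) Z).
    exact: (smoothB oU (smooth_deriv_op oU bX (bY l)) (smooth_deriv_op oU bY (bX l))).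
  by apply/funext => Z; exact: field_coefs_bracket.
by split; [exact: (s (true, k))|exact: (s (false, k))].
Qed.

Lemma deriv_op_bracket X Y u Z : smooth_field U X -> smooth_field U Y -> smooth_on U u -> U Z ->
  deriv_op (field_coefs (bracket X Y)) u Z =
  deriv_op (field_coefs X) (deriv_op (field_coefs Y) u) Z -
  deriv_op (field_coefs Y) (deriv_op (field_coefs X) u) Z.
Proof.
move=> sX sY su UZ; have bX := smooth_field_coefs (@subset_refl _ U) sX.
have bY := smooth_field_coefs (@subset_refl _ U) sY.
move: (field_coefs X) (field_coefs Y) bX bY (@field_coefs_bracket X Y) => x y bX bY E.
have expand b c : smooth_coefs U b -> smooth_coefs U c -> deriv_op b (deriv_op c u) Z =
    \sum_l (deriv_op b (c l) Z * wirtinger l u Z) +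
    \sum_l \sum_m c l Z * (b m Z * wirtinger m (wirtinger l u) Z).
  move=> sb sc; rewrite -big_split /=.
  have sl l := smooth_wirtinger oU l su.
  have Dsum (s : seq L) : deriv_op b (fun W => \sum_(l <- s) c l W * wirtinger l u W) Z =
      \sum_(l <- s) (deriv_op b (c l) Z * wirtinger l u Z +
        \sum_m c l Z * (b m Z * wirtinger m (wirtinger l u) Z)).
    elim: s => [|l s IH].
      rewrite big_nil (_ : (fun W => _) = fun=> 0) ?deriv_op_cst //.
      by apply/funext => W; rewrite big_nil.
    rewrite big_cons -IH (_ : (fun W => _) = fun W => c l W * wirtinger l u W +
      \sum_(l <- s) c l W * wirtinger l u W); last by apply/funext => W; rewrite big_cons.
    have s1 l := smoothM oU (sc l) (sl l).
    rewrite (deriv_opD b (s1 l) (smooth_sum oU s (fun l _ => s1 l)) UZ).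
    by rewrite (deriv_opM b (sc l) (sl l) UZ) -mulr_sumr.
  exact: Dsum.
rewrite (expand x y bX bY) (expand y x bY bX).
have -> : \sum_l \sum_m y l Z * (x m Z * wirtinger m (wirtinger l u) Z) =
    \sum_l \sum_m x l Z * (y m Z * wirtinger m (wirtinger l u) Z).
  rewrite exchange_big; apply: eq_bigr => l _; apply: eq_bigr => m _.
  by rewrite (wirtinger_comm oU l m su UZ) mulrCA.
have cancel (a c e : C) : a + e - (c + e) = a - c by ring.
rewrite cancel -sumrB; apply: eq_bigr => l _.
by rewrite E mulrBl.
Qed.

End FieldsAsOperators.

(** * The kernel of a formal flow as an ideal *)

Section FlowKernelIdeal.
Context {R : realType} {N : nat}.
Notation C := R[i].
Notation L := (bool * 'I_N)%type.
Variables (U : set 'rV[C]_N) (p : 'rV[C]_N) (B : set (L -> 'rV[C]_N -> C)).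
Hypotheses (oU : open U) (Up : U p).
Hypothesis sB : forall b, B b -> smooth_coefs U b.
Implicit Types (u v a : 'rV[C]_N -> C) (b : L -> 'rV[C]_N -> C) (Z : 'rV[C]_N).

Lemma flow_kernel_value w u : flow_kernel p w u -> u p = 0.
Proof. by elim: w u => [|b w IH] u //= H; exact: IH (H 0%N). Qed.

Lemma flow_kernel_ext w u v : all_in B w -> smooth_on U u -> (forall Z, U Z -> u Z = v Z) ->
  flow_kernel p w u -> flow_kernel p w v.
Proof.
elim: w u v => [|b w IH] u v /=; first by move=> _ _ E; rewrite E.
move=> [Bb Bw] su E H k; apply: (IH _ _ Bw (smooth_iter_deriv_op oU k (sB Bb) su) _ (H k)).
by move=> Z UZ; exact: (iter_ext oU (sB Bb) k su E UZ).
Qed.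

Lemma iter_deriv_opD b k u v Z : smooth_coefs U b -> smooth_on U u -> smooth_on U v -> U Z ->
  iter k (deriv_op b) (fun Z => u Z + v Z) Z = iter k (deriv_op b) u Z + iter k (deriv_op b) v Z.
Proof.
move=> sb su sv; elim: k Z => [|k IH] Z UZ //=.
have s1 := smooth_iter_deriv_op oU k sb su; have s2 := smooth_iter_deriv_op oU k sb sv.
rewrite -(deriv_opD b s1 s2 UZ).
apply: (deriv_op_ext oU b _ (smoothD oU s1 s2) UZ) => W UW; exact/esym/IH.
Qed.

Lemma flow_kernelD w u v : all_in B w -> smooth_on U u -> smooth_on U v ->
  flow_kernel p w u -> flow_kernel p w v -> flow_kernel p w (fun Z => u Z + v Z).
Proof.
elim: w u v => [|b w IH] u v /=; first by move=> _ _ _ -> ->; rewrite addr0.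
move=> [Bb Bw] su sv Hu Hv k; have sb := sB Bb.
have s1 := smooth_iter_deriv_op oU k sb su; have s2 := smooth_iter_deriv_op oU k sb sv.
apply: (flow_kernel_ext Bw (smoothD oU s1 s2) _ (IH _ _ Bw s1 s2 (Hu k) (Hv k))).
by move=> Z UZ; rewrite (iter_deriv_opD k sb su sv UZ).
Qed.

(** Nested inductions, on the word and on the number of derivatives by its head; the Leibniz rule
    moves each derivative onto one of the factors. *)
Lemma flow_kernelM w a u : all_in B w -> smooth_on U a -> smooth_on U u ->
  flow_kernel p w u -> flow_kernel p w (fun Z => a Z * u Z).
Proof.
elim: w a u => [|b w IH] a u /=; first by move=> _ _ _ ->; rewrite mulr0.
move=> [Bb Bw] sa su Hu k; have sb := sB Bb.
elim: k a u sa su Hu => [|k IHk] a u sa su Hu; first exact: (IH _ _ Bw sa su (Hu 0%N)).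
have sba := smooth_deriv_op oU sb sa; have sbu := smooth_deriv_op oU sb su.
have s1 := smoothM oU sba su; have s2 := smoothM oU sa sbu.
have s12 := smoothD oU s1 s2.
have Hbu i : flow_kernel p w (iter i (deriv_op b) (deriv_op b u)) by rewrite -iterSr.
have K1 := IHk _ _ sba su Hu; have K2 := IHk _ _ sa sbu Hbu.
have t1 := smooth_iter_deriv_op oU k sb s1; have t2 := smooth_iter_deriv_op oU k sb s2.
rewrite iterSr.
apply: (flow_kernel_ext Bw (smoothD oU t1 t2) _ (flow_kernelD Bw t1 t2 K1 K2)) => Z UZ.
rewrite -(iter_deriv_opD k sb s1 s2 UZ).
apply: (iter_ext oU sb k s12 _ UZ) => W UW.
by rewrite (deriv_opM b sa su UW).
Qed.

Lemma flow_kernel_sum w I (s : seq I) (F : I -> 'rV[C]_N -> C) : all_in B w ->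
  (forall i, smooth_on U (F i)) -> (forall i, flow_kernel p w (F i)) ->
  flow_kernel p w (fun Z => \sum_(i <- s) F i Z).
Proof.
move=> Bw sF HF; elim: s => [|i s IH].
  rewrite (_ : (fun Z => _) = fun=> 0); last by apply/funext => Z; rewrite big_nil.
  elim: w {HF} Bw => [|b w IHw] //= [Bb Bw] k.
  suff -> : iter k (deriv_op b) (fun=> 0) = fun=> 0 by exact: IHw.
  by elim: k => [|k IHk] //=; rewrite IHk deriv_op_cst.
rewrite (_ : (fun Z => _) = fun Z => F i Z + \sum_(j <- s) F j Z); last first.
  by apply/funext => Z; rewrite big_cons.
exact: (flow_kernelD Bw (sF i) (smooth_sum oU s (fun j _ => sF j)) (HF i) IH).
Qed.

End FlowKernelIdeal.

Lemma cramer_sum (F : comNzRingType) n (A : 'M[F]_n) (x : 'I_n -> F) l :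
  \sum_i (\adj A) l i * \sum_j A i j * x j = \det A * x l.
Proof.
have : (\adj A *m (A *m (\col_j x j))) l 0 = \det A * x l.
  by rewrite mulmxA mul_adj_mx mul_scalar_mx !mxE.
rewrite mxE => <-; apply: eq_bigr => i _; congr (_ * _); rewrite mxE.
by apply: eq_bigr => j _; rewrite mxE.
Qed.

(** * The reflection argument *)

Section ReflectionIdeal.
Context {R : realType} {N m : nat}.
Notation C := R[i].
Notation L := (bool * 'I_N)%type.
Variables (M U : set 'rV[C]_N) (p : 'rV[C]_N) (h : 'I_m -> 'rV[C]_N -> C).
Hypotheses (oU : open U) (Up : U p) (Mp : M p) (Hh : forall l, hol U (h l)).
Implicit Types (u v a : 'rV[C]_N -> C) (b : L -> 'rV[C]_N -> C) (Z : 'rV[C]_N) (s : seq 'I_N).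

Definition vanish_on u := forall Z, (M `&` U) Z -> u Z = 0.

(** Tangency is recorded by its effect on the ideal of functions vanishing on [M], a form that can
    be iterated and no longer mentions defining functions. *)
Definition tangent_op b := smooth_coefs U b /\
  forall u, smooth_on U u -> vanish_on u -> vanish_on (deriv_op b u).

(* [type_op true] means type (0,1) along [M], [type_op false] type (1,0). *)
Definition type_op e b := forall k, vanish_on (b (e, k)).

Definition conj_dZs s l : 'rV[C]_N -> C := fun Z => (dZs s (h l) Z)^*%C.

(* Reflection through [M]: the holomorphic functions [h l] and their derivatives
   turn out to lie in this ideal. *)
Inductive conj_ideal k : ('rV[C]_N -> C) -> Prop :=
| conj_ideal_vanish u : smooth_on U u -> vanish_on u -> conj_ideal k u
| conj_ideal_conj s l : (size s <= k)%N -> conj_ideal k (conj_dZs s l)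
| conj_ideal_add u v : conj_ideal k u -> conj_ideal k v -> conj_ideal k (fun Z => u Z + v Z)
| conj_ideal_mul a u : smooth_on U a -> conj_ideal k u -> conj_ideal k (fun Z => a Z * u Z).

Lemma smooth_dZs s l : smooth_on U (dZs s (h l)).
Proof. exact: (hol_smooth oU (hol_dZs s oU (Hh l))). Qed.

Lemma smooth_conj_dZs s l : smooth_on U (conj_dZs s l).
Proof. exact: (smoothJ oU (smooth_dZs s l)). Qed.

Lemma conj_ideal_smooth k u : conj_ideal k u -> smooth_on U u.
Proof.
elim=> {u} [u //|s l _|u v _ su _ sv|a u sa _ su].
- exact: smooth_conj_dZs.
- exact: (smoothD oU su sv).
- exact: (smoothM oU sa su).
Qed.

Lemma conj_ideal_mono k k' u : (k <= k')%N -> conj_ideal k u -> conj_ideal k' u.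
Proof.
move=> kk'; elim=> {u} [u su vu|s l sk|u v _ Iu _ Iv|a u sa _ Iu].
- exact: conj_ideal_vanish.
- exact/conj_ideal_conj/(leq_trans sk).
- exact: conj_ideal_add.
- exact: conj_ideal_mul.
Qed.

Lemma conj_ideal_ext k u v : conj_ideal k u -> smooth_on U v ->
  (forall Z, (M `&` U) Z -> u Z = v Z) -> conj_ideal k v.
Proof.
move=> Iu sv E; have su := conj_ideal_smooth Iu.
rewrite (_ : v = fun Z => u Z + (v Z - u Z)); last by apply/funext => Z; rewrite addrC subrK.
apply: (conj_ideal_add Iu); apply: (conj_ideal_vanish _ (smoothB oU sv su)) => Z MZ.
by rewrite E // subrr.
Qed.

Lemma conj_ideal_sum k I (s : seq I) (F : I -> 'rV[C]_N -> C) :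
  (forall i, conj_ideal k (F i)) -> conj_ideal k (fun Z => \sum_(i <- s) F i Z).
Proof.
move=> IF; elim: s => [|i s IH].
  rewrite (_ : (fun Z => _) = fun=> 0); last by apply/funext => Z; rewrite big_nil.
  by apply: conj_ideal_vanish => //; exact: (smooth_cst oU 0).
rewrite (_ : (fun Z => _) = fun Z => F i Z + \sum_(j <- s) F j Z); last first.
  by apply/funext => Z; rewrite big_cons.
exact: conj_ideal_add.
Qed.

Lemma dZ_conj_hol g k Z : hol U g -> U Z -> dZ k (fun Z => (g Z)^*%C) Z = 0.
Proof.
move=> Hg UZ; have := wirtingerJ (true, k) (hol_smooth oU Hg) UZ.
by rewrite /wirtinger /= (hol_dZbar k Hg UZ) conjc0.
Qed.

Lemma dZbar_conj_hol g k Z : hol U g -> U Z ->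
  dZbar k (fun Z => (g Z)^*%C) Z = (dZ k g Z)^*%C.
Proof. by move=> Hg UZ; exact: (wirtingerJ (false, k) (hol_smooth oU Hg) UZ). Qed.

Lemma deriv_op_hol b g Z : hol U g -> U Z ->
  deriv_op b g Z = \sum_k b (true, k) Z * dZ k g Z.
Proof.
move=> Hg UZ; rewrite deriv_opE [X in _ + X]big1 ?addr0 // => k _.
by rewrite (hol_dZbar k Hg UZ) mulr0.
Qed.

Lemma deriv_op_conj_hol b g Z : hol U g -> U Z ->
  deriv_op b (fun Z => (g Z)^*%C) Z = \sum_k b (false, k) Z * (dZ k g Z)^*%C.
Proof.
move=> Hg UZ; rewrite deriv_opE [X in X + _]big1 ?add0r => [|k _].
  by apply: eq_bigr => k _; rewrite (dZbar_conj_hol k Hg UZ).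
by rewrite (dZ_conj_hol k Hg UZ) mulr0.
Qed.

Lemma type_op_hol b g : type_op true b -> hol U g -> vanish_on (deriv_op b g).
Proof.
move=> tb Hg Z MZ; rewrite (deriv_op_hol b Hg MZ.2) big1 // => k _.
by rewrite tb // mul0r.
Qed.

Lemma type_op_conj b g : type_op false b -> hol U g ->
  vanish_on (deriv_op b (fun Z => (g Z)^*%C)).
Proof.
move=> tb Hg Z MZ; rewrite (deriv_op_conj_hol b Hg MZ.2) big1 // => k _.
by rewrite tb // mul0r.
Qed.

(** On a conjugate holomorphic function only the (0,1) part of [b] acts, producing conjugates of
    derivatives of one order more; the other cases are tangency and the Leibniz rule. *)
Lemma conj_ideal_deriv k b u : tangent_op b -> conj_ideal k u -> conj_ideal k.+1 (deriv_op b u).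
Proof.
move=> [sb tb]; elim=> {u} [u su vu|s l sk|u v Iu IHu Iv IHv|a u sa Iu IHu].
- exact: (conj_ideal_vanish _ (smooth_deriv_op oU sb su) (tb _ su vu)).
- have I1 : conj_ideal k.+1 (fun Z => \sum_(j <- index_enum 'I_N) b (false, j) Z * conj_dZs (j :: s) l Z).
    by apply: conj_ideal_sum => j; apply: (conj_ideal_mul (sb _)); exact: conj_ideal_conj.
  apply: (conj_ideal_ext I1 (smooth_deriv_op oU sb (smooth_conj_dZs s l))) => Z [_ UZ].
  by rewrite (deriv_op_conj_hol b (hol_dZs s oU (Hh l)) UZ).
- have su := conj_ideal_smooth Iu; have sv := conj_ideal_smooth Iv.
  apply: (conj_ideal_ext (conj_ideal_add IHu IHv) (smooth_deriv_op oU sb (smoothD oU su sv))).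
  by move=> Z [_ UZ]; rewrite (deriv_opD b su sv UZ).
have su := conj_ideal_smooth Iu.
have I1 := conj_ideal_mul (smooth_deriv_op oU sb sa) (conj_ideal_mono (leqnSn k) Iu).
apply: (conj_ideal_ext (conj_ideal_add I1 (conj_ideal_mul sa IHu))
  (smooth_deriv_op oU sb (smoothM oU sa su))).
by move=> Z [_ UZ]; rewrite (deriv_opM b sa su UZ).
Qed.

(** CR fields annihilate the holomorphic [h l] along [M], so in such a sum they differentiate the
    coefficients alone. One relation thus gives a new one for each word, at the cost of one order
    per letter. *)
Lemma conj_ideal_word k (Q : 'I_m -> 'rV[C]_N -> C) (w : seq (L -> 'rV[C]_N -> C)) :
  (forall l, smooth_on U (Q l)) -> conj_ideal k (fun Z => \sum_l Q l Z * h l Z) ->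
  (forall b, List.In b w -> tangent_op b /\ type_op true b) ->
  (forall l, smooth_on U (foldr deriv_op (Q l) w)) /\
  conj_ideal (k + size w) (fun Z => \sum_l foldr deriv_op (Q l) w Z * h l Z).
Proof.
move=> sQ IQ; elim: w => [|b w IH] Hw /=; first by rewrite addn0.
have [[sb tb] tyb] := Hw b (or_introl (erefl b)).
have {}IH := IH (fun b' Hb' => Hw b' (or_intror Hb')).
move: IH => [sw Iw]; have sbw l := smooth_deriv_op oU sb (sw l).
split=> //; rewrite addnS.
have sh l := hol_smooth oU (Hh l).
apply: (conj_ideal_ext (conj_ideal_deriv (conj sb tb) Iw)).
  exact: (smooth_sum oU (index_enum 'I_m) (fun l _ => smoothM oU (sbw l) (sh l))).
move=> Z MZ.
have main (s : seq 'I_m) : deriv_op b (fun Z => \sum_(l <- s) foldr deriv_op (Q l) w Z * h l Z) Z =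
    \sum_(l <- s) deriv_op b (foldr deriv_op (Q l) w) Z * h l Z.
  elim: s => [|l s IH].
    rewrite big_nil (_ : (fun W => _) = fun=> 0) ?deriv_op_cst //.
    by apply/funext => W; rewrite big_nil.
  rewrite big_cons -IH (_ : (fun W => _) = fun W => foldr deriv_op (Q l) w W * h l W +
    \sum_(l <- s) foldr deriv_op (Q l) w W * h l W); last by apply/funext => W; rewrite big_cons.
  have s1 l := smoothM oU (sw l) (sh l).
  rewrite (deriv_opD b (s1 l) (smooth_sum oU s (fun l _ => s1 l)) MZ.2).
  rewrite (deriv_opM b (sw l) (sh l) MZ.2).
  by rewrite (type_op_hol tyb (Hh l) MZ) mulr0 addr0.
exact: main.
Qed.

Lemma conj_ideal_solve k (Q : 'rV[C]_N -> 'M[C]_m) :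
  (forall i l, smooth_on U (fun Z => Q Z i l)) -> (forall Z, U Z -> \det (Q Z) != 0) ->
  (forall i, conj_ideal k (fun Z => \sum_l Q Z i l * h l Z)) -> forall l, conj_ideal k (h l).
Proof.
move=> sQ dQ IQ l.
have sd := smoothV oU dQ (smooth_det oU sQ).
have I1 : conj_ideal k (fun Z => \sum_(i <- index_enum 'I_m) (\det (Q Z))^-1 *
    ((\adj (Q Z)) l i * \sum_l Q Z i l * h l Z)).
  apply: conj_ideal_sum => i; apply: (conj_ideal_mul sd).
  exact: (conj_ideal_mul (smooth_adj oU l i sQ) (IQ i)).
apply: (conj_ideal_ext I1 (hol_smooth oU (Hh l))) => Z [_ UZ].
by rewrite -mulr_sumr (cramer_sum (Q Z) (h^~ Z)) mulKf ?dQ.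
Qed.

Variables (T : 'I_N -> L -> 'rV[C]_N -> C) (delta : 'rV[C]_N -> C) (k0 : nat).
Hypotheses (tT : forall k, tangent_op (T k)) (sdelta : smooth_on U delta).
Hypotheses (delta0 : forall Z, U Z -> delta Z != 0).
Hypothesis TE : forall k j Z, U Z -> T k (true, j) Z = delta Z * (k == j)%:R.
Hypothesis Ih : forall l, conj_ideal k0 (h l).

(** Being tangent, [T k] may be applied to a relation that holds only on [M]. On holomorphic
    functions it acts as [delta] d/dZ_k, and the unit [delta] is divided out. *)
Lemma conj_ideal_dZs s l : conj_ideal (size s + k0) (dZs s (h l)).
Proof.
elim: s => [|k s IH] /=; first exact: Ih.
have I1 := conj_ideal_mul (smoothV oU delta0 sdelta) (conj_ideal_deriv (tT k) IH).
apply: (conj_ideal_ext I1 (smooth_dZs (k :: s) l)) => Z [_ UZ].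
rewrite (deriv_op_hol _ (hol_dZs s oU (Hh l)) UZ) (bigD1 k) //= big1 ?addr0.
  by rewrite (TE k k UZ) eqxx mulr1 mulKf ?delta0.
by move=> j jk; rewrite (TE k j UZ) eq_sym (negPf jk) mulr0 mul0r.
Qed.

Variable B : set (L -> 'rV[C]_N -> C).
Hypothesis tB : forall b, B b -> tangent_op b.
Hypothesis tyB : forall b, B b -> type_op true b \/ type_op false b.
Hypothesis flat : forall s l, (size s <= (N + N) * k0)%N -> dZs s (h l) p = 0.

Let sB b : B b -> smooth_coefs U b. Proof. by move=> /tB[]. Qed.

Lemma flow_kernel_vanish w u : all_in B w -> smooth_on U u -> vanish_on u -> flow_kernel p w u.
Proof.
elim: w u => [|b w IH] u /=; first by move=> _ _ vu; exact: vu.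
move=> [Bb Bw] su vu k; have sb := sB Bb.
apply: (IH _ Bw (smooth_iter_deriv_op oU k sb su)).
elim: k => [|k IHk] //=.
exact: ((tB Bb).2 _ (smooth_iter_deriv_op oU k sb su) IHk).
Qed.

(** Once X u vanishes on [M], so do all X^k u with k >= 1, and they lie in every kernel. Only the
    constant term of the new series remains, and it is the hypothesis on [w]. *)
Lemma flow_kernel_cons b w u : B b -> all_in B w -> smooth_on U u ->
  flow_kernel p w u -> vanish_on (deriv_op b u) -> flow_kernel p (b :: w) u.
Proof.
move=> Bb Bw su Hu vu [|k] //; rewrite iterSr.
have sbu := smooth_deriv_op oU (sB Bb) su.
apply: (flow_kernel_vanish Bw (smooth_iter_deriv_op oU k (sB Bb) sbu)).
elim: k => [|k IHk]; first exact: vu.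
exact: ((tB Bb).2 _ (smooth_iter_deriv_op oU k (sB Bb) sbu) IHk).
Qed.

Lemma conj_ideal_flow_kernel w k u : all_in B w ->
  (forall s l, (size s <= k)%N -> flow_kernel p w (conj_dZs s l)) ->
  conj_ideal k u -> flow_kernel p w u.
Proof.
move=> Bw Hc; elim=> {u} [u su vu|s l sk|u v Iu IHu Iv IHv|a u sa Iu IHu].
- exact: flow_kernel_vanish.
- exact: Hc.
- exact: (flow_kernelD oU Up sB Bw (conj_ideal_smooth Iu) (conj_ideal_smooth Iv) IHu IHv).
- exact: (flow_kernelM oU Up sB Bw sa (conj_ideal_smooth Iu)).
Qed.

(** Conjugation turns the generators back into holomorphic derivatives and preserves the functions
    vanishing on [M]; this is reflection in the other direction. *)
Lemma conj_ideal_flow_kernel_conj w k u : all_in B w ->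
  (forall s l, (size s <= k)%N -> flow_kernel p w (dZs s (h l))) ->
  conj_ideal k u -> flow_kernel p w (fun Z => (u Z)^*%C).
Proof.
move=> Bw Hc; elim=> {u} [u su vu|s l sk|u v Iu IHu Iv IHv|a u sa Iu IHu].
- apply: (flow_kernel_vanish Bw (smoothJ oU su)) => Z MZ.
  by rewrite vu // conjc0.
- rewrite (_ : (fun Z => _) = dZs s (h l)); first exact: Hc.
  by apply/funext => Z; rewrite /conj_dZs conjcK.
- rewrite (_ : (fun Z => _) = fun Z => (u Z)^*%C + (v Z)^*%C).
    exact: (flow_kernelD oU Up sB Bw (smoothJ oU (conj_ideal_smooth Iu)) (smoothJ oU (conj_ideal_smooth Iv))).
  by apply/funext => Z; rewrite -rmorphD.
rewrite (_ : (fun Z => _) = fun Z => (a Z)^*%C * (u Z)^*%C).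
  exact: (flow_kernelM oU Up sB Bw (smoothJ oU sa) (smoothJ oU (conj_ideal_smooth Iu))).
by apply/funext => Z; rewrite -rmorphM.
Qed.

(** The orders of [s] and of the remaining letters share a budget of [2 N k0], each letter costing
    [k0]. A CR letter keeps the holomorphic derivatives in the kernel, up to order [size s + k0],
    and reflection then adds the conjugates of order [size s]; for an anti-CR letter the two halves
    are exchanged. *)
Lemma flow_kernel_dZs w s l : all_in B w -> (size s + size w * k0 <= (N + N) * k0)%N ->
  flow_kernel p w (dZs s (h l)) /\ flow_kernel p w (conj_dZs s l).
Proof.
elim: w s l => [|b w IH] s l.
  by move=> _; rewrite addn0 => H; rewrite /= /conj_dZs flat // conjc0.
rewrite [size (b :: w)]/= mulSn addnA => -[Bb Bw] H.
have bound s' : (size s' <= size s + k0)%N -> (size s' + size w * k0 <= (N + N) * k0)%N.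
  by move=> s's; apply: leq_trans H; rewrite leq_add2r.
have Bbw : all_in B (b :: w) by [].
have sk : (size s <= size s + k0)%N by exact: leq_addr.
case: (tyB Bb) => ty.
  have K1 s' l' : (size s' <= size s + k0)%N -> flow_kernel p (b :: w) (dZs s' (h l')).
    move=> /bound s's; apply: (flow_kernel_cons Bb Bw (smooth_dZs s' l')).
      exact: (IH s' l' Bw s's).1.
    exact: (type_op_hol ty (hol_dZs s' oU (Hh l'))).
  split; first exact: K1.
  exact: (conj_ideal_flow_kernel_conj Bbw K1 (conj_ideal_dZs s l)).
have K1 s' l' : (size s' <= size s + k0)%N -> flow_kernel p (b :: w) (conj_dZs s' l').
  move=> /bound s's; apply: (flow_kernel_cons Bb Bw (smooth_conj_dZs s' l')).
    exact: (IH s' l' Bw s's).2.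
  exact: (type_op_conj ty (hol_dZs s' oU (Hh l'))).
split; last exact: K1.
exact: (conj_ideal_flow_kernel Bbw K1 (conj_ideal_dZs s l)).
Qed.

Variable Y : 'I_N -> L -> 'rV[C]_N -> C.
Hypothesis sY : forall k, smooth_coefs U (Y k).
Hypothesis Ystable : forall w, all_in B w ->
  (forall b, B b -> forall u, smooth_on U u -> flow_kernel p w u -> flow_kernel p w (deriv_op b u)) ->
  forall k u, smooth_on U u -> flow_kernel p w u -> flow_kernel p w (deriv_op (Y k) u).
Hypothesis Ydet : forall Z, U Z -> \det (\matrix_(k, j) Y k (true, j) Z) != 0.

Theorem reflection_flat s l : dZs s (h l) p = 0.
Proof.
have [w [Bw sw stable]] := flow_kernel_stabilizes oU Up sB.
apply: (flow_kernel_value (w := w)).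
have {}stable := Ystable Bw stable.
elim: s => [|j s IH] /=.
  have H : (size ([::] : seq 'I_N) + size w * k0 <= (N + N) * k0)%N.
    by rewrite add0n leq_mul2r sw orbT.
  exact: (flow_kernel_dZs l Bw H).1.
set g := dZs s (h l) in IH *.
have Hg : hol U g by exact: hol_dZs.
have sg := hol_smooth oU Hg.
pose A Z := \matrix_(k < N, j < N) Y k (true, j) Z.
have sA k i : smooth_on U (fun Z => A Z k i).
  have -> : (fun Z => A Z k i) = Y k (true, i) by apply/funext => Z; rewrite mxE.
  exact: sY.
have sd := smoothV oU Ydet (smooth_det oU sA).
(* Cramer's rule recovers d/dZ_j on holomorphic functions from the fields [Y k], whose (1,0) parts
   form an invertible matrix. Variable coefficients are allowed as the kernel is an ideal. *)
pose F k Z := (\det (A Z))^-1 * ((\adj (A Z)) j k * deriv_op (Y k) g Z).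
have sYg k := smooth_deriv_op oU (sY k) sg.
have s1 k := smoothM oU (smooth_adj oU j k sA) (sYg k).
have sF k : smooth_on U (F k) by exact: (smoothM oU sd (s1 k)).
have HF k : flow_kernel p w (F k).
  apply: (flow_kernelM oU Up sB Bw sd (s1 k)).
  exact: (flow_kernelM oU Up sB Bw (smooth_adj oU j k sA) (sYg k) (stable k g sg IH)).
have sS := smooth_sum oU (index_enum 'I_N) (P := xpredT) (fun k _ => sF k).
apply: (flow_kernel_ext oU Up sB Bw sS _ (flow_kernel_sum oU Up sB (index_enum 'I_N) Bw sF HF)).
move=> Z UZ; rewrite /F -mulr_sumr.
have -> : \sum_k (\adj (A Z)) j k * deriv_op (Y k) g Z =
    \sum_k (\adj (A Z)) j k * \sum_i A Z k i * dZ i g Z.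
  apply: eq_bigr => k _; congr (_ * _); rewrite (deriv_op_hol _ Hg UZ).
  by apply: eq_bigr => i _; congr (_ * _); rewrite mxE.
by rewrite (cramer_sum (A Z) (fun i => dZ i g Z)) mulKf ?Ydet.
Qed.

End ReflectionIdeal.

(** * Lifts, nondegeneracy and finite type *)

Section TangentFields.
Context {R : realType} {N : nat}.
Notation C := R[i].
Notation L := (bool * 'I_N)%type.
Implicit Types (M U V : set 'rV[C]_N) (X Y : cfield R N) (u f : 'rV[C]_N -> C) (Z p : 'rV[C]_N).

Lemma open_neq0 U f : open U -> smooth_on U f -> open (U `&` [set Z | f Z != 0]).
Proof.
move=> oU sf; rewrite openE => Z [UZ fZ]; apply: filterI; first exact: open_nbhs_nbhs.
have /cont_rVP/(_ _ (cn_gt0 fZ))[d d0 dP] := smooth_cont sf UZ.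
apply/nbhs_rVP; exists d => // W /dP; apply: contraTneq => ->.
by rewrite sub0r cnN ltxx.
Qed.

Lemma field_tangent_op d M U V X : open U -> U `<=` V -> smooth_field V X ->
  (forall Z, (M `&` V) Z -> ctangent d M Z (X Z)) -> tangent_op M U (field_coefs X).
Proof.
move=> oU UV sX tX; split; first exact: smooth_field_coefs UV sX.
move=> u su vu Z [MZ UZ]; rewrite deriv_op_vector_apply.
exact: (tangent_vanishing oU UZ MZ su vu (tX Z (conj MZ (UV _ UZ)))).
Qed.

Lemma CR_commutator_smooth d M V X : open V -> CR_commutator d M V X -> smooth_field V X.
Proof.
move=> oV; elim=> {X} [X [] //|X [] //|X Y _ sX _ sY].
exact: smooth_field_bracket.
Qed.

Lemma smooth_field_sub U V X : U `<=` V -> smooth_field V X -> smooth_field U X.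
Proof.
by move=> UV sX k; have [s1 s2] := sX k; split; [exact: smooth_sub UV s1|exact: smooth_sub UV s2].
Qed.

Lemma CR_commutator_stable d M U V p X (B : set (L -> 'rV[C]_N -> C)) w :
  open U -> U p -> open V -> U `<=` V ->
  (forall b, B b -> smooth_coefs U b) ->
  (forall Y, CR_field d M V Y \/ antiCR_field d M V Y -> B (field_coefs Y)) ->
  all_in B w ->
  (forall b, B b -> forall u, smooth_on U u -> flow_kernel p w u -> flow_kernel p w (deriv_op b u)) ->
  CR_commutator d M V X -> forall u, smooth_on U u -> flow_kernel p w u ->
  flow_kernel p w (deriv_op (field_coefs X) u).
Proof.
move=> oU Up oV UV sB BX Bw stable; elim=> {X} [X CX|X CX|X Y CX IHX CY IHY] u su Hu.
- by apply: stable => //; apply: BX; left.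
- by apply: stable => //; apply: BX; right.
have sX := smooth_field_sub UV (CR_commutator_smooth oV CX).
have sY := smooth_field_sub UV (CR_commutator_smooth oV CY).
have bX := smooth_field_coefs (@subset_refl _ U) sX.
have bY := smooth_field_coefs (@subset_refl _ U) sY.
have s1 := smooth_deriv_op oU bY su; have s2 := smooth_deriv_op oU bX su.
have s3 := smooth_deriv_op oU bX s1; have s4 := smooth_deriv_op oU bY s2.
have sc := smooth_cst oU (-1).
have K1 := IHX _ s1 (IHY _ su Hu); have K2 := IHY _ s2 (IHX _ su Hu).
have K := flow_kernelD oU Up sB Bw s3 (smoothM oU sc s4) K1 (flow_kernelM oU Up sB Bw sc s4 K2).
apply: (flow_kernel_ext oU Up sB Bw (smoothD oU s3 (smoothM oU sc s4)) _ K) => Z UZ.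
by rewrite (deriv_op_bracket oU sX sY su UZ) mulN1r.
Qed.

(* With [A] the matrix of the gradients of the defining functions and [A W]
   invertible, [delta = conj (det (A W))] and the (0,1) part of the [k]-th
   field is [- conj (W adj (A W)) A_k]. *)
Lemma tangent_lifts d M U (rho : 'I_d -> 'rV[C]_N -> R) p :
  open_nbhs p U -> M p -> defining_functions M U rho ->
  exists V (delta : 'rV[C]_N -> C) (T : 'I_N -> cfield R N),
    [/\ open_nbhs p V, smooth_on V delta, (forall Z, V Z -> delta Z != 0),
      (forall k, smooth_field V (T k)) &
      (forall k Z, V Z -> (T k Z).1 = delta Z *: delta_mx 0 k) /\
      (forall k Z, (M `&` V) Z -> ctangent d M Z (T k Z))].
Proof.
move=> [oU Up] Mp def; have [srho ME wedge] := def.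
have [W] := wedge p (conj Mp Up); rewrite /gradient_wedge.
pose A Z := \matrix_(j < d) complex_gradient (rho j) Z; rewrite -/(A p) => detp.
have AE Z j k : A Z j k = dZ k (fun W => (rho j W)%:C%C) Z by rewrite !mxE.
have sA j k : smooth_on U (fun Z => A Z j k).
  have -> : (fun Z => A Z j k) = dZ k (fun W => (rho j W)%:C%C) by apply/funext => Z; exact: AE.
  exact: (smooth_dZ oU k (srho j)).
have sAW i j : smooth_on U (fun Z => (A Z *m W) i j).
  have -> : (fun Z => (A Z *m W) i j) = fun Z => \sum_k A Z i k * W k j.
    by apply/funext => Z; rewrite mxE.
  by apply: (smooth_sum oU) => k _; exact: (smoothM oU (sA i k) (smooth_cst oU _)).
have sdet := smooth_det oU sAW.
have oV := open_neq0 oU sdet.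
pose V := U `&` [set Z | \det (A Z *m W) != 0].
have VU : V `<=` U by move=> Z [].
pose delta Z := (\det (A Z *m W))^*%C.
have sdelta : smooth_on V delta by exact: smooth_sub VU (smoothJ oU sdet).
pose S Z m i := \sum_j W m j * (\adj (A Z *m W)) j i.
have sS m i : smooth_on U (fun Z => S Z m i).
  apply: (smooth_sum oU) => j _; exact: (smoothM oU (smooth_cst oU _) (smooth_adj oU j i sAW)).
have AS Z j i : \sum_m A Z j m * S Z m i = \det (A Z *m W) * (j == i)%:R.
  have E : ((A Z *m W) *m \adj (A Z *m W)) j i = \det (A Z *m W) * (j == i)%:R.
    by rewrite mul_mx_adj mxE mulr_natr.
  rewrite -E -mulmxA mxE; apply: eq_bigr => m _; congr (_ * _).
  by rewrite mxE.
pose T k : cfield R N := fun Z =>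
  (delta Z *: delta_mx 0 k, \row_m - \sum_i (S Z m i)^*%C * A Z i k).
exists V, delta, T; split; [by split|exact: sdelta| | |].
- by move=> Z [_ /= dZ0]; rewrite /delta conjc_eq0.
- move=> k m; split.
    have -> : (fun Z => (T k Z).1 0 m) = fun Z => delta Z * (delta_mx 0 k : 'rV[C]_N) 0 m.
      by apply/funext => Z; rewrite /T /= mxE.
    exact: (smoothM oV sdelta (smooth_cst oV _)).
  have -> : (fun Z => (T k Z).2 0 m) = fun Z => - \sum_i (S Z m i)^*%C * A Z i k.
    by apply/funext => Z; rewrite /T /= mxE.
  apply: (smooth_sub VU); apply: (smoothN oU); apply: (smooth_sum oU) => i _.
  exact: (smoothM oU (smoothJ oU (sS m i)) (sA i k)).
split=> // k Z [MZ [UZ dZ0]]; exists U, rho; split=> // j.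
rewrite /vector_apply big_split /= (bigD1 k) //= big1 ?addr0; last first.
  by move=> i ik; rewrite !mxE /= (negPf ik) mulr0 mul0r.
rewrite !mxE !eqxx mulr1 -AE.
(* By [AS] the (0,1) part contributes -conj(det (A W)) A_jk, which cancels the term [delta] A_jk of
   the (1,0) part. *)
have -> : \sum_i (\row_m - (\sum_i0 (S Z m i0)^*%C * A Z i0 k)) 0 i *
    dZbar i (fun W => (rho j W)%:C%C) Z = - (\sum_i (\sum_m A Z j m * S Z m i)^*%C * A Z i k).
  transitivity (\sum_m - (\sum_i (S Z m i)^*%C * A Z i k) * (A Z j m)^*%C).
    apply: eq_bigr => m _; rewrite (dZbar_real m oU (srho j) UZ) -AE; congr (_ * _).
    by rewrite mxE.
  under eq_bigr do rewrite mulNr mulr_suml.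
  rewrite sumrN exchange_big /=; congr (- _); apply: eq_bigr => i _.
  rewrite rmorph_sum mulr_suml; apply: eq_bigr => m _.
  by rewrite rmorphM /= mulrC mulrA.
rewrite (bigD1 j) //= AS eqxx mulr1 big1 ?addr0 ?subrr // => i ij.
by rewrite AS eq_sym (negPf ij) mulr0 conjc0 mul0r.
Qed.

End TangentFields.

Section Words.
Context {R : realType} {N : nat}.
Notation C := R[i].
Notation L := (bool * 'I_N)%type.
Implicit Types (f g : 'rV[C]_N -> C) (p : 'rV[C]_N) (U : set 'rV[C]_N).

(** The operator L^a spelled out letter by letter, so that the inductions on words apply to it. *)
Definition field_word n (X : 'I_n -> cfield R N) (a : 'I_n -> nat) : seq (L -> 'rV[C]_N -> C) :=
  flatten [seq nseq (a i) (field_coefs (X i)) | i <- enum 'I_n].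

Lemma multi_iter_word n (X : 'I_n -> cfield R N) a f :
  multi_iter (fun i => field_apply (X i)) a f = foldr deriv_op f (field_word X a).
Proof.
rewrite /multi_iter /field_word; elim: (enum 'I_n) => [|i e IH] //=.
rewrite foldr_cat -IH; elim: (a i) => [|k IHk] //=.
by rewrite IHk field_applyE.
Qed.

Lemma size_field_word n (X : 'I_n -> cfield R N) a :
  size (field_word X a) = (\sum_i a i)%N.
Proof.
rewrite /field_word size_flatten /shape -map_comp sumnE big_map big_enum /=.
by apply: eq_bigr => i _; rewrite size_nseq.
Qed.

Lemma In_field_word n (X : 'I_n -> cfield R N) a b :
  List.In b (field_word X a) -> exists i, b = field_coefs (X i).
Proof.
rewrite /field_word; elim: (enum 'I_n) => [|i e IH] //=.
by elim: (a i) => [|k IHk] //= [<-|]; [exists i|exact: IHk].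
Qed.

Lemma jet_eq_word U p k f g (w : seq (L -> 'rV[C]_N -> C)) : open U -> U p ->
  (forall b, List.In b w -> smooth_coefs U b) -> smooth_on U f -> smooth_on U g ->
  jet_eq p (size w + k) f g ->
  [/\ smooth_on U (foldr deriv_op f w), smooth_on U (foldr deriv_op g w) &
      jet_eq p k (foldr deriv_op f w) (foldr deriv_op g w)].
Proof.
move=> oU Up; elim: w k => [|b w IH] k sw sf sg J; first by split.
have sb := sw b (or_introl erefl).
have := IH k.+1 (fun b' Hb => sw b' (or_intror Hb)) sf sg; rewrite addnS => /(_ J)[s1 s2 J'].
split=> /=; [exact: smooth_deriv_op|exact: smooth_deriv_op|].
exact: (jet_eq_deriv_op oU Up sb s1 s2 J').
Qed.

End Words.

(** * The linear system provided by nondegeneracy *)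

Section JetCombinations.
Context {R : realType} {N m d' : nat}.
Notation C := R[i].
Notation L := (bool * 'I_N)%type.
Variables (M U : set 'rV[C]_N) (p : 'rV[C]_N) (M' V : set 'rV[C]_m).
Variables (rho : 'I_d' -> 'rV[C]_m -> R) (q : 'rV[C]_m) (r : R) (H H' : 'rV[C]_N -> 'rV[C]_m).
Hypotheses (oU : open U) (Up : U p) (oV : open V).
Hypothesis srho : forall j, smooth_on V (fun y => (rho j y)%:C%C).
Hypothesis rho0 : forall j y, (M' `&` V) y -> rho j y = 0.
Hypothesis ballV : forall y, rn (y - q) < r -> V y.
Hypotheses (Hball : forall Z, U Z -> rn (H Z - q) < r) (H'ball : forall Z, U Z -> rn (H' Z - q) < r).
Hypothesis HH : forall l, hol U (fun Z => H Z 0 l).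
Hypothesis HH' : forall l, hol U (fun Z => H' Z 0 l).
Hypotheses (HM : forall Z, (M `&` U) Z -> M' (H Z)) (HM' : forall Z, (M `&` U) Z -> M' (H' Z)).
Variables (A : finType) (P : pred A) (w : A -> seq (L -> 'rV[C]_N -> C)) (k0 : nat).
Hypothesis size_w : forall a, P a -> (size (w a) <= k0)%N.
Hypothesis opsw : forall a b, List.In b (w a) -> tangent_op M U b /\ type_op M U true b.

(** The coefficients [c] are constants, chosen at [p] to produce a unit vector there. Away from [p]
    the combination is just a smooth row of coefficients of a relation for [h], which is enough for
    invertibility nearby. *)
Definition jet_comb (c : A -> 'I_d' -> C) l Z : C :=
  \sum_(a | P a) \sum_j c a j * foldr deriv_op (hadamard_coef (rho j) H H' l) (w a) Z.

Let h l Z := H Z 0 l - H' Z 0 l.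
Let sH l := hol_smooth oU (HH l).
Let sH' l := hol_smooth oU (HH' l).
Let coef j l := hadamard_coef (rho j) H H' l.
Let scoef j l := smooth_hadamard_coef oU oV (srho j) ballV Hball H'ball sH sH' l.
Let Hh l : hol U (h l) := holB oU (HH l) (HH' l).

(** The starting relation: on [M] both maps take values in [M'], so the left side of Hadamard's
    formula vanishes, and the half linear in [h] is minus the half linear in its conjugates, without
    derivatives. *)
Let conj_ideal_coef j : conj_ideal M U h 0 (fun Z => \sum_l coef j l Z * h l Z).
Proof.
have sh l := hol_smooth oU (Hh l).
have E Z : U Z -> \sum_l coef j l Z * h l Z =
    ((rho j (H Z))%:C%C - (rho j (H' Z))%:C%C) + \sum_l - (coef j l Z)^*%C * conj_dZs h [::] l Z.
  move=> UZ; rewrite (hadamard_formula oU oV (srho j) ballV Hball H'ball sH sH' UZ) -big_split /=.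
  apply: eq_bigr => l _; rewrite /conj_dZs /= -/(h l Z) -/(coef j l Z).
  by rewrite mulNr addrK.
have sE : smooth_on U (fun Z => \sum_l coef j l Z * h l Z).
  by apply: (smooth_sum oU) => l _; exact: (smoothM oU (scoef j l) (sh l)).
have VH Z : U Z -> V (H Z) by move=> /Hball/ballV.
have VH' Z : U Z -> V (H' Z) by move=> /H'ball/ballV.
have s1 := smoothB oU (smooth_comp oU oV VH sH (srho j)) (smooth_comp oU oV VH' sH' (srho j)).
have I1 : conj_ideal M U h 0 (fun Z => (rho j (H Z))%:C%C - (rho j (H' Z))%:C%C).
  apply: (conj_ideal_vanish _ _ s1) => Z [MZ UZ].
  by rewrite !rho0 ?subrr //; split; [exact: HM'|exact: VH'|exact: HM|exact: VH].
have I2 : conj_ideal M U h 0 (fun Z => \sum_l - (coef j l Z)^*%C * conj_dZs h [::] l Z).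
  apply: (conj_ideal_sum oU) => l.
  have Ic : conj_ideal M U h 0 (conj_dZs h [::] l) by exact: conj_ideal_conj.
  exact: (conj_ideal_mul (smoothN oU (smoothJ oU (scoef j l))) Ic).
apply: (conj_ideal_ext oU Hh (conj_ideal_add I1 I2) sE) => Z [_ UZ].
by rewrite E.
Qed.

Let word a j := conj_ideal_word oU Hh (fun l => scoef j l) (conj_ideal_coef j) (@opsw a).

Lemma smooth_jet_comb c l : smooth_on U (jet_comb c l).
Proof.
apply: (smooth_sum oU) => a _; apply: (smooth_sum oU) => j _.
exact: (smoothM oU (smooth_cst oU _) ((word a j).1 l)).
Qed.

Lemma conj_ideal_jet_comb c : conj_ideal M U h k0 (fun Z => \sum_l jet_comb c l Z * h l Z).
Proof.
have sh l := hol_smooth oU (Hh l).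
have sw a j l := (word a j).1 l.
have I1 : conj_ideal M U h k0 (fun Z => \sum_(a <- index_enum A) \sum_(j <- index_enum 'I_d')
    (if P a then c a j else 0) * \sum_l foldr deriv_op (coef j l) (w a) Z * h l Z).
  apply: (conj_ideal_sum oU) => a; apply: (conj_ideal_sum oU) => j.
  case: ifP => Pa; last first.
    apply: conj_ideal_vanish => [|Z _]; last by rewrite mul0r.
    apply: (smoothM oU (smooth_cst oU 0)); apply: (smooth_sum oU) => l _.
    exact: (smoothM oU (sw a j l) (sh l)).
  apply: (conj_ideal_mul (smooth_cst oU _)).
  exact: (conj_ideal_mono (size_w Pa) (word a j).2).
apply: (conj_ideal_ext oU Hh I1).
  by apply: (smooth_sum oU) => l _; exact: (smoothM oU (smooth_jet_comb c l) (sh l)).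
move=> Z _; rewrite /jet_comb; under [RHS]eq_bigr do rewrite mulr_suml.
rewrite [RHS]exchange_big /= [RHS]big_mkcond; apply: eq_bigr => a _.
case: ifP => Pa; last by rewrite big1 // => j _; rewrite mul0r.
under [RHS]eq_bigr do rewrite mulr_suml.
rewrite [RHS]exchange_big /=; apply: eq_bigr => j _; rewrite mulr_sumr.
by apply: eq_bigr => l _; rewrite mulrA.
Qed.

Lemma jet_comb_value c l :
  (forall j, jet_eq p k0 (fun Z => H Z 0 j) (fun Z => H' Z 0 j)) ->
  jet_comb c l p = \sum_(a | P a) \sum_j c a j *
    foldr deriv_op (fun Z => dZ l (fun y => (rho j y)%:C%C) (H Z)) (w a) p.
Proof.
move=> J; apply: eq_bigr => a Pa; apply: eq_bigr => j _; congr (_ * _).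
have VH Z : U Z -> V (H Z) by move=> /Hball/ballV.
have J1 := jet_eq_hadamard_coef oU oV (srho j) ballV Hball H'ball sH sH' l Up J.
rewrite -(subnKC (size_w Pa)) in J1.
have sw b : List.In b (w a) -> smooth_coefs U b by move=> /opsw[[]].
have s2 := smooth_comp oU oV VH sH (smooth_dZ oV l (srho j)).
by have [_ _ /jet_eq_value] := jet_eq_word oU Up sw (scoef j l) s2 J1.
Qed.

End JetCombinations.

Lemma open_rn_ball (R : realType) n (q : 'rV[R[i]]_n) (r : R) : open [set y | rn (y - q) < r].
Proof.
rewrite openE => y /= yq; apply/nbhs_rVP; exists (r - rn (y - q)); first by rewrite subr_gt0.
move=> z zy; rewrite /= -(subrK y z) -addrA; apply: le_lt_trans (rnD _ _) _.
by rewrite -ltrBrDr.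
Qed.

(** If the jets of the gradients span everything, the i-th unit vector is one of their combinations;
    these will be the rows of a matrix equal to the identity at [p]. *)
Lemma nondegeneracy_combination (R : realType) (N N' n d' : nat) (L : 'I_n -> cfield R N)
    (rho' : 'I_d' -> 'rV[R[i]]_N' -> R) (H : 'rV[R[i]]_N -> 'rV[R[i]]_N') p k i :
  nondegeneracy_space L rho' H p k = fullv ->
  exists c : {ffun 'I_n -> 'I_k.+1} -> 'I_d' -> R[i], forall l,
    \sum_(a : {ffun 'I_n -> 'I_k.+1} | (\sum_i a i <= k)%N) \sum_j c a j *
      foldr deriv_op (fun Z => dZ l (fun y => (rho' j y)%:C%C) (H Z)) (field_word L (fun i => a i)) p
    = (i == l)%:R.
Proof.
move=> full.
have : (delta_mx 0 i : 'rV[R[i]]_N') \in nondegeneracy_space L rho' H p k by rewrite full memvf.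
move=> /memv_sumP[v vP vE].
have : forall a : {ffun 'I_n -> 'I_k.+1}, exists c : 'I_d' -> R[i], (\sum_i a i <= k)%N ->
    v a = \sum_j c j *: gradient_jet L (rho' j) H p (fun i => nat_of_ord (a i)).
  move=> a; case: (boolP (\sum_i a i <= k)%N) => Pa; last by exists (fun=> 0).
  have /memv_sumP[u uP ->] := vP a Pa.
  have : forall j : 'I_d', exists c : R[i],
      u j = c *: gradient_jet L (rho' j) H p (fun i => nat_of_ord (a i)).
    by move=> j; have /vlineP := uP j isT.
  by move=> /choice[c cP]; exists c => _; apply: eq_bigr => j _.
move=> /choice[c cP]; exists c => l.
transitivity ((delta_mx 0 i : 'rV[R[i]]_N') 0 l); last by rewrite mxE eqxx eq_sym.
rewrite vE summxE; apply: eq_bigr => a Pa; rewrite cP // summxE; apply: eq_bigr => j _.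
rewrite mxE; congr (_ * _); rewrite /gradient_jet mxE multi_iter_word.
by congr (foldr _ _ _ _); apply/funext => Z; rewrite /complex_gradient mxE.
Qed.

(** The decomposition of [v] holds at [p] only; keeping its coefficients constant extends it to a
    field built from commutators, which therefore preserves every kernel stable under CR and anti-CR
    fields. The neighbourhood [U] is quantified inside because it is chosen only after [Y]. *)
Lemma finite_type_combination (R : realType) (N d : nat) (M V : set 'rV[R[i]]_N) p v m
    (X : 'I_m -> cfield R N) (c : 'I_m -> R[i]) :
  open V -> (forall i, CR_commutator d M V (X i)) -> v = \sum_i c i *: X i p ->
  exists Y : bool * 'I_N -> 'rV[R[i]]_N -> R[i],
    [/\ smooth_coefs V Y, (forall j, Y (true, j) p = v.1 0 j) &
    forall U (B : set (bool * 'I_N -> 'rV[R[i]]_N -> R[i])) w,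
      open U -> U p -> U `<=` V -> (forall b, B b -> smooth_coefs U b) ->
      (forall X, CR_field d M V X \/ antiCR_field d M V X -> B (field_coefs X)) ->
      all_in B w ->
      (forall b, B b -> forall u, smooth_on U u -> flow_kernel p w u ->
         flow_kernel p w (deriv_op b u)) ->
      forall u, smooth_on U u -> flow_kernel p w u -> flow_kernel p w (deriv_op Y u)].
Proof.
move=> oV CX vE; have sX i := CR_commutator_smooth oV (CX i).
have sV i := smooth_field_coefs (@subset_refl _ V) (sX i).
exists (fun l Z => \sum_i c i * field_coefs (X i) l Z); split.
- by move=> l; apply: (smooth_sum oV) => i _; exact: (smoothM oV (smooth_cst oV _) (sV i l)).
- move=> j; rewrite vE.
  have -> : (\sum_i c i *: X i p).1 = \sum_i c i *: (X i p).1.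
    by elim/big_rec2: _ => // i x y _ <-.
  by rewrite summxE; apply: eq_bigr => i _; rewrite mxE.
move=> U B w oU Up UV sB BX Bw stable u su Hu.
have sU i := smooth_field_coefs UV (sX i).
have sc i := smooth_cst oU (c i); have sXu i := smooth_deriv_op oU (sU i) su.
have K i := flow_kernelM oU Up sB Bw (sc i) (sXu i)
  (CR_commutator_stable oU Up oV UV sB BX Bw stable (CX i) su Hu).
have := flow_kernel_sum oU Up sB (index_enum 'I_m) Bw (fun i => smoothM oU (sc i) (sXu i)) K.
congr (flow_kernel _ _ _); apply/funext => Z; rewrite /deriv_op.
under [RHS]eq_bigr do rewrite mulr_suml.
rewrite [RHS]exchange_big /=; apply: eq_bigr => i _; rewrite mulr_sumr.
by apply: eq_bigr => l _; rewrite mulrA.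
Qed.

(** * Assembly in a neighbourhood of [p0] *)

Unset Implicit Arguments.
Set Strict Implicit.
Set Printing Implicit Defensive.

Theorem theorem3 (R : realType) (N N' d d' : nat)
    (M : set 'rV[R[i]]_N) (M' : set 'rV[R[i]]_N') (p0 : 'rV[R[i]]_N)
    (M_generic : generic_submanifold d M) (M_connected : connected M)
    (M'_generic : generic_submanifold d' M') (M'_connected : connected M')
    (Mp0 : M p0) (M_finite_type : finite_type d M p0) :
  exists K : nat,
    forall (k0 : nat) (U : set 'rV[R[i]]_N) (H : 'rV[R[i]]_N -> 'rV[R[i]]_N')
      (U' : set 'rV[R[i]]_N) (H' : 'rV[R[i]]_N -> 'rV[R[i]]_N'),
    open_nbhs p0 U -> holomorphic_on U H -> H @` (U `&` M) `<=` M' ->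
    map_nondegenerate d d' M M' H p0 k0 ->
    open_nbhs p0 U' -> holomorphic_on U' H' -> H' @` (U' `&` M) `<=` M' ->
    (forall a : 'I_N -> nat, (\sum_i a i <= K * k0)%N ->
       partial_derivative a H p0 = partial_derivative a H' p0) ->
    \forall Z \near p0, H Z = H' Z.
Proof.
(* The reflection spends [2 N] times [k0]. The successor ensures that [k0] itself is within the
   bound, even for [N = 0], as the Hadamard coefficients require. *)
exists (N + N).+1 => k0 U H U' H' [oU Up] HH HM.
move=> [V [L [V' [rho' [[oV Vp] [LCR _] [oV' V'p] [srho' M'E _] [_ Efull _]]]]]].
move=> [oU' U'p] HH' HM' jets.
have [V0 [oV0 V0p] FT] := M_finite_type.
have [U1 [rho1 [on1 def1]]] := M_generic p0 Mp0.
have [V1 [delta [T [[oV1 V1p] sdelta delta0 sT [T1 tT]]]]] := tangent_lifts on1 Mp0 def1.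
have /choice[Y YP] : forall k : 'I_N, exists Y : bool * 'I_N -> 'rV[R[i]]_N -> R[i],
    [/\ smooth_coefs V0 Y, (forall j, Y (true, j) p0 = (T k p0).1 0 j) &
    forall U (B : set (bool * 'I_N -> 'rV[R[i]]_N -> R[i])) w,
      open U -> U p0 -> U `<=` V0 -> (forall b, B b -> smooth_coefs U b) ->
      (forall X, CR_field d M V0 X \/ antiCR_field d M V0 X -> B (field_coefs X)) ->
      all_in B w ->
      (forall b, B b -> forall u, smooth_on U u -> flow_kernel p0 w u ->
         flow_kernel p0 w (deriv_op b u)) ->
      forall u, smooth_on U u -> flow_kernel p0 w u -> flow_kernel p0 w (deriv_op Y u)].
  (* Finite type is applied to the value at [p0] of the tangent lift of d/dZ_k, so that the (1,0)
     parts of the [Y k] are there multiples of the unit vectors by [delta p0]. *)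
  move=> k; have [m [X [c [CX vE]]]] := FT _ (tT k p0 (conj Mp0 V1p)).
  exact: finite_type_combination oV0 CX vE.
pose U2 := (U `&` U') `&` V `&` V0 `&` V1.
have oU2 : open U2 by do 4?apply: openI.
have U2p : U2 p0 by [].
have U2U : U2 `<=` U by move=> Z [[[[]]]].
have U2U' : U2 `<=` U' by move=> Z [[[[]]]].
have hol2 l : hol U2 (fun Z => H Z 0 l) by move=> Z UZ; exact: (holomorphic_on_hol l HH (U2U Z UZ)).
have hol2' l : hol U2 (fun Z => H' Z 0 l) by move=> Z UZ; exact: (holomorphic_on_hol l HH' (U2U' Z UZ)).
have HH2 : holomorphic_on U2 H by move=> Z UZ; exact: HH (U2U Z UZ).
have HH2' : holomorphic_on U2 H' by move=> Z UZ; exact: HH' (U2U' Z UZ).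
have jet s l : (size s <= (N + N).+1 * k0)%N ->
    dZs s (fun Z => H Z 0 l) p0 = dZs s (fun Z => H' Z 0 l) p0.
  by move=> sk; exact: (jets_agree l oU2 U2p HH2 HH2' jets sk).
pose q := H p0; have qE : H' p0 = q by apply/rowP => l; have := jet [::] l isT.
have /nbhs_rVP[r r0 ballV] := open_nbhs_nbhs (conj oV' V'p).
(* Since [H' p0 = H p0], both maps can be confined to one ball inside [V']; Hadamard's lemma uses
   its convexity. *)
pose G := [set y | rn (y - q) < r]; have oG : open G by exact: open_rn_ball.
have oA1 := open_smooth_preimage oU2 oG (fun l => hol_smooth oU2 (hol2 l)).
pose A1 := U2 `&` [set Z | G (H Z)].
have A1U2 : A1 `<=` U2 by move=> Z [].
have oA := open_smooth_preimage oA1 oG (fun l => smooth_sub A1U2 (hol_smooth oU2 (hol2' l))).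
pose A := A1 `&` [set Z | G (H' Z)].
have Ap : A p0 by split; [split=> //|]; rewrite /= /G /= ?qE subrr rn0.
have AU2 : A `<=` U2 by move=> Z [[]].
pose P (a : {ffun 'I_(N - d) -> 'I_k0.+1}) := (\sum_i a i <= k0)%N.
pose w (a : {ffun 'I_(N - d) -> 'I_k0.+1}) := field_word L (fun i => a i).
have /choice[c cP] : forall i : 'I_N', exists c : {ffun 'I_(N - d) -> 'I_k0.+1} -> 'I_d' -> R[i],
    forall l, \sum_(a | P a) \sum_j c a j *
      foldr deriv_op (fun Z => dZ l (fun y => (rho' j y)%:C%C) (H Z)) (w a) p0 = (i == l)%:R.
  by move=> i; exact: nondegeneracy_combination Efull.
pose Q Z := \matrix_(i, l) jet_comb rho' H H' P w (c i) l Z.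
have size_w a : P a -> (size (w a) <= k0)%N by rewrite /w size_field_word.
(* Stated for every open [W] inside [A]: the relations are used on [A] to form [Q], and again on the
   smaller set where the determinant of [Q] is nonzero. *)
have ops W : open W -> W `<=` A -> forall a b, List.In b (w a) ->
    tangent_op M W b /\ type_op M W true b.
  move=> oW WA a b /In_field_word[i ->]; have [sL tL] := LCR i.
  have WV : W `<=` V by move=> Z /WA/AU2[[[]]].
  split; first by apply: (field_tangent_op (d := d) oW WV sL) => Z MZ; exact: (tL Z MZ).1.
  by move=> k Z [MZ /WV VZ]; rewrite /field_coefs /= (tL Z (conj MZ VZ)).2 mxE.
have rho0 j y : (M' `&` V') y -> rho' j y = 0 by rewrite M'E => -[].
have inG W Z : W `<=` A -> W Z -> rn (H Z - q) < r by move=> WA /WA[[]].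
have inG' W Z : W `<=` A -> W Z -> rn (H' Z - q) < r by move=> WA /WA[].
have holW W l : W `<=` A -> hol W (fun Z => H Z 0 l) by move=> WA Z /WA/AU2; exact: hol2.
have holW' W l : W `<=` A -> hol W (fun Z => H' Z 0 l) by move=> WA Z /WA/AU2; exact: hol2'.
have HMW W Z : W `<=` A -> (M `&` W) Z -> M' (H Z).
  by move=> WA [MZ /WA/AU2/U2U UZ]; apply: HM; exists Z.
have HMW' W Z : W `<=` A -> (M `&` W) Z -> M' (H' Z).
  by move=> WA [MZ /WA/AU2/U2U' UZ]; apply: HM'; exists Z.
have J j : jet_eq p0 k0 (fun Z => H Z 0 j) (fun Z => H' Z 0 j).
  apply: (jet_eq_hol oU2 U2p (hol2 j) (hol2' j)) => s sk; apply: jet.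
  by apply: leq_trans sk _; rewrite mulSn leq_addr.
have AA := @subset_refl _ A.
have sQ i l : smooth_on A (fun Z => Q Z i l).
  have -> : (fun Z => Q Z i l) = jet_comb rho' H H' P w (c i) l by apply/funext => Z; rewrite mxE.
  exact: (smooth_jet_comb oA oV' srho' rho0 ballV (fun Z => inG A Z AA) (fun Z => inG' A Z AA)
    (fun l => holW A l AA) (fun l => holW' A l AA) (fun Z => HMW A Z AA) (fun Z => HMW' A Z AA)
    P (ops A oA AA) (c i) l).
(* At [p0] the Hadamard coefficients have the k0-jets of the gradients along [H], so the
   combinations [c i] make [Q p0] the identity. *)
have Q1 : \det (Q p0) != 0.
  suff -> : Q p0 = 1%:M by rewrite det1 oner_eq0.
  apply/matrixP => i l; rewrite !mxE.
  by rewrite (jet_comb_value oA Ap oV' srho' ballV (fun Z => inG A Z AA) (fun Z => inG' A Z AA)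
    (fun l => holW A l AA) (fun l => holW' A l AA) size_w (ops A oA AA)).
have oB := open_neq0 oA (smooth_det oA sQ).
pose B1 := A `&` [set Z | \det (Q Z) != 0].
pose DY Z := \matrix_(k < N, j < N) Y k (true, j) Z.
have B1V0 : B1 `<=` V0 by move=> Z [/AU2[[]]].
have sDY k j : smooth_on B1 (fun Z => DY Z k j).
  have -> : (fun Z => DY Z k j) = Y k (true, j) by apply/funext => Z; rewrite mxE.
  by have [sYk _ _] := YP k; exact: smooth_sub B1V0 (sYk _).
have oW := open_neq0 oB (smooth_det oB sDY).
pose W := B1 `&` [set Z | \det (DY Z) != 0].
have WA : W `<=` A by move=> Z [[]].
have WV0 : W `<=` V0 by move=> Z [/B1V0].
have WV1 : W `<=` V1 by move=> Z /WA/AU2[].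
have Wp : W p0.
  split=> //=; suff -> : DY p0 = (delta p0)%:M by rewrite det_scalar expf_neq0 // delta0.
  apply/matrixP => k j; rewrite !mxE; have [_ -> _] := YP k.
  by rewrite T1 // !mxE eqxx /= -[RHS]mulr_natr (eq_sym j).
pose h l Z := H Z 0 l - H' Z 0 l.
have Hh l : hol W (h l) by exact: (holB oW (holW W l WA) (holW' W l WA)).
have Ih : forall l, conj_ideal M W h k0 (h l).
  apply: (conj_ideal_solve oW Hh (Q := Q)).
  - by move=> i l; exact: smooth_sub WA (sQ i l).
  - by move=> Z [[]].
  move=> i; have := conj_ideal_jet_comb oW oV' srho' rho0 ballV (fun Z => inG W Z WA)
    (fun Z => inG' W Z WA) (fun l => holW W l WA) (fun l => holW' W l WA)
    (fun Z => HMW W Z WA) (fun Z => HMW' W Z WA) size_w (ops W oW WA) (c i).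
  by congr (conj_ideal _ _ _ _ _); apply/funext => Z; apply: eq_bigr => l _; rewrite mxE.
(* All CR and anti-CR fields on [V0] are taken, and not just the basis [L]: the commutators of the
   finite type condition are built from them. *)
pose B := [set b | exists2 X, CR_field d M V0 X \/ antiCR_field d M V0 X & b = field_coefs X].
have tB b : B b -> tangent_op M W b.
  by move=> [X [] [sX tX] ->]; apply: (field_tangent_op (d := d) oW WV0 sX) => Z MZ; exact: (tX Z MZ).1.
have tyB b : B b -> type_op M W true b \/ type_op M W false b.
  move=> [X [] [sX tX] ->]; [left|right] => k Z [MZ /WV0 VZ];
  by rewrite /field_coefs /= (tX Z (conj MZ VZ)).2 mxE.
have flat s l : (size s <= (N + N) * k0)%N -> dZs s (h l) p0 = 0.
  move=> sk; rewrite (dZsB s oU2 (hol2 l) (hol2' l) U2p) jet ?subrr //.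
  by apply: leq_trans sk _; rewrite leq_mul2r leqnSn orbT.
have all_flat : forall s l, dZs s (h l) p0 = 0.
  apply: (reflection_flat oW Wp Mp0 Hh (T := fun k => field_coefs (T k)) (delta := delta) (k0 := k0)
    _ _ _ _ Ih tB tyB flat (Y := Y)).
  - by move=> k; apply: (field_tangent_op oW WV1 (sT k)) => Z; exact: tT.
  - exact: smooth_sub WV1 sdelta.
  - by move=> Z /WV1; exact: delta0.
  - by move=> k j Z /WV1 VZ; rewrite /field_coefs /= T1 // !mxE eqxx /= (eq_sym j).
  - by move=> k l; have [sYk _ _] := YP k; exact: smooth_sub WV0 (sYk l).
  - move=> v Bv stable k u; have [_ _ st] := YP k.
    apply: (st W B v oW Wp WV0 _ _ Bv stable) => [b /tB[] //|X HX]; by exists X.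
  by move=> Z [].
have : \forall Z \near p0, forall l, h l Z = 0.
  apply: (@filter_forall _ _ (fun l Z => h l Z = 0) (nbhs p0)) => l.
  by apply: (hol_flat_eq0 oW Wp (Hh l)) => s; exact: all_flat.
by apply: filterS => Z hZ; apply/rowP => l; apply/eqP; rewrite -subr_eq0; apply/eqP; exact: hZ.
Qed.
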